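(* Let $\mathbf k=\mathbb F_q$ be a finite field. Then $\mathcal H$, with the objects, morphisms, composition and monoidal product defined in the context, is a monoidal category.
   Context: Notation. $\operatorname{Hom}^i(V,W)$: homogeneous linear maps of degree $i$ of $\mathbb Z$-graded $\mathbf k$-vector spaces. Differentials have degree $1$ and square to $0$. For a graded space $V$ with complete flag $F_\bullet V$, $\operatorname{Hom}^i_{<0}(V,V)$ is the set of $h\in\operatorname{Hom}^i(V,V)$ with $h(F_jV)\subseteq F_{j-1}V$ for all $j$. $|\cdot|$ is cardinality. The category $\mathcal H$. Objects: finite-dimensional $\mathbb Z$-graded $\mathbf k$-vector spaces $V=\bigoplus_{i\in\mathbb Z}V_i$ with a complete flag of graded subspaces $F_iV\subseteq V$, $\dim F_iV=i$, $0\le i\le\dim V$. Monoidal product of objects: $(V,F_\bullet V)\otimes(W,F_\bullet W)$ is $V\oplus W$ with complete flag $0=F_0V\subset\dots\subset F_{\dim V}V=V\subset V\oplus F_1W\subset\dots\subset V\oplus F_{\dim W}W=V\oplus W$; the unit object is $0$, and iterated direct sums are identified in the usual way. Morphisms: $\operatorname{Hom}_{\mathcal H}(V,W)$ is the $\mathbb Q$-vector space with basis the set $B(V,W)$ of equivalence classes of triples $(d_V,f,d_W)$, where $d_V\in\operatorname{Hom}^1_{<0}(V,V)$ and $d_W\in\operatorname{Hom}^1_{<0}(W,W)$ are differentials and $f:(V,d_V)\to(W,d_W)$ is a quasi-isomorphism; $(d_V,f,d_W)\sim(d_V',f',d_W')$ if there are grading- and flag-preserving isomorphisms of complexes $\phi:(V,d_V)\to(V,d_V')$,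 $\psi:(W,d_W)\to(W,d_W')$ such that $\psi f$ and $f'\phi$ are homotopic (equivalently, induce the same map on cohomology). Composition (extended bilinearly): for $(d_U,f,d_V)$ representing a morphism $U\to V$ and $(d_V',g,d_W)$ representing a morphism $V\to W$, $$(d_V',g,d_W)\circ(d_U,f,d_V)=\Big(\prod_{i=1}^\infty|\operatorname{Hom}^{-i}_{<0}(V,V)|^{(-1)^i}\Big)\sum_b(d_U,gbf,d_W),$$ sum over all isomorphisms of complexes $b:(V,d_V)\to(V,d_V')$ preserving grading and flag. Monoidal product of morphisms (extended bilinearly): for $(d_U,f,d_V):U\to V$ and $(d_X,g,d_Y):X\to Y$, $$(d_U,f,d_V)\otimes(d_X,g,d_Y)=\Big(\prod_{i=0}^\infty\big(|\operatorname{Hom}^{-i}(X,U)||\operatorname{Hom}^{-i}(Y,V)||\operatorname{Hom}^{-i-1}(X,V)|\big)^{(-1)^{i+1}}\Big)\sum_\delta\left(\begin{bmatrix}d_U&\delta_{11}\\0&d_X\end{bmatrix},\begin{bmatrix}f&\delta_{12}\\0&g\end{bmatrix},\begin{bmatrix}d_V&\delta_{22}\\0&d_Y\end{bmatrix}\right),$$ sum over $\delta=(\delta_{11},\delta_{12},\delta_{22})\in\operatorname{Hom}^1(X,U)\oplus\operatorname{Hom}^0(X,V)\oplus\operatorname{Hom}^1(Y,V)$ with $d_U\delta_{11}+\delta_{11}d_X=0$, $d_V\delta_{22}+\delta_{22}d_Y=0$, $\delta_{12}d_X+f\delta_{11}=d_V\delta_{12}+\delta_{22}g$. *)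

(* Defs.v *)
From HB Require Import structures.
From mathcomp Require Import all_boot all_order all_algebra all_field.
From mathcomp Require Import zify.
From mathcomp Require Import boolp classical_sets fsbigop.

Set Implicit Arguments.
Unset Strict Implicit.
Unset Printing Implicit Defensive.
Import GRing.Theory Num.Theory.

Local Open Scope ring_scope.

Section DirectSum.
Variable k : fieldType.

Definition inl_fun (V W : vectType k) (v : V) : V * W := (v, 0).
Definition inr_fun (V W : vectType k) (w : W) : V * W := (0, w).
Definition ublock_fun (U X V Y : vectType k)
    (a : 'Hom(U, V)) (b : 'Hom(X, V)) (c : 'Hom(X, Y)) (p : U * X) : V * Y :=
  (a p.1 + b p.2, c p.2).
Definition assoc_fun (U V W : vectType k) (p : U * V * W) : U * (V * W) :=
  (p.1.1, (p.1.2, p.2)).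

Fact inl_linear (V W : vectType k) : linear (@inl_fun V W).
Proof.
by move=> a u v; apply/eqP; rewrite xpair_eqE /= scaler0 addr0 !eqxx.
Qed.
Fact inr_linear (V W : vectType k) : linear (@inr_fun V W).
Proof.
by move=> a u v; apply/eqP; rewrite xpair_eqE /= scaler0 addr0 !eqxx.
Qed.
Fact ublock_linear (U X V Y : vectType k) (a : 'Hom(U, V)) (b : 'Hom(X, V))
  (c : 'Hom(X, Y)) : linear (ublock_fun a b c).
Proof.
move=> x [u1 u2] [v1 v2]; apply/eqP.
by rewrite xpair_eqE /= !linearP /= scalerDr addrACA !eqxx.
Qed.
Fact assoc_linear (U V W : vectType k) : linear (@assoc_fun U V W).
Proof. by move=> x [[u1 u2] u3] [[v1 v2] v3]. Qed.

HB.instance Definition _ (V W : vectType k) :=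
  GRing.isLinear.Build k V (V * W)%type *:%R (@inl_fun V W) (@inl_linear V W).
HB.instance Definition _ (V W : vectType k) :=
  GRing.isLinear.Build k W (V * W)%type *:%R (@inr_fun V W) (@inr_linear V W).
HB.instance Definition _ (U X V Y : vectType k) (a : 'Hom(U, V))
    (b : 'Hom(X, V)) (c : 'Hom(X, Y)) :=
  GRing.isLinear.Build k (U * X)%type (V * Y)%type *:%R (ublock_fun a b c)
    (ublock_linear a b c).
HB.instance Definition _ (U V W : vectType k) :=
  GRing.isLinear.Build k (U * V * W)%type (U * (V * W))%type *:%R
    (@assoc_fun U V W) (@assoc_linear U V W).

Definition inl_lf (V W : vectType k) : 'Hom(V, (V * W)%type) :=
  linfun (@inl_fun V W).
Definition inr_lf (V W : vectType k) : 'Hom(W, (V * W)%type) :=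
  linfun (@inr_fun V W).

(* The block matrix [a b; 0 c], acting on columns. *)
Definition ublock (U X V Y : vectType k)
    (a : 'Hom(U, V)) (b : 'Hom(X, V)) (c : 'Hom(X, Y)) :
    'Hom((U * X)%type, (V * Y)%type) :=
  linfun (ublock_fun a b c).

Definition assoc_lf (U V W : vectType k) :
  'Hom((U * V * W)%type, (U * (V * W))%type) := linfun (@assoc_fun U V W).
Definition lunit_lf (U V : vectType k) : 'Hom((U * V)%type, V) :=
  linfun snd.
Definition runit_lf (U V : vectType k) : 'Hom((U * V)%type, U) :=
  linfun fst.

Definition osum (V W : vectType k) (A : {vspace V}) (B : {vspace W}) :
    {vspace (V * W)%type} :=
  (inl_lf V W @: A + inr_lf V W @: B)%VS.

Lemma inl_lfE (V W : vectType k) (v : V) : inl_lf V W v = (v, 0).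
Proof. exact: lfunE. Qed.
Lemma inr_lfE (V W : vectType k) (w : W) : inr_lf V W w = (0, w).
Proof. exact: lfunE. Qed.
Lemma ublockE (U X V Y : vectType k) (a : 'Hom(U, V)) (b : 'Hom(X, V))
  (c : 'Hom(X, Y)) p : ublock a b c p = (a p.1 + b p.2, c p.2).
Proof. exact: lfunE. Qed.
Lemma assoc_lfE (U V W : vectType k) p :
  assoc_lf U V W p = (p.1.1, (p.1.2, p.2)).
Proof. exact: lfunE. Qed.
Lemma lunit_lfE (U V : vectType k) p : lunit_lf U V p = p.2.
Proof. exact: lfunE. Qed.
Lemma runit_lfE (U V : vectType k) p : runit_lf U V p = p.1.
Proof. exact: lfunE. Qed.

Lemma memv_osum (V W : vectType k) (A : {vspace V}) (B : {vspace W}) p :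
  (p \in osum A B) = (p.1 \in A) && (p.2 \in B).
Proof.
apply/idP/andP.
  case/memv_addP => _ /memv_imgP[a Aa ->] [_ /memv_imgP[b Bb ->] ->].
  by rewrite inl_lfE inr_lfE /= addr0 add0r.
case: p => a b /= [Aa Bb].
have ->: (a, b) = inl_lf V W a + inr_lf V W b.
  by rewrite inl_lfE inr_lfE; apply/eqP; rewrite xpair_eqE /= addr0 add0r !eqxx.
by apply: memv_add; apply: memv_img.
Qed.

Lemma dim_osum (V W : vectType k) (A : {vspace V}) (B : {vspace W}) :
  \dim (osum A B) = (\dim A + \dim B)%N.
Proof.
rewrite dimv_disjoint_sum.
  congr (_ + _)%N; apply: limg_dim_eq; apply/eqP; rewrite -subv0;
    apply/subvP=> x; rewrite memv_cap memv_ker memv0 => /andP[_].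
  - by rewrite inl_lfE => /eqP[->].
  - by rewrite inr_lfE => /eqP[->].
apply/eqP; rewrite -subv0; apply/subvP=> x; rewrite memv_cap memv0.
case/andP=> /memv_imgP[a _ ->] /memv_imgP[b _].
by rewrite inl_lfE inr_lfE => -[-> _].
Qed.

Lemma osumS (V W : vectType k) (A A' : {vspace V}) (B B' : {vspace W}) :
  (A <= A')%VS -> (B <= B')%VS -> (osum A B <= osum A' B')%VS.
Proof. by move=> sA sB; apply: addvS; apply: limgS. Qed.

Lemma osum_sum (V W : vectType k) (I : Type) (s : seq I)
    (F : I -> {vspace V}) (G : I -> {vspace W}) :
  (\sum_(i <- s) osum (F i) (G i) =
   osum (\sum_(i <- s) F i) (\sum_(i <- s) G i))%VS.
Proof. by rewrite /osum !limg_sum big_split. Qed.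

Lemma sumvS (V : vectType k) (I : Type) (s : seq I) (F G : I -> {vspace V}) :
  (forall i, F i <= G i)%VS -> (\sum_(i <- s) F i <= \sum_(i <- s) G i)%VS.
Proof.
by move=> FG; elim: s => [|i s IHs]; rewrite ?big_nil ?sub0v // !big_cons addvS.
Qed.

Lemma osum_full (V W : vectType k) : osum {: V} {: W} = fullv.
Proof. by apply/vspaceP=> p; rewrite memv_osum !memvf. Qed.

End DirectSum.

Definition independent (k : fieldType) (V : vectType k)
    (gr : int -> {vspace V}) : Prop :=
  forall s : seq int, uniq s -> directv (\sum_(i <- s) gr i).

(* U is spanned by its homogeneous pieces U :&: gr i. *)
Definition graded_sub (k : fieldType) (V : vectType k)
    (gr : int -> {vspace V}) (U : {vspace V}) : Prop :=
  exists s : seq int, U = (\sum_(i <- s) (U :&: gr i))%VS.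

(* The flag is extended to all of nat by fl j = V for j >= dim V, which is
   what fl_dim forces. *)
Record flagspace (k : fieldType) := FlagSpace {
  fs_space :> vectType k;
  gr : int -> {vspace fs_space};
  fl : nat -> {vspace fs_space};
  gr_direct : independent gr;
  gr_full : graded_sub gr fullv;
  fl_dim : forall j, \dim (fl j) = minn j (\dim {: fs_space});
  fl_incr : forall j, (fl j <= fl j.+1)%VS;
  fl_graded : forall j, graded_sub gr (fl j)
}.

Section FlagSpaces.
Variable k : fieldType.
Implicit Types U V W X Y : flagspace k.

Lemma fl_full V j : (\dim {: V} <= j)%N -> fl V j = fullv.
Proof.
move=> lej; apply/eqP; rewrite eqEdim subvf /= fl_dim.
by rewrite (minn_idPr lej).
Qed.


Section Unit.
Let Z : vectType k := 'rV[k]_0.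

Lemma zero_eq0 (v : Z) : v = 0.
Proof. by apply/rowP; case. Qed.

Lemma zero_vspace (A : {vspace Z}) : A = 0%VS.
Proof. by apply/vspaceP=> v; rewrite (zero_eq0 v) !mem0v. Qed.

Fact unit_direct : @independent k Z (fun=> 0%VS).
Proof.
by move=> s _; rewrite directvE /= [X in \dim X]zero_vspace dimv0 big1_seq.
Qed.

Fact unit_graded (A : {vspace Z}) : graded_sub (fun=> 0%VS) A.
Proof. by exists [::]; rewrite big_nil; apply: zero_vspace. Qed.

Fact unit_fl_dim (j : nat) : \dim (0 : {vspace Z}) = minn j (\dim {: Z}).
Proof. by rewrite [fullv]zero_vspace dimv0 minn0. Qed.

Definition unit_space : flagspace k :=
  @FlagSpace k Z (fun=> 0%VS) (fun=> 0%VS) unit_direct (unit_graded _)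
    unit_fl_dim (fun=> subvv _) (fun=> unit_graded _).

End Unit.

Section Tensor.
Variables V W : flagspace k.
Let VW : vectType k := (V * W)%type.
Let grVW (i : int) : {vspace VW} := osum (gr V i) (gr W i).

(* 0 = F_0 V <= ... <= V <= V + F_1 W <= ... : the V-part is constant once
   j >= dim V, and fl W 0 = 0. *)
Let flVW (j : nat) : {vspace VW} :=
  osum (fl V j) (fl W (j - \dim {: V})).

Fact tens_direct : independent grVW.
Proof.
move=> s us; rewrite directvE /= osum_sum dim_osum.
have /directvP /= -> := gr_direct V us; have /directvP /= -> := gr_direct W us.
by rewrite -big_split /=; apply/eqP/eq_bigr => i _; apply/esym/dim_osum.
Qed.

Lemma graded_osum (A : {vspace V}) (B : {vspace W}) :
  graded_sub (gr V) A -> graded_sub (gr W) B -> graded_sub grVW (osum A B).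
Proof.
move=> [s defA] [t defB]; exists (s ++ t); apply/eqP; rewrite eqEsubv.
apply/andP; split; last first.
  by elim/big_ind: _ => [|C D sC sD|i _]; rewrite ?sub0v ?subv_add ?sC ?capvSl.
rewrite big_cat /= /osum [in X in (X <= _)%VS]defA [in X in (X <= _)%VS]defB.
rewrite !limg_sum; apply: addvS; apply: sumvS => i.
  by apply: (subv_trans (limg_cap _ _ _)); apply/capvS/addvSl/addvSl.
by apply: (subv_trans (limg_cap _ _ _)); apply/capvS/addvSr/addvSr.
Qed.

Fact tens_full : graded_sub grVW fullv.
Proof. by rewrite -osum_full; apply: graded_osum; apply: gr_full. Qed.

Fact tens_fl_dim j : \dim (flVW j) = minn j (\dim {: VW}).
Proof.
have -> : \dim {: VW} = (\dim {: V} + \dim {: W})%N.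
  by rewrite -(osum_full V W); apply: dim_osum.
have -> : \dim (flVW j) = _ := dim_osum _ _.
by rewrite !fl_dim; lia.
Qed.

Fact tens_fl_incr j : (flVW j <= flVW j.+1)%VS.
Proof.
apply: osumS; first exact: fl_incr.
have [le|lt] := leqP (\dim {: V}) j; first by rewrite subSn // fl_incr.
have /eqP-> : (j - \dim {: V} == 0)%N by rewrite subn_eq0 ltnW.
by have /eqP-> : (j.+1 - \dim {: V} == 0)%N by rewrite subn_eq0.
Qed.

Fact tens_fl_graded j : graded_sub grVW (flVW j).
Proof. by apply: graded_osum; apply: fl_graded. Qed.

Definition tens_space : flagspace k :=
  @FlagSpace k VW grVW flVW tens_direct tens_full tens_fl_dim tens_fl_incr
    tens_fl_graded.

End Tensor.
End FlagSpaces.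

Section MonoidalCategory.
Variables (obj : Type) (hom : obj -> obj -> Type).
Variables (idm : forall A, hom A A)
  (comp : forall A B C, hom B C -> hom A B -> hom A C).

Record is_category : Prop := IsCategory {
  comp_assoc : forall A B C D (h : hom C D) (g : hom B C) (f : hom A B),
    comp h (comp g f) = comp (comp h g) f;
  comp_idl : forall A B (f : hom A B), comp (idm B) f = f;
  comp_idr : forall A B (f : hom A B), comp f (idm A) = f
}.

Definition is_iso A B (f : hom A B) : Prop :=
  exists g : hom B A, comp g f = idm A /\ comp f g = idm B.

Variables (one : obj) (tens : obj -> obj -> obj)
  (tensm : forall A B C D, hom A B -> hom C D -> hom (tens A C) (tens B D)).
Variables
  (assoc : forall A B C, hom (tens (tens A B) C) (tens A (tens B C)))
  (lunit : forall A, hom (tens one A) A)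
  (runit : forall A, hom (tens A one) A).

Record is_monoidal_category : Prop := IsMonoidalCategory {
  moncat_category : is_category;
  tens_id : forall A B, tensm (idm A) (idm B) = idm (tens A B);
  tens_comp : forall A B C A' B' C' (g : hom B C) (f : hom A B)
      (g' : hom B' C') (f' : hom A' B'),
    tensm (comp g f) (comp g' f') = comp (tensm g g') (tensm f f');
  assoc_iso : forall A B C, is_iso (assoc A B C);
  lunit_iso : forall A, is_iso (lunit A);
  runit_iso : forall A, is_iso (runit A);
  assoc_nat : forall A A' B B' C C' (f : hom A A') (g : hom B B')
      (h : hom C C'),
    comp (assoc A' B' C') (tensm (tensm f g) h) =
    comp (tensm f (tensm g h)) (assoc A B C);
  lunit_nat : forall A B (f : hom A B),
    comp (lunit B) (tensm (idm one) f) = comp f (lunit A);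
  runit_nat : forall A B (f : hom A B),
    comp (runit B) (tensm f (idm one)) = comp f (runit A);
  pentagon : forall A B C D,
    comp (assoc A B (tens C D)) (assoc (tens A B) C D) =
    comp (tensm (idm A) (assoc B C D))
      (comp (assoc A (tens B C) D) (tensm (assoc A B C) (idm D)));
  triangle : forall A B,
    comp (tensm (idm A) (lunit B)) (assoc A one B) =
    tensm (runit A) (idm B)
}.
End MonoidalCategory.
Arguments is_monoidal_category {obj hom} idm comp one tens tensm assoc lunit runit.

Section GradedMaps.
Variable k : fieldType.
Implicit Types U V W X Y : flagspace k.

Definition hdeg V W (i : int) (h : 'Hom(V, W)) : Prop :=
  forall j : int, (h @: gr V j <= gr W (j + i))%VS.

Definition lowers_flag V (h : 'End(V)) : Prop :=
  forall j : nat, (h @: fl V j.+1 <= fl V j)%VS.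

Definition is_diff V (d : 'End(V)) : Prop :=
  [/\ hdeg 1 d, lowers_flag d & (d \o d)%VF = 0].

(* The cohomology of (V, d) is ker d / im d; the last two clauses say that the
   map induced by f on cohomology is injective and surjective. *)
Definition quasi_iso V W (d : 'End(V)) (e : 'End(W)) (f : 'Hom(V, W)) : Prop :=
  [/\ hdeg 0 f, (f \o d = e \o f)%VF,
      forall v, d v = 0 -> (exists w, f v = e w) -> exists u, v = d u
    & forall w, e w = 0 -> exists2 v, d v = 0 & exists w', w = f v + e w'].

Definition homotopic V W (d : 'End(V)) (e : 'End(W)) (f g : 'Hom(V, W)) :
    Prop :=
  exists2 h : 'Hom(V, W), hdeg (-1) h & f - g = (e \o h)%VF + (h \o d)%VF.

(* Isomorphisms preserving grading and flag. *)
Definition fg_iso V W (phi : 'Hom(V, W)) : Prop :=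
  [/\ lker phi = 0%VS, forall i, (phi @: gr V i)%VS = gr W i
    & forall j, (phi @: fl V j)%VS = fl W j].

Definition cx_iso V (d d' : 'End(V)) (b : 'End(V)) : Prop :=
  fg_iso b /\ (b \o d = d' \o b)%VF.

Lemma hdegP V W i (h : 'Hom(V, W)) :
  hdeg i h <-> forall j v, v \in gr V j -> h v \in gr W (j + i).
Proof.
split=> [hh j v Vv|hh j]; first by apply: (subvP (hh j)); apply: memv_img.
by apply/subvP=> _ /memv_imgP[v Vv ->]; apply: hh.
Qed.

Lemma hdeg_comp U V W i j (g : 'Hom(V, W)) (f : 'Hom(U, V)) :
  hdeg i f -> hdeg j g -> hdeg (i + j) (g \o f)%VF.
Proof.
move=> hf hg l; rewrite limg_comp addrA.
exact: subv_trans (limgS _ (hf l)) (hg _).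
Qed.

Lemma hdegD V W i (f g : 'Hom(V, W)) : hdeg i f -> hdeg i g -> hdeg i (f + g).
Proof.
move=> /hdegP hf /hdegP hg; apply/hdegP=> j v Vv.
by rewrite add_lfunE memvD ?hf ?hg.
Qed.

Lemma hdegN V W i (f : 'Hom(V, W)) : hdeg i f -> hdeg i (- f).
Proof.
by move=> /hdegP hf; apply/hdegP=> j v Vv; rewrite opp_lfunE memvN hf.
Qed.

Lemma fg_iso_hdeg V W (phi : 'Hom(V, W)) : fg_iso phi -> hdeg 0 phi.
Proof. by case=> _ grphi _ j; rewrite grphi addr0. Qed.

Lemma fg_isoK V W (phi : 'Hom(V, W)) : fg_iso phi -> cancel phi phi^-1%VF.
Proof. by case=> kphi _ _; apply/lker0_lfunK/eqP. Qed.

Lemma fg_isoVK V W (phi : 'Hom(V, W)) : fg_iso phi -> cancel phi^-1%VF phi.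
Proof.
case=> _ _ flphi w; apply: limg_lfunVK.
have := flphi (\dim {: V} + \dim {: W})%N.
by rewrite !fl_full ?leq_addl ?leq_addr // => ->; apply: memvf.
Qed.

Lemma fg_iso_comp U V W (psi : 'Hom(V, W)) (phi : 'Hom(U, V)) :
  fg_iso phi -> fg_iso psi -> fg_iso (psi \o phi)%VF.
Proof.
move=> iphi ipsi; split.
- apply/eqP/lker0P => x y; rewrite !comp_lfunE.
  by move/(can_inj (fg_isoK ipsi))/(can_inj (fg_isoK iphi)).
- by case: iphi ipsi => _ e _ [_ e' _] i; rewrite limg_comp e e'.
- by case: iphi ipsi => _ _ e [_ _ e'] i; rewrite limg_comp e e'.
Qed.

Lemma fg_iso_inv V W (phi : 'Hom(V, W)) : fg_iso phi -> fg_iso phi^-1%VF.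
Proof.
move=> iphi; have phiK := fg_isoK iphi; have phiVK := fg_isoVK iphi.
have img A B : (phi @: A)%VS = B -> (phi^-1%VF @: B)%VS = A.
  move=> <-; apply/vspaceP=> v; rewrite -limg_comp.
  suff -> : (phi^-1 \o phi)%VF = \1%VF by rewrite lim1g.
  by apply/lfunP=> x; rewrite comp_lfunE phiK id_lfunE.
split; last 2 first.
- by case: iphi => _ e _ i; apply: img.
- by case: iphi => _ _ e j; apply: img.
by apply/eqP/lker0P; apply: can_inj phiVK.
Qed.

Lemma fg_iso1 V : fg_iso (\1 : 'End(V))%VF.
Proof.
split=> [|i|j]; rewrite ?lim1g //.
by apply/eqP/lker0P => x y; rewrite !id_lfunE.
Qed.

Lemma quasi_iso_cx_iso V (d d' b : 'End(V)) :
  cx_iso d d' b -> quasi_iso d d' b.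
Proof.
case=> ib bd; have bK := fg_isoK ib; have bVK := fg_isoVK ib.
have bdE v : b (d v) = d' (b v).
  by have /lfunP/(_ v) := bd; rewrite !comp_lfunE.
split=> [||v _ [w bv]|w dw] //; first exact: fg_iso_hdeg.
  exists (b^-1%VF w); apply: (can_inj bK); rewrite bdE bVK //.
exists (b^-1%VF w); last by exists 0; rewrite bVK linear0 addr0.
by apply: (can_inj bK); rewrite bdE bVK dw linear0.
Qed.

Lemma quasi_iso_comp U V W (d : 'End(U)) (e : 'End(V)) (c : 'End(W))
    (g : 'Hom(V, W)) (f : 'Hom(U, V)) : (e \o e)%VF = 0 ->
  quasi_iso d e f -> quasi_iso e c g -> quasi_iso d c (g \o f)%VF.
Proof.
move=> e2 [f0 fd finj fsurj] [g0 ge ginj gsurj].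
have fdE v : f (d v) = e (f v).
  by have /lfunP/(_ v) := fd; rewrite !comp_lfunE.
have geE v : g (e v) = c (g v).
  by have /lfunP/(_ v) := ge; rewrite !comp_lfunE.
split.
- by rewrite -(addr0 0); apply: hdeg_comp.
- by rewrite -comp_lfunA fd !comp_lfunA ge.
- move=> v dv [w]; rewrite comp_lfunE => gfv.
  apply: finj => //; apply: ginj; last by exists w.
  by rewrite -fdE dv linear0.
move=> w cw; have [v ev [w' ->]] := gsurj w cw.
have [u du [v' ->]] := fsurj v ev; exists u => //; exists (g v' + w').
by rewrite comp_lfunE !linearD /= geE addrA.
Qed.

Lemma quasi_iso_push V W X (d : 'End(V)) (e : 'End(W)) (f : 'Hom(V, W))
    (phi : 'Hom(W, X)) :
  fg_iso phi -> quasi_iso d e f ->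
  quasi_iso d (phi \o e \o phi^-1)%VF (phi \o f)%VF.
Proof.
move=> iphi [f0 fd finj fsurj].
have phiK := fg_isoK iphi; have phiVK := fg_isoVK iphi.
have fdE v : f (d v) = e (f v).
  by have /lfunP/(_ v) := fd; rewrite !comp_lfunE.
split.
- by rewrite -(addr0 0); apply: hdeg_comp => //; apply: fg_iso_hdeg.
- by apply/lfunP=> v; rewrite !comp_lfunE fdE phiK.
- move=> v dv [z]; rewrite !comp_lfunE => /(can_inj phiK) fv.
  by apply: finj => //; exists (phi^-1%VF z).
move=> z; rewrite !comp_lfunE => ez.
have {}ez : e (phi^-1%VF z) = 0.
  by apply: (can_inj phiK); rewrite ez linear0.
have [v dv [w defz]] := fsurj _ ez; exists v => //; exists (phi w).
by rewrite !comp_lfunE phiK -linearD /= -defz phiVK.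
Qed.

Lemma is_diff_push V W (d : 'End(V)) (phi : 'Hom(V, W)) :
  fg_iso phi -> is_diff d -> is_diff (phi \o d \o phi^-1)%VF.
Proof.
move=> iphi [d1 dlt dd]; have phiK := fg_isoK iphi.
have [ker grp flp] := iphi; have [_ grv flv] := fg_iso_inv iphi.
split.
- move=> j; rewrite !limg_comp grv.
  by rewrite -grp; apply: limgS; apply: d1.
- move=> j; rewrite !limg_comp flv -flp; apply: limgS; exact: dlt.
apply/lfunP=> w; rewrite !comp_lfunE phiK.
have /lfunP/(_ (phi^-1%VF w)) := dd.
by rewrite comp_lfunE !zero_lfunE => ->; rewrite linear0.
Qed.

Lemma is_diff_tens U X (dU : 'End(U)) (dX : 'End(X)) (delta : 'Hom(X, U)) :
  is_diff dU -> is_diff dX -> hdeg 1 delta ->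
  (dU \o delta)%VF + (delta \o dX)%VF = 0 ->
  is_diff (ublock dU delta dX : 'End(tens_space U X)).
Proof.
move=> [/hdegP dU1 dUlt dU2] [/hdegP dX1 dXlt dX2] /hdegP de1 de2; split.
- apply/hdegP=> j p; rewrite !memv_osum ublockE /= => /andP[p1 p2].
  by rewrite memvD ?dU1 ?dX1 ?de1.
- move=> j; apply/subvP=> _ /memv_imgP[p Vp ->].
  move: Vp; rewrite !memv_osum ublockE /= => /andP[p1 p2].
  have [le|lt] := leqP (\dim {: U}) j.
    rewrite fl_full // memvf /=; apply: (subvP (dXlt _)); apply: memv_img.
    by rewrite -subSn.
  have p20 : p.2 = 0.
    apply/eqP; rewrite -memv0; suff <- : fl X (j.+1 - \dim {: U}) = 0%VS by [].
    by apply/eqP; rewrite -dimv_eq0 fl_dim (eqP lt) min0n.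
  rewrite p20 !linear0 addr0 mem0v andbT.
  by apply: (subvP (dUlt _)); apply: memv_img.
apply/lfunP=> p; rewrite comp_lfunE !ublockE /= zero_lfunE.
have /lfunP/(_ p.1) := dU2; have /lfunP/(_ p.2) := dX2.
have /lfunP/(_ p.2) := de2.
rewrite add_lfunE !comp_lfunE !zero_lfunE linearD /= -addrA => -> -> ->.
by rewrite addr0.
Qed.

Lemma quasi_iso_tens U V X Y (dU : 'End(U)) (dV : 'End(V)) (dX : 'End(X))
    (dY : 'End(Y)) (f : 'Hom(U, V)) (g : 'Hom(X, Y))
    (d11 : 'Hom(X, U)) (d12 : 'Hom(X, V)) (d22 : 'Hom(Y, V)) :
  (dY \o dY)%VF = 0 ->
  quasi_iso dU dV f -> quasi_iso dX dY g ->
  hdeg 0 d12 ->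
  (dU \o d11)%VF + (d11 \o dX)%VF = 0 -> (dV \o d22)%VF + (d22 \o dY)%VF = 0 ->
  (d12 \o dX)%VF + (f \o d11)%VF = (dV \o d12)%VF + (d22 \o g)%VF ->
  quasi_iso (ublock dU d11 dX : 'End(tens_space U X))
    (ublock dV d22 dY : 'End(tens_space V Y))
    (ublock f d12 g : 'Hom(tens_space U X, tens_space V Y)).
Proof.
move=> dY2 [/hdegP f0 fd finj fsurj] [/hdegP g0 gd ginj gsurj] /hdegP h0.
move=> e11 e22 e12.
have {}fd v : f (dU v) = dV (f v).
  by have /lfunP/(_ v) := fd; rewrite !comp_lfunE.
have {}gd v : g (dX v) = dY (g v).
  by have /lfunP/(_ v) := gd; rewrite !comp_lfunE.
have {}dY2 y : dY (dY y) = 0.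
  by have /lfunP/(_ y) := dY2; rewrite comp_lfunE zero_lfunE.
have {}e11 x : dU (d11 x) = - d11 (dX x).
  apply/eqP; rewrite -addr_eq0; apply/eqP.
  by have /lfunP/(_ x) := e11; rewrite add_lfunE !comp_lfunE zero_lfunE.
have {}e22 y : dV (d22 y) = - d22 (dY y).
  apply/eqP; rewrite -addr_eq0; apply/eqP.
  by have /lfunP/(_ y) := e22; rewrite add_lfunE !comp_lfunE zero_lfunE.
have {}e12 x : f (d11 x) = dV (d12 x) + d22 (g x) - d12 (dX x).
  have /lfunP/(_ x) := e12; rewrite !add_lfunE !comp_lfunE => <-.
  by rewrite addrAC subrr add0r.
split.
- apply/hdegP=> j p; rewrite !memv_osum ublockE /= => /andP[p1 p2].
  by rewrite memvD ?f0 ?h0 ?g0.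
- apply/lfunP=> p; rewrite !comp_lfunE !ublockE /= !linearD /= fd gd e12.
  by congr (_, _); rewrite -!addrA addNr addr0.
- move=> [u x]; rewrite ublockE /= => -[du dx] [[v y]].
  rewrite !ublockE /= => -[fu gx].
  have [x' defx] := ginj x dx (ex_intro _ y gx).
  have [x2 dx2 [y2 defy]] : exists2 x2, dX x2 = 0 &
      exists y2, y - g x' = g x2 + dY y2.
    by apply: gsurj; rewrite linearB /= -gx -gd -defx subrr.
  have {}fu : f u = dV v + d22 y - d12 x by rewrite -fu addrK.
  have [||u' defu] := finj (u - d11 x' - d11 x2).
  + rewrite !linearB /= !e11 dx2 linear0 -defx opprK oppr0 subr0.
    by [].
  + exists (v - d12 x' - d12 x2 - d22 y2).
    rewrite !linearB /= fu !e12 dx2 linear0 -defx subr0 e22 opprK.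
    have -> : y = g x' + g x2 + dY y2 by rewrite -addrA -defy addrC subrK.
    rewrite !linearD /= !opprK !addrA.
    by rewrite [LHS](ACl (1*6*9*4*(2*7)*(3*10)*(8*5))) /= !subrr !addr0.
  exists (u', x' + x2); rewrite ublockE /= !linearD /= -defu dx2 addr0 -defx.
  by rewrite -[u - _ - _]addrA -opprD subrK.
move=> [v y]; rewrite ublockE /= => -[dv dy].
have [x dx [y' defy]] := gsurj y dy.
have dV1 : dV (v - d12 x - d22 y') = - f (d11 x).
  move/eqP: dv; rewrite addr_eq0 => /eqP dv.
  rewrite !linearB /= e12 dx linear0 subr0 e22 opprK dv defy.
  by rewrite linearD /= !opprD [LHS](ACl (3*1*(2*4))) /= addNr addr0.
have [||u0 defu0] := finj (d11 x).
- by rewrite e11 dx linear0 oppr0.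
- by exists (- (v - d12 x - d22 y')); rewrite (linearN dV) /= dV1 opprK.
have [|u1 du1 [v' defv]] := fsurj (v - d12 x - d22 y' + f u0).
  by rewrite linearD /= dV1 -fd -defu0 addNr.
exists (u1 - u0, x).
  by rewrite ublockE /= linearB /= du1 dx -defu0 sub0r addNr.
exists (v', y'); rewrite !ublockE /= defy; congr (_, _).
rewrite linearB /= !addrA [RHS](ACl ((1*4)*2*3*5)) /= -defv.
by rewrite [RHS](ACl (1*(4*5)*(2*6)*(3*7))) /= subrr !addNr !addr0.
Qed.

Lemma dim_tens V W :
  \dim {: tens_space V W} = (\dim {: V} + \dim {: W})%N.
Proof. by rewrite -(osum_full V W); apply: dim_osum. Qed.

Lemma fg_iso_assoc U V W :
  fg_iso (assoc_lf U V W :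
    'Hom(tens_space (tens_space U V) W, tens_space U (tens_space V W))).
Proof.
have img (A : {vspace U}) (B : {vspace V}) (C : {vspace W}) :
    (assoc_lf U V W @: osum (osum A B) C)%VS = osum A (osum B C).
  apply/vspaceP=> -[u [v w]]; apply/memv_imgP/idP => [[[[u' v'] w']]|].
    by rewrite assoc_lfE !memv_osum /= => /andP[/andP[? ?] ?] [-> -> ->]; apply/and3P.
  rewrite !memv_osum /= => /and3P[? ? ?]; exists (u, v, w).
    by rewrite !memv_osum /=; apply/andP; split=> //; apply/andP.
  by rewrite assoc_lfE.
split=> [|i|j]; last 2 [exact: img].
  apply/eqP/lker0P => -[[u v] w] [[u' v'] w'].
  by rewrite !assoc_lfE /= => -[-> -> ->].
by rewrite /= -subnDA -dim_tens.
Qed.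

Lemma fg_iso_lunit V : fg_iso (lunit_lf _ V : 'Hom(tens_space (unit_space k) V, V)).
Proof.
have img (B : {vspace V}) :
    (lunit_lf _ V @: osum (0 : {vspace unit_space k}) B)%VS = B.
  apply/vspaceP=> v; apply/memv_imgP/idP => [[[z v']]|Bv].
    by rewrite lunit_lfE memv_osum /= => /andP[_ ?] ->.
  by exists (0, v); rewrite ?lunit_lfE // memv_osum mem0v.
split=> [|i|j]; try exact: img.
  apply/eqP/lker0P => -[z v] [z' v'].
  by rewrite !lunit_lfE /= (zero_eq0 z) (zero_eq0 z') => ->.
by rewrite [LHS]img [fullv]zero_vspace dimv0 subn0.
Qed.

Lemma fg_iso_runit V : fg_iso (runit_lf V _ : 'Hom(tens_space V (unit_space k), V)).
Proof.
have img (A : {vspace V}) :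
    (runit_lf V _ @: osum A (0 : {vspace unit_space k}))%VS = A.
  apply/vspaceP=> v; apply/memv_imgP/idP => [[[v' z]]|Av].
    by rewrite runit_lfE memv_osum /= => /andP[? _] ->.
  by exists (v, 0); rewrite ?runit_lfE // memv_osum mem0v andbT.
split=> [|i|j]; try exact: img.
apply/eqP/lker0P => -[v z] [v' z'].
by rewrite !runit_lfE /= (zero_eq0 z) (zero_eq0 z') => ->.
Qed.

End GradedMaps.

Section CategoryH.
Variable k : finFieldType.
Implicit Types U V W X Y : flagspace k.

Definition is_qtriple V W (d : 'End(V)) (f : 'Hom(V, W)) (e : 'End(W)) : Prop :=
  [/\ is_diff d, is_diff e & quasi_iso d e f].

(* finvect_type makes the (finite) spaces of linear maps into finTypes. *)
Record qtriple V W := QTriple {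
  qraw : finvect_type 'End(V) * finvect_type 'Hom(V, W) * finvect_type 'End(W);
  _ : `[< is_qtriple qraw.1.1 qraw.1.2 qraw.2 >]
}.

HB.instance Definition _ V W := [isSub for @qraw V W].
HB.instance Definition _ V W := [Finite of qtriple V W by <:].

Definition dsrc V W (t : qtriple V W) : 'End(V) := (qraw t).1.1.
Definition qmap V W (t : qtriple V W) : 'Hom(V, W) := (qraw t).1.2.
Definition dtgt V W (t : qtriple V W) : 'End(W) := (qraw t).2.

Lemma qtripleP V W (t : qtriple V W) : is_qtriple (dsrc t) (qmap t) (dtgt t).
Proof. by apply/asboolP; case: t. Qed.

Definition mk_qtriple V W (d : 'End(V)) (f : 'Hom(V, W)) (e : 'End(W))
    (h : is_qtriple d f e) : qtriple V W :=
  @QTriple V W (d, f, e) (asboolT h).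

Definition qtriple_equiv V W (s t : qtriple V W) : Prop :=
  exists (phi : 'End(V)) (psi : 'End(W)),
    [/\ cx_iso (dsrc s) (dsrc t) phi, cx_iso (dtgt s) (dtgt t) psi
      & homotopic (dsrc s) (dtgt t) (psi \o qmap s)%VF (qmap t \o phi)%VF].

Lemma qtriple_equiv_refl V W (t : qtriple V W) : qtriple_equiv t t.
Proof.
exists \1%VF, \1%VF; split; try by split; [exact: fg_iso1 | rewrite comp_lfun1l comp_lfun1r].
exists 0; first by move=> j; rewrite lim0g sub0v.
by rewrite comp_lfun1l comp_lfun1r subrr comp_lfun0l comp_lfun0r addr0.
Qed.

Lemma qtriple_equiv_sym V W (s t : qtriple V W) :
  qtriple_equiv s t -> qtriple_equiv t s.
Proof.
move=> [phi [psi [[iphi cphi] [ipsi cpsi] [h h1 hE]]]].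
have phiK := fg_isoK iphi; have phiVK := fg_isoVK iphi.
have psiK := fg_isoK ipsi; have psiVK := fg_isoVK ipsi.
have cphi' v : phi (dsrc s v) = dsrc t (phi v).
  by have /lfunP/(_ v) := cphi; rewrite !comp_lfunE.
have cpsi' v : psi (dtgt s v) = dtgt t (psi v).
  by have /lfunP/(_ v) := cpsi; rewrite !comp_lfunE.
exists phi^-1%VF, psi^-1%VF; split.
- split; first exact: fg_iso_inv.
  apply/lfunP=> v; rewrite !comp_lfunE; apply: (can_inj phiK).
  by rewrite cphi' !phiVK.
- split; first exact: fg_iso_inv.
  apply/lfunP=> v; rewrite !comp_lfunE; apply: (can_inj psiK).
  by rewrite cpsi' !psiVK.
exists (- (psi^-1 \o h \o phi^-1)%VF).
  apply: hdegN; rewrite -[-1]addr0 -[X in hdeg X]add0r; apply: hdeg_comp.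
    exact/fg_iso_hdeg/fg_iso_inv.
  by apply: hdeg_comp => //; exact/fg_iso_hdeg/fg_iso_inv.
apply/lfunP=> v; have /lfunP/(_ (phi^-1%VF v)) := hE.
have defd : phi^-1%VF (dsrc t v) = dsrc s (phi^-1%VF v).
  by apply: (can_inj phiK); rewrite cphi' !phiVK.
rewrite !(add_lfunE, opp_lfunE, comp_lfunE) phiVK defd => hEv.
apply: (can_inj psiK); rewrite linearB linearD !linearN /= cpsi' !psiVK.
by rewrite -opprD -hEv opprB.
Qed.

Lemma qtriple_equiv_trans V W (r s t : qtriple V W) :
  qtriple_equiv r s -> qtriple_equiv s t -> qtriple_equiv r t.
Proof.
move=> [phi [psi [[iphi cphi] [ipsi cpsi] [h h1 hE]]]].
move=> [phi' [psi' [[iphi' cphi'] [ipsi' cpsi'] [h' h'1 h'E]]]].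
exists (phi' \o phi)%VF, (psi' \o psi)%VF; split.
- by split; [exact: fg_iso_comp | rewrite -comp_lfunA cphi !comp_lfunA cphi'].
- by split; [exact: fg_iso_comp | rewrite -comp_lfunA cpsi !comp_lfunA cpsi'].
exists ((psi' \o h)%VF + (h' \o phi)%VF).
  apply: hdegD; first by rewrite -[-1]addr0; apply: hdeg_comp => //; apply: fg_iso_hdeg.
  by rewrite -[-1]add0r; apply: hdeg_comp => //; apply: fg_iso_hdeg.
apply/lfunP=> v; have /lfunP/(_ v)/(congr1 psi') := hE.
have /lfunP/(_ (phi v)) := h'E.
have /lfunP/(_ v) := cphi; have /lfunP/(_ (h v)) := cpsi'.
rewrite !(add_lfunE, opp_lfunE, comp_lfunE) => cE dE E2.
rewrite linearB linearD /= => E1.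
by rewrite linearD /= -cE dE addrACA -E1 -E2 addrA subrK.
Qed.

Definition qtriple_rel V W : rel (qtriple V W) :=
  fun s t => `[< qtriple_equiv s t >].

(* The set B(V, W) of equivalence classes of triples. *)
Definition Bset V W :=
  {C : {set qtriple V W} | [exists t, C == [set u | qtriple_rel t u]]}.

Fact qclass_proof V W (t : qtriple V W) :
  [exists u, [set v | qtriple_rel t v] == [set v | qtriple_rel u v]].
Proof. by apply/existsP; exists t. Qed.

Definition qclass V W (t : qtriple V W) : Bset V W :=
  exist _ [set u | qtriple_rel t u] (qclass_proof t).

Definition qrepr V W (c : Bset V W) : qtriple V W :=
  xchoose (existsP (valP c)).

Lemma qreprK V W : cancel (@qrepr V W) (@qclass V W).
Proof.
by move=> c; apply: val_inj => /=; apply/esym/eqP/(xchooseP (existsP (valP c))).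
Qed.

Lemma qclassP V W (s t : qtriple V W) :
  reflect (qtriple_equiv s t) (qclass s == qclass t).
Proof.
apply: (iffP eqP) => [[/setP/(_ t)]|st].
  rewrite !inE => e; apply/asboolP; move: e; rewrite /qtriple_rel => ->.
  exact/asboolP/qtriple_equiv_refl.
apply/val_inj/setP=> u /=; rewrite !inE; apply/asboolP/asboolP.
  exact/qtriple_equiv_trans/qtriple_equiv_sym.
exact: qtriple_equiv_trans st.
Qed.

(* The Q-vector space with basis Bset V W. *)
Definition Hhom V W := {ffun Bset V W -> rat^o}.

Definition Hbasis V W (c : Bset V W) : Hhom V W := [ffun c' => (c' == c)%:R].

Definition cls V W (t : qtriple V W) : Hhom V W := Hbasis (qclass t).

Definition homset V W (i : int) : {set finvect_type 'Hom(V, W)} :=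
  [set h : finvect_type 'Hom(V, W) | `[< hdeg i (h : 'Hom(V, W)) >]].

Definition endset_lt V (i : int) : {set finvect_type 'End(V)} :=
  [set h in homset V V i | `[< lowers_flag (h : 'End(V)) >]].

(* All but finitely many factors of the two products below are 1. *)
Definition comp_coef V : rat :=
  \big[*%R/1]_(i \in [set i : nat | (0 < i)%N]%classic)
    (#|endset_lt V (- i%:Z)|%:Q ^ ((-1 : int) ^+ i)).

Definition tens_coef U X V Y : rat :=
  \big[*%R/1]_(i \in [set: nat]%classic)
    ((#|homset X U (- i%:Z)| * #|homset Y V (- i%:Z)| *
      #|homset X V (- i%:Z - 1)|)%:Q ^ ((-1 : int) ^+ i.+1)).

Fact comp_qtriple_proof U V W (t : qtriple V W) (s : qtriple U V)
    (b : 'End(V)) : cx_iso (dtgt s) (dsrc t) b ->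
  is_qtriple (dsrc s) (qmap t \o b \o qmap s)%VF (dtgt t).
Proof.
case: (qtripleP s) (qtripleP t) => ds es qs [dt et qt] /quasi_iso_cx_iso qb.
split=> //; apply: quasi_iso_comp qs _; first by case: es.
by apply: quasi_iso_comp qb qt; case: dt.
Qed.

Definition comp_rep U V W (t : qtriple V W) (s : qtriple U V) : Hhom U W :=
  comp_coef V *:
    \sum_(b : {b : finvect_type 'End(V) | `[< cx_iso (dtgt s) (dsrc t) b >]})
      cls (mk_qtriple (comp_qtriple_proof (asboolW (valP b)))).

Definition Hcomp U V W (y : Hhom V W) (x : Hhom U V) : Hhom U W :=
  \sum_(c : Bset V W) \sum_(b : Bset U V)
    (y c * x b : rat) *: comp_rep (qrepr c) (qrepr b).

Definition is_tens_ext U V X Y (s : qtriple U V) (t : qtriple X Y)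
    (d11 : 'Hom(X, U)) (d12 : 'Hom(X, V)) (d22 : 'Hom(Y, V)) : Prop :=
  [/\ [/\ hdeg 1 d11, hdeg 0 d12 & hdeg 1 d22],
      (dsrc s \o d11)%VF + (d11 \o dsrc t)%VF = 0,
      (dtgt s \o d22)%VF + (d22 \o dtgt t)%VF = 0
    & (d12 \o dsrc t)%VF + (qmap s \o d11)%VF =
      (dtgt s \o d12)%VF + (d22 \o qmap t)%VF].

Fact tens_qtriple_proof U V X Y (s : qtriple U V) (t : qtriple X Y)
    (d11 : 'Hom(X, U)) (d12 : 'Hom(X, V)) (d22 : 'Hom(Y, V)) :
  is_tens_ext s t d11 d12 d22 ->
  @is_qtriple (tens_space U X) (tens_space V Y)
    (ublock (dsrc s) d11 (dsrc t)) (ublock (qmap s) d12 (qmap t))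
    (ublock (dtgt s) d22 (dtgt t)).
Proof.
case: (qtripleP s) (qtripleP t) => ds es qs [dt et qt] [[h1 h2 h3] e1 e2 e3].
split; [exact: is_diff_tens | exact: is_diff_tens|].
by apply: quasi_iso_tens => //; case: et.
Qed.

Definition tens_ext U V X Y (s : qtriple U V) (t : qtriple X Y) :=
  {delta : finvect_type 'Hom(X, U) * finvect_type 'Hom(X, V) *
           finvect_type 'Hom(Y, V) |
    `[< is_tens_ext s t delta.1.1 delta.1.2 delta.2 >]}.

Definition tens_rep U V X Y (s : qtriple U V) (t : qtriple X Y) :
    Hhom (tens_space U X) (tens_space V Y) :=
  tens_coef U X V Y *:
    \sum_(delta : tens_ext s t)
      cls (mk_qtriple (tens_qtriple_proof (asboolW (valP delta)))).

Definition Htens U V X Y (x : Hhom U V) (y : Hhom X Y) :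
    Hhom (tens_space U X) (tens_space V Y) :=
  \sum_(b : Bset U V) \sum_(c : Bset X Y)
    (x b * y c : rat) *: tens_rep (qrepr b) (qrepr c).

Fact push_qtriple_proof U V W (phi : 'Hom(V, W)) (iphi : fg_iso phi)
    (t : qtriple U V) :
  is_qtriple (dsrc t) (phi \o qmap t)%VF (phi \o dtgt t \o phi^-1)%VF.
Proof.
case: (qtripleP t) => ds es qs.
by split=> //; [exact: is_diff_push | exact: quasi_iso_push].
Qed.

Definition push_qtriple U V W (phi : 'Hom(V, W)) (iphi : fg_iso phi)
    (t : qtriple U V) : qtriple U W :=
  mk_qtriple (push_qtriple_proof iphi t).

(* Transport of morphisms along an isomorphism of objects V = W; applied to the
   identity of V it gives the morphism of H by which V and W are identified. *)
Definition Hpush U V W (phi : 'Hom(V, W)) (iphi : fg_iso phi) (x : Hhom U V) :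
    Hhom U W :=
  \sum_(b : Bset U V) (x b : rat) *: cls (push_qtriple iphi (qrepr b)).

Lemma push_qtriple_equiv U V W (phi : 'Hom(V, W)) (iphi : fg_iso phi)
    (s t : qtriple U V) :
  qtriple_equiv s t -> qtriple_equiv (push_qtriple iphi s) (push_qtriple iphi t).
Proof.
move=> [phi0 [psi [cphi0 [ipsi cpsi] [h h1 hE]]]].
have phiK := fg_isoK iphi.
exists phi0, (phi \o psi \o phi^-1)%VF; split=> //.
  split; first by apply: fg_iso_comp (fg_iso_comp _ _) => //; apply: fg_iso_inv.
  apply/lfunP=> w; have /lfunP/(_ (phi^-1%VF w)) := cpsi.
  by rewrite !comp_lfunE /= !phiK => ->.
exists (phi \o h)%VF.
  by rewrite -[-1]addr0; apply: hdeg_comp => //; apply: fg_iso_hdeg.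
apply/lfunP=> v; have /lfunP/(_ v)/(congr1 phi) := hE.
by rewrite !(add_lfunE, opp_lfunE, comp_lfunE) /= !phiK -linearB -linearD.
Qed.

Lemma Hpush_cls U V W (phi : 'Hom(V, W)) (iphi : fg_iso phi) (t : qtriple U V) :
  Hpush iphi (cls t) = cls (push_qtriple iphi t).
Proof.
rewrite /Hpush (bigD1 (qclass t)) //= big1 ?addr0 => [|c /negPf tc]; last first.
  by rewrite /cls /Hbasis ffunE tc scale0r.
rewrite [X in X *: _]ffunE eqxx scale1r; congr Hbasis.
by apply/eqP/qclassP/push_qtriple_equiv/qclassP; rewrite qreprK.
Qed.

End CategoryH.

(* Main.v *)
(* Morphisms are transported along isomorphisms of objects (Htr), and composition
   and tensor product commute with transport; this gives well-definedness, the
   unit laws and all coherence conditions, the latter being identities between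
   linear maps.  Both sides of the associativity of composition are the same
   double sum over isomorphisms; both bracketings of a triple tensor product are
   sums over 3 x 3 block triangular triples.

   The interchange law is the substantial point.  After the isomorphism on
   B + B' is absorbed, one compares the extensions w of (g f, g' f') with the
   pairs (u, v) of an extension u of (f, f') and an extension v of (g, g') that
   agree on B + B'.  The pairs form a finite group which maps additively to that
   of the w's, and this map is onto modulo homotopies, since quasi-isomorphisms
   induce isomorphisms on the cohomology of Hom complexes.  Hence every class
   is hit equally often, and the multiplicity is computed from the numbers of
   cocycles and coboundaries: the alternating products in the normalizations
   are multiplicative Euler characteristics, which telescope to a number of
   coboundaries times an invariant of cohomology. *)

(* Over a field a quasi-isomorphism is a homotopy equivalence: a homogeneous contraction of its
   mapping cone contains a homotopy inverse. The Hom complexes that govern extensions involve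
   gradings but no flags, so the inverse only has to be homogeneous. Once the diagonal blocks are
   fixed, the equations on delta are homogeneous linear, which is why extensions form groups and why
   counting reduces to kernels. The flag enters through one fact: step dim B of the flag of B + B'
   is B itself. Flag-preserving endomorphisms of B + B' are therefore upper triangular, with an
   off-diagonal entry free in Hom(B', B). For automorphisms this entry contributes |Hom^0(B', B)|;
   for the flag-lowering maps of degree -i with i > 0 it contributes |Hom^{-i}(B', B)|. Together
   these factors make up [altc B' B], the discrepancy between the normalizations on B + B' and on B
   and B' separately. A morphism carries differentials on both ends, so no single triple can be the
   identity of V; it is a weighted sum over all differentials of V. *)
Require Import Defs.
From HB Require Import structures.
From mathcomp Require Import all_boot all_order all_algebra all_field.
From mathcomp Require Import boolp fsbigop.
From mathcomp Require Import zify ring.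

Set Implicit Arguments.
Unset Strict Implicit.
Unset Printing Implicit Defensive.
Import GRing.Theory Num.Theory.

Local Open Scope ring_scope.

(* Makes products of finite abelian groups finite abelian groups. *)
HB.saturate prod.

(* Left to conversion, differences in nested products are very slow. *)
Lemma pairB (E F : finZmodType) (p q : (E * F)%type) :
  p - q = (p.1 - q.1, p.2 - q.2).
Proof. by []. Qed.

(** * Counting and summing along additive maps of finite abelian groups *)

Section Counting.
Variables (E E' : finZmodType) (S : {set E}) (T : {set E'}) (L : E -> E').
Hypotheses (S_sub : forall x y, x \in S -> y \in S -> x - y \in S)
  (L_sub : forall x y, L (x - y) = L x - L y)
  (L_im : forall x, x \in S -> L x \in T)
  (L_surj : forall w, w \in T -> exists2 x, x \in S & L x = w).

Let ker := [set x in S | L x == 0].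

(** Translation by one preimage [x0] of [w] carries the kernel onto the fibre. *)
Lemma card_fibre w : w \in T -> #|[set x in S | L x == w]| = #|ker|.
Proof.
move=> /L_surj[x0 Sx0 <-].
rewrite -(card_imset (mem ker) (can_inj (addrK x0))); apply: eq_card => x.
apply/idP/imsetP => [|[y]]; rewrite !inE; last first.
  case/andP=> Sy /eqP Ly ->; have S0 : 0 \in S by rewrite -(subrr x0) S_sub.
  have SN0 : - x0 \in S by rewrite -[- x0]add0r S_sub.
  rewrite -[x0 in y + x0]opprK S_sub //= L_sub -[- x0]add0r L_sub.
  by rewrite -(subrr x0) L_sub subrr sub0r opprK Ly add0r.
case/andP=> Sx /eqP Lx; exists (x - x0); last by rewrite subrK.
by rewrite inE S_sub //= L_sub Lx subrr.
Qed.

Lemma sum_surj_ker (M : nmodType) (c : E' -> M) :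
  \sum_(x in S) c (L x) = (\sum_(w in T) c w) *+ #|ker|.
Proof.
rewrite (partition_big L (mem T)) //= -sumrMnl; apply: eq_bigr => w Tw.
rewrite -(card_fibre Tw) (eq_bigr (fun=> c w)) => [|x /andP[_ /eqP->]] //.
by rewrite sumr_const; congr (_ *+ _); apply: eq_card => x; rewrite !inE.
Qed.

Lemma card_surj : (#|S| = #|T| * #|ker|)%N.
Proof.
have := sum_surj_ker (fun=> 1%N); rewrite !sum1_card => ->.
by rewrite -mulr_natr natn.
Qed.

(** All fibres have the same size #|S| / #|T|. The statement is cleared of denominators because [M]
    is only an additive monoid. *)
Lemma sum_surj (M : nmodType) (c : E' -> M) :
  (\sum_(x in S) c (L x)) *+ #|T| = (\sum_(w in T) c w) *+ #|S|.
Proof. by rewrite sum_surj_ker -mulrnA card_surj mulnC. Qed.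

End Counting.

(** The map [(x, n) |-> L x + n] from S x N is onto T, and [c] is constant along N, so summing over
    [n] only multiplies by #|N|. In the application N consists of homotopies and [c] sends a block
    to its class. *)
Lemma sum_surj_mod (E E' : finZmodType) (S : {set E}) (T N : {set E'})
    (L : E -> E') (M : nmodType) (c : E' -> M) :
  (forall x y, x \in S -> y \in S -> x - y \in S) ->
  (forall x y, x \in N -> y \in N -> x - y \in N) ->
  (forall x y, L (x - y) = L x - L y) ->
  (forall x n, x \in S -> n \in N -> L x + n \in T) ->
  (forall w, w \in T -> exists x n, [/\ x \in S, n \in N & w = L x + n]) ->
  (forall x n, x \in S -> n \in N -> c (L x + n) = c (L x)) ->
  (\sum_(x in S) c (L x)) *+ #|N| *+ #|T| = (\sum_(w in T) c w) *+ (#|S| * #|N|).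
Proof.
move=> S_sub N_sub L_sub L_im L_surj cN.
have surj := @sum_surj ((E * E')%type : finZmodType) E' (setX S N) T
  (fun p => L p.1 + p.2).
rewrite -cardsX -surj; first 1 last.
- by move=> [x n] [y m]; rewrite !inE /= => /andP[? ?] /andP[? ?]; rewrite S_sub ?N_sub.
- by move=> x y /=; rewrite L_sub opprD addrACA.
- by move=> [x n]; rewrite inE /= => /andP[? ?]; apply: L_im.
- by move=> w /L_surj[x [n [Sx Nn ->]]]; exists (x, n); rewrite ?inE /= ?Sx.
congr (_ *+ _); rewrite -sumrMnl.
rewrite (eq_bigl (fun p : E * E' => (p.1 \in S) && (p.2 \in N))); last first.
  by move=> [x n]; rewrite inE.
rewrite -(pair_big (mem S) (mem N) (fun x n => c (L x + n))) /=.
apply: eq_bigr => x Sx; rewrite -sumr_const; apply: eq_bigr => n Nn.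
by rewrite cN.
Qed.

Lemma sum_bij (I J : finType) (M : nmodType) (P : pred I) (Q : pred J)
    (h : I -> J) (h' : J -> I) (F : I -> M) (G : J -> M) :
  (forall i, P i -> Q (h i)) -> (forall j, Q j -> P (h' j)) ->
  (forall i, P i -> h' (h i) = i) -> (forall j, Q j -> h (h' j) = j) ->
  (forall i, P i -> F i = G (h i)) ->
  \sum_(i | P i) F i = \sum_(j | Q j) G j.
Proof.
move=> PQ QP hK h'K FG; rewrite (reindex_onto h' h) => [|i Pi]; last exact: hK.
rewrite (eq_bigl Q) => [|j]; last first.
  apply/andP/idP => [[Pj /eqP <-]|Qj]; first exact: PQ.
  by rewrite QP ?h'K ?eqxx.
by apply: eq_bigr => j Qj; rewrite FG ?h'K ?QP.
Qed.

Lemma card_bij (I J : finType) (P : {set I}) (Q : {set J})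
    (h : I -> J) (h' : J -> I) :
  (forall i, i \in P -> h i \in Q) -> (forall j, j \in Q -> h' j \in P) ->
  (forall i, i \in P -> h' (h i) = i) -> (forall j, j \in Q -> h (h' j) = j) ->
  #|P| = #|Q|.
Proof.
move=> PQ QP hK h'K; rewrite -!sum1_card.
exact: (sum_bij (M := nat) PQ QP hK h'K).
Qed.

Lemma sum_sig (I : finType) (M : nmodType) (P : pred I)
    (F : {x | P x} -> M) (G : I -> M) :
  (forall x, F x = G (val x)) -> \sum_x F x = \sum_(i | P i) G i.
Proof.
move=> FG; rewrite (reindex_omap (val : {x | P x} -> I) insub) => [|i Pi]; last first.
  by rewrite insubT.
by apply: eq_big => [x|x _]; rewrite ?valK ?eqxx ?(valP x) ?FG.
Qed.

(** * Graded linear algebra: projections, homogeneous generalized inverses, contractions *)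

Section Graded.
Variables (k : fieldType) (V : vectType k) (gr : int -> {vspace V}).
Hypotheses (ind : independent gr) (full : graded_sub gr fullv).

Lemma independent_cap i s : uniq (i :: s) ->
  (gr i :&: \sum_(j <- s) gr j = 0)%VS.
Proof.
move=> us; have /andP[_ us'] := us.
have /directvP /= := ind us; have /directvP /= := ind us'.
rewrite !big_cons => <-; rewrite -dimv_sum_cap => /esym/eqP.
by rewrite -[X in _ == X]addn0 eqn_add2l dimv_eq0 => /eqP.
Qed.

Lemma independent_eq0 s (u : int -> V) : uniq s ->
  (forall i, u i \in gr i) -> \sum_(i <- s) u i = 0 ->
  forall i, i \in s -> u i = 0.
Proof.
move=> us Vu; elim: s us => [|j s IHs] // us.
rewrite big_cons => e; have /= /andP[_ us'] := us.
have uj0 : u j = 0.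
  apply/eqP; rewrite -memv0 -(independent_cap us) memv_cap Vu /=.
  move/eqP: e; rewrite addr_eq0 => /eqP ->; rewrite memvN.
  by rewrite (big_nth 0) [in X in _ \in X](big_nth 0) !big_mkord memv_sumr.
move: e; rewrite uj0 add0r => e i; rewrite inE => /orP[/eqP->|] //.
exact: IHs.
Qed.

(** The pieces indexed by a finite list [s] already span V, so by independence every other piece is
    zero, and the projection onto it is taken to be 0. *)
Lemma graded_proj : exists s, uniq s /\ exists p : int -> 'End(V),
  [/\ forall i v, p i v \in gr i, forall i v, v \in gr i -> p i v = v,
      forall i j v, i != j -> v \in gr j -> p i v = 0
    & forall v, v = \sum_(i <- s) p i v].
Proof.
have [s0 def0] := full; pose s := undup s0; have us : uniq s by apply: undup_uniq.
have defV : fullv = (\sum_(i <- s) gr i)%VS.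
  apply/eqP; rewrite eq_sym eqEsubv subvf /= [X in (X <= _)%VS]def0.
  rewrite (big_nth 0) big_mkord; apply/subv_sumP=> i _.
  have: s0`_i \in s by rewrite mem_undup mem_nth.
  by move/(big_rem _) => ->; rewrite capfv addvSl.
exists s; split=> //; pose q := sumv_pi_for defV.
have qV i v : q i v \in gr i by apply: memv_sum_pi.
have qsum v : v = \sum_(i <- s) q i v.
  by rewrite sumv_pi_uniq_sum ?memvf // filter_predT.
have qd i j v : i \in s -> v \in gr j -> q i v = if i == j then v else 0.
  move=> si Vv; have [js|js] := boolP (j \in s).
    pose u i := q i v - (if i == j then v else 0).
    suff /(_ i si) /eqP : forall i, i \in s -> u i = 0.
      by rewrite subr_eq0 => /eqP.
    apply: independent_eq0 => // [l|]; first by rewrite memvB //; case: eqP => [->|]; rewrite ?mem0v.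
    by rewrite sumrB -qsum (bigD1_seq j) //= eqxx big1 ?addr0 ?subrr // => l /negPf->.
  have ujs : uniq (j :: s) by rewrite /= js.
  have v0 : v = 0.
    by apply/eqP; rewrite -memv0 -(independent_cap ujs) memv_cap Vv -defV memvf.
  by rewrite v0 linear0 if_same.
pose p i : 'End(V) := if i \in s then q i else 0.
have gr0 i v : i \notin s -> v \in gr i -> v = 0.
  move=> is' Vv; rewrite [v]qsum big1_seq // => j /andP[_ js].
  by rewrite (qd _ _ _ js Vv); case: eqP is' => // <-; rewrite js.
exists p; rewrite /p; split=> [i v|i v Vv|i j v ij Vv|v].
- by case: ifP; rewrite ?zero_lfunE ?mem0v.
- case: ifPn => is'; first by rewrite (qd _ i) ?eqxx.
  by rewrite (gr0 i v) ?linear0.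
- by case: ifPn => is'; rewrite ?zero_lfunE // (qd _ j) ?(negPf ij).
by rewrite [LHS]qsum; apply: eq_big_seq => i ->.
Qed.

End Graded.

(** The generalized inverse [h^-1] of a linear map is in general not homogeneous. Keeping only its
    components from degree [i + n] to degree [i] makes it so, and [h r h = h] survives because [h]
    intertwines the homogeneous projections of V and W. *)
Lemma graded_pinv (k : fieldType) (V W : vectType k)
    (grV : int -> {vspace V}) (grW : int -> {vspace W}) (n : int)
    (h : 'Hom(V, W)) :
  independent grV -> graded_sub grV fullv ->
  independent grW -> graded_sub grW fullv ->
  (forall i v, v \in grV i -> h v \in grW (i + n)) ->
  exists r : 'Hom(W, V), (forall i w, w \in grW (i + n) -> r w \in grV i) /\
    forall v, h (r (h v)) = h v.
Proof.
move=> iV fV iW fW hh.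
have [s [us [p [pV pid pne psum]]]] := graded_proj iV fV.
have [t [ut [q [qW qid qne qsum]]]] := graded_proj iW fW.
pose r : 'Hom(W, V) := (\sum_(i <- s) (p i \o h^-1 \o q (i + n)))%VF.
have rE w : r w = \sum_(i <- s) p i (h^-1%VF (q (i + n) w)).
  by rewrite sum_lfunE; apply: eq_bigr => i _; rewrite !comp_lfunE.
have rgr i w : w \in grW (i + n) -> r w = if i \in s then p i (h^-1%VF w) else 0.
  move=> Ww; rewrite rE; case: ifPn => is'.
    rewrite (bigD1_seq i) //= qid // big1 ?addr0 // => j ji.
    by rewrite (qne _ _ _ _ Ww) ?linear0 // (inj_eq (addIr n)).
  rewrite big1_seq // => j /andP[_ js]; rewrite (qne _ _ _ _ Ww) ?linear0 //.
  by rewrite (inj_eq (addIr n)); apply: contraNneq is' => <-.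
exists r; split=> [i w Ww|v].
  by rewrite (rgr i) //; case: ifP; rewrite ?mem0v.
rewrite [v]psum !linear_sum; apply: eq_big_seq => i is' /=.
rewrite (rgr i) ?is' ?hh //.
have hp u : h (p i u) = q (i + n) (h u).
  rewrite {2}[u]psum !linear_sum /= (bigD1_seq i) //= qid ?hh //.
  rewrite big1 ?addr0 // => j ji.
  by rewrite (qne _ (j + n)) ?hh // (inj_eq (addIr n)) eq_sym.
rewrite hp limg_lfunVK ?memv_img ?memvf // qid ?hh //.
Qed.

(** An acyclic complex over a field is contractible, because a generalized inverse [s] of [D] splits
    off the cycles. *)
Lemma graded_contraction (k : fieldType) (V : vectType k)
    (gr : int -> {vspace V}) (D : 'End(V)) :
  independent gr -> graded_sub gr fullv ->
  (forall i v, v \in gr i -> D v \in gr (i + 1)) ->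
  (forall v, D (D v) = 0) -> (forall v, D v = 0 -> exists w, v = D w) ->
  exists2 H : 'End(V), forall i v, v \in gr (i + 1) -> H v \in gr i &
    forall v, D (H v) + H (D v) = v.
Proof.
move=> ind full D1 D2 acyc.
have [s [s1 sK]] := graded_pinv ind full ind full D1.
(* With pi = D s the projector onto im D = ker D, take (1 - pi) s pi. *)
exists (((\1 - (D \o s)) \o s) \o (D \o s))%VF => [i v Vv|v].
  rewrite !comp_lfunE add_lfunE opp_lfunE id_lfunE comp_lfunE.
  have Ds j w : w \in gr (j + 1) -> D (s w) \in gr (j + 1) by move/s1/D1.
  apply: memvB; first exact/s1/Ds.
  by rewrite -[i](subrK 1); apply: (Ds _); rewrite subrK; exact/s1/Ds.
rewrite !comp_lfunE !add_lfunE !opp_lfunE !id_lfunE !comp_lfunE sK.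
rewrite linearB /= D2 subr0.
have kerP u : D u = 0 -> D (s u) = u by case/acyc=> w ->; rewrite sK.
have -> : D (s (D (s v))) = D (s v) by rewrite sK.
set y := s (D v).
(* [D s D = D] makes [v - y] a cycle, hence a boundary, and [D s] fixes boundaries. *)
have : D (s (v - y)) = v - y by apply: kerP; rewrite linearB /= sK subrr.
rewrite !linearB /= => e.
by rewrite addrCA e addrC subrK.
Qed.

Lemma independent_shift (k : fieldType) (V : vectType k)
    (gr : int -> {vspace V}) n :
  independent gr -> independent (fun i => gr (i + n)).
Proof.
move=> ind s us; have := ind [seq i + n | i <- s].
rewrite map_inj_uniq ?us; last exact: addIr.
by move/(_ isT); rewrite !directvE /= !big_map.
Qed.

Lemma graded_shift (k : fieldType) (V : vectType k)
    (gr : int -> {vspace V}) n (A : {vspace V}) :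
  graded_sub gr A -> graded_sub (fun i => gr (i + n)) A.
Proof.
move=> [s defA]; exists [seq i - n | i <- s]; rewrite big_map.
by rewrite [LHS]defA; apply: eq_bigr => i _; rewrite subrK.
Qed.

Lemma independent_osum (k : fieldType) (V W : vectType k)
    (grV : int -> {vspace V}) (grW : int -> {vspace W}) :
  independent grV -> independent grW ->
  independent (fun i => osum (grV i) (grW i)).
Proof.
move=> iV iW s us; rewrite directvE /= osum_sum dim_osum.
have /directvP /= -> := iV s us; have /directvP /= -> := iW s us.
by rewrite -big_split /=; apply/eqP/eq_bigr => i _; apply/esym/dim_osum.
Qed.

Lemma graded_sub_osum (k : fieldType) (V W : vectType k)
    (grV : int -> {vspace V}) (grW : int -> {vspace W}) :
  graded_sub grV fullv -> graded_sub grW fullv ->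
  graded_sub (fun i => osum (grV i) (grW i)) fullv.
Proof.
move=> [s defV] [t defW]; exists (s ++ t); apply/eqP; rewrite eqEsubv subvf andbT.
rewrite -[X in (X <= _)%VS]osum_full {1}defV {1}defW /osum !limg_sum big_cat /=; apply: addvS.
  by apply: sumvS => i; rewrite !capfv /osum addvSl.
by apply: sumvS => i; rewrite !capfv /osum addvSr.
Qed.

(** * Quasi-isomorphisms are homotopy equivalences *)

Section HomotopyInverse.
Variables (k : fieldType) (U V : flagspace k).
Variables (d : 'End(U)) (e : 'End(V)) (f : 'Hom(U, V)).
Hypotheses (dd : is_diff d) (de : is_diff e) (qf : quasi_iso d e f).

(** The cone of a quasi-isomorphism is acyclic, hence contractible. In a contraction of V + U[1] the
    block V -> U is the inverse [g], and the two diagonal blocks are the homotopies [a] and [c]. *)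
Lemma homotopy_inverse : exists (g : 'Hom(V, U)) (a : 'End(V)) (c : 'End(U)),
  [/\ [/\ hdeg 0 g, hdeg (-1) a & hdeg (-1) c], (g \o e = d \o g)%VF,
      (f \o g = \1 - ((e \o a) + (a \o e)))%VF
    & (g \o f = \1 + ((d \o c) + (c \o d)))%VF].
Proof.
have [/hdegP d1 _ d2] := dd; have [/hdegP e1 _ e2] := de.
have [/hdegP f0 fd finj fsurj] := qf.
have {}d2 v : d (d v) = 0 by have /lfunP/(_ v) := d2; rewrite comp_lfunE zero_lfunE.
have {}e2 v : e (e v) = 0 by have /lfunP/(_ v) := e2; rewrite comp_lfunE zero_lfunE.
have {}fd v : f (d v) = e (f v) by have /lfunP/(_ v) := fd; rewrite !comp_lfunE.
(* The mapping cone of f, with the U summand shifted. *)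
pose D := ublock e f (- d).
have DE v u : D (v, u) = (e v + f u, - d u) by rewrite ublockE opp_lfunE.
pose grD i := osum (gr V i) (gr U (i + 1)).
have iD : independent grD.
  by apply: independent_osum; [|apply: independent_shift]; apply: gr_direct.
have fD : graded_sub grD fullv.
  by apply: graded_sub_osum; [|apply: graded_shift]; apply: gr_full.
have D1 i p : p \in grD i -> D p \in grD (i + 1).
  case: p => v u; rewrite DE !memv_osum /= => /andP[vi ui].
  by rewrite memvD ?e1 ?memvN ?d1 // -[i + 1]addr0 f0.
have D2 p : D (D p) = 0.
  case: p => v u; rewrite !DE linearD linearN /= e2 add0r fd linearN /= d2.
  by rewrite subrr opprK.
have acyc p : D p = 0 -> exists q, p = D q.
  case: p => v u; rewrite DE => -[/eqP]; rewrite addr_eq0 => /eqP ev /eqP.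
  rewrite oppr_eq0 => /eqP du.
  (* Since [f u = e (- v)], injectivity on cohomology gives [u = d u1]. Then [v + f u1] is a cycle,
     and surjectivity writes it as [f u2 + e v2]; the two corrections combine into the primitive
     [(v2, u2 - u1)]. *)
  have [|u1 defu] := finj u du; first by exists (- v); rewrite linearN /= ev opprK.
  have [|u2 du2 [v2 defv]] := fsurj (v + f u1); first by rewrite linearD /= ev -fd -defu addNr.
  exists (v2, u2 - u1); rewrite DE (linearB f) (linearB d) /= du2 sub0r opprK -defu.
  by rewrite addrCA addrA -defv addrK.
have [H H1 DH] := graded_contraction iD fD D1 D2 acyc.
pose pV : 'Hom((V * U)%type, V) := runit_lf V U.
pose pU : 'Hom((V * U)%type, U) := lunit_lf V U.
exists (pU \o H \o inl_lf V U)%VF, (pV \o H \o inl_lf V U)%VF, (pU \o H \o inr_lf V U)%VF.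
have HE v u : H (v, u) = H (v, 0) + H (0, u).
  by rewrite -linearD; congr (H _); apply/eqP; rewrite xpair_eqE /= addr0 add0r !eqxx.
have H1E i p : p \in grD (i + 1) -> ((H p).1 \in gr V i) && ((H p).2 \in gr U (i + 1)).
  by move/H1; rewrite memv_osum.
(* On [(v, 0)] the two components of [D H + H D = 1] give the formula for [f g] and the chain map
   property of [g]; on [(0, u)] the second component gives [g f]. *)
have DHl v := DH (v, 0); have DHr u := DH (0, u).
split; first split.
- apply/hdegP=> j v vj; rewrite !comp_lfunE inl_lfE lunit_lfE addr0.
  have /H1E/andP[_]: (v, 0) \in grD (j - 1 + 1) by rewrite memv_osum subrK /= vj mem0v.
  by rewrite subrK.
- apply/hdegP=> j v vj; rewrite !comp_lfunE inl_lfE runit_lfE.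
  by have /H1E/andP[]: (v, 0) \in grD (j - 1 + 1) by rewrite memv_osum subrK /= vj mem0v.
- apply/hdegP=> j u uj; rewrite !comp_lfunE inr_lfE lunit_lfE.
  have /H1E/andP[_]: (0, u) \in grD (j - 1 - 1 + 1) by rewrite memv_osum !subrK /= uj mem0v.
  by rewrite subrK.
- apply/lfunP=> v; rewrite !comp_lfunE !inl_lfE !lunit_lfE.
  have := DHl v; case: (H (v, 0)) => a b; rewrite !DE !linear0 addr0.
  by case: (H (e v, 0)) => a' b' [_] /= /eqP; rewrite addrC subr_eq0 => /eqP.
- apply/lfunP=> v; rewrite !(add_lfunE, opp_lfunE, id_lfunE, comp_lfunE) !inl_lfE lunit_lfE !runit_lfE.
  have := DHl v; case: (H (v, 0)) => a b; rewrite !DE !linear0 addr0.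
  case: (H (e v, 0)) => a' b' [] /= <- _.
  by rewrite (addrAC (e a)) [_ + f b]addrC addrK.
apply/lfunP=> u; rewrite !(add_lfunE, opp_lfunE, id_lfunE, comp_lfunE) !(inl_lfE, inr_lfE, lunit_lfE).
have := DHr u; rewrite DE linear0 add0r [H (f u, _)]HE; case: (H (0, u)) => a b; rewrite DE.
have -> : H (0, - d u) = - H (0, d u).
  have -> : (0, - d u) = - ((0, d u) : V * U) by congr (_, _); rewrite oppr0.
  by rewrite linearN.
case: (H (f u, 0)) => a' b'; case: (H (0, d u)) => a2 b2 [_] /= <-.
by rewrite addrACA addNr add0r subrK.
Qed.

End HomotopyInverse.

Section LfunComp.
Variables (k : fieldType) (U V W : vectType k).

Lemma comp_lfunBl (f g : 'Hom(V, W)) (h : 'Hom(U, V)) :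
  ((f - g) \o h = (f \o h) - (g \o h))%VF.
Proof. by rewrite comp_lfunDl comp_lfunNl. Qed.

Lemma comp_lfunBr (f : 'Hom(V, W)) (g h : 'Hom(U, V)) :
  (f \o (g - h) = (f \o g) - (f \o h))%VF.
Proof. by rewrite comp_lfunDr comp_lfunNr. Qed.

Lemma lfun_compZl a (f : 'Hom(V, W)) (g : 'Hom(U, V)) :
  ((a *: f) \o g)%VF = a *: (f \o g)%VF.
Proof. by rewrite comp_lfunZl. Qed.

Lemma lfun_compZr a (f : 'Hom(V, W)) (g : 'Hom(U, V)) :
  (f \o (a *: g))%VF = a *: (f \o g)%VF.
Proof. by rewrite comp_lfunZr. Qed.

End LfunComp.

(** * Cocycles and coboundaries of Hom complexes, and their behaviour under quasi-isomorphisms *)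

Section HomComplex.
Variable k : finFieldType.
Implicit Types U V W X Y : flagspace k.

Lemma hdegB V W i (f g : 'Hom(V, W)) : hdeg i f -> hdeg i g -> hdeg i (f - g).
Proof. by move=> ? ?; apply: hdegD => //; apply: hdegN. Qed.

Lemma hdeg0 V W i : hdeg i (0 : 'Hom(V, W)).
Proof. by apply/hdegP=> j v _; rewrite zero_lfunE mem0v. Qed.

Lemma hdegZ V W i a (f : 'Hom(V, W)) : hdeg i f -> hdeg i (a *: f).
Proof.
by move=> /hdegP f0; apply/hdegP=> j v vj; rewrite scale_lfunE memvZ ?f0.
Qed.

Lemma hdeg_compE U V W i j n (g : 'Hom(V, W)) (f : 'Hom(U, V)) :
  hdeg i f -> hdeg j g -> n = i + j -> hdeg n (g \o f)%VF.
Proof. by move=> f0 g0 ->; apply: hdeg_comp. Qed.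

(* The differential on Hom(X, V) maps h of degree i to d h - (-1)^i h d; eps
   stands for (-1)^i, so that coboundaries come with the opposite sign. *)
Definition cocycles X V (d : 'End(X)) (e : 'End(V)) (i : int) (eps : k) :
    {set finvect_type 'Hom(X, V)} :=
  [set h : finvect_type 'Hom(X, V) |
    `[< hdeg i (h : 'Hom(X, V)) /\ (e \o h)%VF = eps *: (h \o d)%VF >]].

Definition coboundaries X V (d : 'End(X)) (e : 'End(V)) (i : int) (eps : k) :
    {set finvect_type 'Hom(X, V)} :=
  [set h : finvect_type 'Hom(X, V) |
    `[< exists2 h' : 'Hom(X, V), hdeg (i - 1) h' &
        (h : 'Hom(X, V)) = (e \o h')%VF + eps *: (h' \o d)%VF >]].

Lemma cocyclesP X V (d : 'End(X)) (e : 'End(V)) i eps (h : 'Hom(X, V)) :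
  reflect (hdeg i h /\ (e \o h)%VF = eps *: (h \o d)%VF)
    ((h : finvect_type 'Hom(X, V)) \in cocycles d e i eps).
Proof. by rewrite inE; apply: asboolP. Qed.

Lemma coboundariesP X V (d : 'End(X)) (e : 'End(V)) i eps (h : 'Hom(X, V)) :
  reflect (exists2 h' : 'Hom(X, V), hdeg (i - 1) h' &
             h = (e \o h')%VF + eps *: (h' \o d)%VF)
    ((h : finvect_type 'Hom(X, V)) \in coboundaries d e i eps).
Proof. by rewrite inE; apply: asboolP. Qed.

Lemma homsetP X V i (h : 'Hom(X, V)) :
  reflect (hdeg i h) ((h : finvect_type 'Hom(X, V)) \in homset X V i).
Proof. by rewrite inE; apply: asboolP. Qed.

Lemma cocyclesB X V (d : 'End(X)) (e : 'End(V)) i eps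
    (f g : finvect_type 'Hom(X, V)) :
  f \in cocycles d e i eps -> g \in cocycles d e i eps ->
  f - g \in cocycles d e i eps.
Proof.
move=> /cocyclesP[f0 fE] /cocyclesP[g0 gE]; apply/cocyclesP.
split; first exact: hdegB.
by rewrite comp_lfunBr comp_lfunBl scalerBr fE gE.
Qed.

Lemma coboundariesB X V (d : 'End(X)) (e : 'End(V)) i eps
    (f g : finvect_type 'Hom(X, V)) :
  f \in coboundaries d e i eps -> g \in coboundaries d e i eps ->
  f - g \in coboundaries d e i eps.
Proof.
move=> /coboundariesP[f' f0 ->] /coboundariesP[g' g0 ->]; apply/coboundariesP.
exists (f' - g'); first exact: hdegB.
by rewrite comp_lfunBr comp_lfunBl scalerBr opprD addrACA.
Qed.

Lemma homsetB X V i (f g : finvect_type 'Hom(X, V)) :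
  f \in homset X V i -> g \in homset X V i -> f - g \in homset X V i.
Proof. by move=> /homsetP f0 /homsetP g0; apply/homsetP/hdegB. Qed.

Lemma homset0 X V i : 0 \in homset X V i.
Proof. exact/homsetP/hdeg0. Qed.

Lemma cocycles0 X V (d : 'End(X)) (e : 'End(V)) i eps :
  0 \in cocycles d e i eps.
Proof.
by apply/cocyclesP; split; [exact: hdeg0 | rewrite comp_lfun0r comp_lfun0l scaler0].
Qed.

Lemma coboundaries0 X V (d : 'End(X)) (e : 'End(V)) i eps :
  0 \in coboundaries d e i eps.
Proof.
apply/coboundariesP; exists 0; first exact: hdeg0.
by rewrite comp_lfun0r comp_lfun0l scaler0 addr0.
Qed.

Lemma coboundary_cocycle X V (d : 'End(X)) (e : 'End(V)) i eps :
  is_diff d -> is_diff e -> eps * eps = 1 ->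
  coboundaries d e i eps \subset cocycles d e i eps.
Proof.
move=> [d1 _ d2] [e1 _ e2] eps2; apply/subsetP=> h /coboundariesP[h' h0 ->].
apply/cocyclesP; split.
  apply: hdegD; last apply: hdegZ.
    by apply: (hdeg_compE h0 e1); rewrite subrK.
  by apply: (hdeg_compE d1 h0); rewrite addrC subrK.
rewrite comp_lfunDr comp_lfunDl scalerDr lfun_compZr !lfun_compZl scalerA eps2.
rewrite !comp_lfunA e2 comp_lfun0l add0r scale1r -[(h' \o d \o d)%VF]comp_lfunA.
by rewrite d2 comp_lfun0r addr0.
Qed.

(** Rank-nullity, counted: the Hom differential leaving degree [i - 1] has the coboundaries of
    degree [i] as image and the cocycles of degree [i - 1] as kernel. The sign alternates with the
    degree, whence [- eps]. *)
Lemma card_homset X V (d : 'End(X)) (e : 'End(V)) i eps :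
  #|homset X V (i - 1)| =
    (#|coboundaries d e i eps| * #|cocycles d e (i - 1) (- eps)|)%N.
Proof.
have -> := @card_surj (finvect_type 'Hom(X, V)) (finvect_type 'Hom(X, V))
  (homset X V (i - 1)) (coboundaries d e i eps)
  (fun h : 'Hom(X, V) => (e \o h)%VF + eps *: (h \o d)%VF).
- congr (_ * _)%N; apply: eq_card => h; rewrite [in LHS]inE.
  apply/andP/cocyclesP => [[/homsetP h0 /eqP]|[h0 hE]].
    by move/eqP; rewrite addr_eq0 scaleNr => /eqP.
  by rewrite hE scaleNr addNr; split=> //; apply/homsetP.
- exact: homsetB.
- by move=> f g; rewrite comp_lfunBr comp_lfunBl scalerBr opprD addrACA.
- by move=> h /homsetP h0; apply/coboundariesP; exists h.
by move=> h /coboundariesP[h' h0 ->]; exists h' => //; apply/homsetP.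
Qed.

Section Post.
Variables (X U V : flagspace k) (dX : 'End(X)) (dU : 'End(U)) (dV : 'End(V)).
Variables (f : 'Hom(U, V)) (i : int) (eps : k).
Hypotheses (hX : is_diff dX) (hU : is_diff dU) (hV : is_diff dV).
Hypotheses (qf : quasi_iso dU dV f) (eps2 : eps * eps = 1).

Lemma post_cocycle (z : 'Hom(X, U)) :
  (z : finvect_type _) \in cocycles dX dU i eps ->
  ((f \o z)%VF : finvect_type 'Hom(X, V)) \in cocycles dX dV i eps.
Proof.
case: qf => f0 fd _ _ /cocyclesP[z0 zE]; apply/cocyclesP; split.
  by apply: (hdeg_compE z0 f0); rewrite addr0.
by rewrite comp_lfunA -fd -comp_lfunA zE lfun_compZr comp_lfunA.
Qed.

Lemma post_coboundary (z : 'Hom(X, U)) :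
  (z : finvect_type _) \in coboundaries dX dU i eps ->
  ((f \o z)%VF : finvect_type 'Hom(X, V)) \in coboundaries dX dV i eps.
Proof.
case: qf => f0 fd _ _ /coboundariesP[h h0 ->]; apply/coboundariesP.
exists (f \o h)%VF; first by apply: (hdeg_compE h0 f0); rewrite addr0.
by rewrite comp_lfunDr lfun_compZr !comp_lfunA fd.
Qed.

(** With a homotopy inverse [g], take [z' = g z]; the error [z - f g z] is the coboundary of
    [a z]. *)
Lemma post_surj (z : 'Hom(X, V)) :
  (z : finvect_type _) \in cocycles dX dV i eps ->
  exists2 z' : 'Hom(X, U), (z' : finvect_type _) \in cocycles dX dU i eps &
    exists2 h : 'Hom(X, V), hdeg (i - 1) h &
      z = (f \o z')%VF + ((dV \o h)%VF + eps *: (h \o dX)%VF).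
Proof.
have [g [a [c [[g0 a0 c0] gd fg gf]]]] := homotopy_inverse hU hV qf.
move=> /cocyclesP[z0 zE]; exists (g \o z)%VF.
  apply/cocyclesP; split; first by apply: (hdeg_compE z0 g0); rewrite addr0.
  by rewrite comp_lfunA -gd -comp_lfunA zE lfun_compZr comp_lfunA.
exists (a \o z)%VF; first exact: (hdeg_compE z0 a0).
rewrite -[((a \o z) \o dX)%VF]comp_lfunA -lfun_compZr -zE.
by rewrite !comp_lfunA fg comp_lfunBl comp_lfun1l comp_lfunDl subrK.
Qed.

(** If [f z] is the coboundary of [h], then [g f z] is that of [g h], and [g f z - z] is that of
    [c z]. *)
Lemma post_inj (z : 'Hom(X, U)) :
  (z : finvect_type _) \in cocycles dX dU i eps ->
  ((f \o z)%VF : finvect_type 'Hom(X, V)) \in coboundaries dX dV i eps ->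
  (z : finvect_type _) \in coboundaries dX dU i eps.
Proof.
have [g [a [c [[g0 a0 c0] gd fg gf]]]] := homotopy_inverse hU hV qf.
move=> /cocyclesP[z0 zE] /coboundariesP[h h0 fz]; apply/coboundariesP.
exists ((g \o h)%VF - (c \o z)%VF).
  by apply: hdegB; [apply: (hdeg_compE h0 g0); rewrite addr0 | apply: (hdeg_compE z0 c0)].
have : (g \o (f \o z))%VF = (g \o ((dV \o h) + eps *: (h \o dX)))%VF by rewrite fz.
rewrite comp_lfunA gf comp_lfunDl comp_lfun1l comp_lfunDl.
move/(canRL (addrK _)) => zD; rewrite [LHS]zD.
rewrite comp_lfunDr lfun_compZr [(g \o (dV \o h))%VF]comp_lfunA gd.
rewrite comp_lfunBr comp_lfunBl scalerBr !comp_lfunA.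
rewrite -[((c \o dU) \o z)%VF]comp_lfunA zE lfun_compZr comp_lfunA.
by rewrite opprD addrACA.
Qed.

(** Equality of the orders of cohomology, cleared of denominators. The map [(z, b) |-> f z + b] from
    cocycles times coboundaries is onto the cocycles by [post_surj]; by [post_inj] its kernel is the
    graph of [- f] over the coboundaries. *)
Lemma card_post : (#|cocycles dX dU i eps| * #|coboundaries dX dV i eps| =
  #|cocycles dX dV i eps| * #|coboundaries dX dU i eps|)%N.
Proof.
have := @card_surj (finvect_type 'Hom(X, U) * finvect_type 'Hom(X, V) : finZmodType)%type
  (finvect_type 'Hom(X, V))
  (setX (cocycles dX dU i eps) (coboundaries dX dV i eps)) (cocycles dX dV i eps)
  (fun p => (f \o p.1)%VF + p.2).
rewrite cardsX => -> //.
- congr (_ * _)%N.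
  apply: (@card_bij (finvect_type 'Hom(X, U) * finvect_type 'Hom(X, V))%type
    (finvect_type 'Hom(X, U)) _ _ fst (fun z => (z, - (f \o z)%VF))) => /=.
  + move=> [z b] /setIdP[/setXP[zZ bB] /= /eqP e].
    apply: post_inj => //; move/eqP: e; rewrite addr_eq0 => /eqP ->.
    by rewrite -sub0r coboundariesB // coboundaries0.
  + move=> z zB; apply/setIdP; rewrite /= addrN; split=> //; apply/setXP; split.
      by rewrite (subsetP (coboundary_cocycle _ hX hU eps2)).
    by rewrite -sub0r coboundariesB ?coboundaries0 ?post_coboundary.
  + move=> [z b] /setIdP[_ /= /eqP e]; congr (_, _).
    by move/eqP: e; rewrite addrC addr_eq0 => /eqP->.
  by [].
- move=> [z b] [z' b'] /setXP[? ?] /setXP[? ?].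
  by apply/setXP; rewrite cocyclesB ?coboundariesB.
- by move=> [z b] [z' b'] /=; rewrite comp_lfunBr opprD addrACA.
- move=> [z b] /setXP[zZ bB] /=.
  rewrite -[b]opprK cocyclesB ?post_cocycle // -sub0r cocyclesB ?cocycles0 //.
  by rewrite (subsetP (coboundary_cocycle _ hX hV eps2)).
move=> z /post_surj[z' z'Z [h h0 ->]].
exists (z', ((dV \o h)%VF + eps *: (h \o dX)%VF)) => //.
by apply/setXP; split=> //; apply/coboundariesP; exists h.
Qed.

End Post.

Section Pre.
Variables (V X Y : flagspace k) (dV : 'End(V)) (dX : 'End(X)) (dY : 'End(Y)).
Variables (g : 'Hom(X, Y)) (i : int) (eps : k).
Hypotheses (hV : is_diff dV) (hX : is_diff dX) (hY : is_diff dY).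
Hypotheses (qg : quasi_iso dX dY g) (eps2 : eps * eps = 1).

Lemma pre_cocycle (z : 'Hom(Y, V)) :
  (z : finvect_type _) \in cocycles dY dV i eps ->
  ((z \o g)%VF : finvect_type 'Hom(X, V)) \in cocycles dX dV i eps.
Proof.
case: qg => g0 gd _ _ /cocyclesP[z0 zE]; apply/cocyclesP; split.
  by apply: (hdeg_compE g0 z0); rewrite add0r.
by rewrite comp_lfunA zE lfun_compZl -!comp_lfunA gd.
Qed.

Lemma pre_coboundary (z : 'Hom(Y, V)) :
  (z : finvect_type _) \in coboundaries dY dV i eps ->
  ((z \o g)%VF : finvect_type 'Hom(X, V)) \in coboundaries dX dV i eps.
Proof.
case: qg => g0 gd _ _ /coboundariesP[h h0 ->]; apply/coboundariesP.
exists (h \o g)%VF; first by apply: (hdeg_compE g0 h0); rewrite add0r.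
by rewrite comp_lfunDl lfun_compZl -!comp_lfunA gd.
Qed.

Lemma pre_surj (z : 'Hom(X, V)) :
  (z : finvect_type _) \in cocycles dX dV i eps ->
  exists2 z' : 'Hom(Y, V), (z' : finvect_type _) \in cocycles dY dV i eps &
    exists2 h : 'Hom(X, V), hdeg (i - 1) h &
      z = (z' \o g)%VF + ((dV \o h)%VF + eps *: (h \o dX)%VF).
Proof.
have [g' [a [c [[g0 a0 c0] gd fg gf]]]] := homotopy_inverse hX hY qg.
move=> /cocyclesP[z0 zE]; exists (z \o g')%VF.
  apply/cocyclesP; split; first by apply: (hdeg_compE g0 z0); rewrite add0r.
  by rewrite comp_lfunA zE lfun_compZl -!comp_lfunA gd.
(* [z - z g' g] equals [- z (d c + c d)]. Since [dV z = eps z d] and [eps eps = 1], both terms come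
   from the same homotopy with the factor [- eps]. *)
exists (- eps *: (z \o c)%VF).
  by apply: hdegZ; apply: (hdeg_compE c0 z0); rewrite addrC.
rewrite lfun_compZr lfun_compZl scalerA mulrN eps2 comp_lfunA zE.
rewrite lfun_compZl scalerA mulNr eps2 !scaleN1r -opprD.
rewrite -!comp_lfunA gf -comp_lfunDr comp_lfunDr comp_lfun1r addrK //.
Qed.

Lemma pre_inj (z : 'Hom(Y, V)) :
  (z : finvect_type _) \in cocycles dY dV i eps ->
  ((z \o g)%VF : finvect_type 'Hom(X, V)) \in coboundaries dX dV i eps ->
  (z : finvect_type _) \in coboundaries dY dV i eps.
Proof.
have [g' [a [c [[g0 a0 c0] gd fg gf]]]] := homotopy_inverse hX hY qg.
move=> /cocyclesP[z0 zE] /coboundariesP[h h0 fz]; apply/coboundariesP.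
exists ((h \o g')%VF + eps *: (z \o a)%VF).
  apply: hdegD; first by apply: (hdeg_compE g0 h0); rewrite add0r.
  by apply: hdegZ; apply: (hdeg_compE a0 z0); rewrite addrC.
have : ((z \o g) \o g')%VF = (((dV \o h) + eps *: (h \o dX)) \o g')%VF by rewrite fz.
rewrite -comp_lfunA fg comp_lfunBr comp_lfun1r => /(canRL (subrK _)) zD; rewrite [LHS]zD.
rewrite comp_lfunDl lfun_compZl comp_lfunDr -!comp_lfunA -gd.
rewrite [in RHS]comp_lfunDr [in RHS]comp_lfunDl scalerDr lfun_compZr lfun_compZl.
rewrite scalerA eps2 scale1r [(dV \o (z \o a))%VF]comp_lfunA zE lfun_compZl.
by rewrite scalerA eps2 scale1r -!comp_lfunA addrACA.
Qed.

Lemma card_pre : (#|cocycles dY dV i eps| * #|coboundaries dX dV i eps| =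
  #|cocycles dX dV i eps| * #|coboundaries dY dV i eps|)%N.
Proof.
have := @card_surj (finvect_type 'Hom(Y, V) * finvect_type 'Hom(X, V) : finZmodType)%type
  (finvect_type 'Hom(X, V))
  (setX (cocycles dY dV i eps) (coboundaries dX dV i eps)) (cocycles dX dV i eps)
  (fun p => (p.1 \o g)%VF + p.2).
rewrite cardsX => -> //.
- congr (_ * _)%N.
  apply: (@card_bij (finvect_type 'Hom(Y, V) * finvect_type 'Hom(X, V))%type
    (finvect_type 'Hom(Y, V)) _ _ fst (fun z => (z, - (z \o g)%VF))) => /=.
  + move=> [z b] /setIdP[/setXP[zZ bB] /= /eqP e].
    apply: pre_inj => //; move/eqP: e; rewrite addr_eq0 => /eqP ->.
    by rewrite -sub0r coboundariesB // coboundaries0.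
  + move=> z zB; apply/setIdP; rewrite /= addrN; split=> //; apply/setXP; split.
      by rewrite (subsetP (coboundary_cocycle _ hY hV eps2)).
    by rewrite -sub0r coboundariesB ?coboundaries0 ?pre_coboundary.
  + move=> [z b] /setIdP[_ /= /eqP e]; congr (_, _).
    by move/eqP: e; rewrite addrC addr_eq0 => /eqP->.
  by [].
- move=> [z b] [z' b'] /setXP[? ?] /setXP[? ?].
  by apply/setXP; rewrite cocyclesB ?coboundariesB.
- by move=> [z b] [z' b'] /=; rewrite comp_lfunBl opprD addrACA.
- move=> [z b] /setXP[zZ bB] /=.
  rewrite -[b]opprK cocyclesB ?pre_cocycle // -sub0r cocyclesB ?cocycles0 //.
  by rewrite (subsetP (coboundary_cocycle _ hX hV eps2)).
move=> z /pre_surj[z' z'Z [h h0 ->]].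
exists (z', ((dV \o h)%VF + eps *: (h \o dX)%VF)) => //.
by apply/setXP; split=> //; apply/coboundariesP; exists h.
Qed.

End Pre.
End HomComplex.

(** * Algebra of block triangular maps *)

Section Ublock.
Variable k : fieldType.
Implicit Types U V W X Y Z : vectType k.

Lemma comp_ublock U V W X Y Z (a : 'Hom(U, V)) (b : 'Hom(X, V)) (c : 'Hom(X, Y))
    (a' : 'Hom(V, W)) (b' : 'Hom(Y, W)) (c' : 'Hom(Y, Z)) :
  (ublock a' b' c' \o ublock a b c)%VF =
  ublock (a' \o a)%VF ((a' \o b) + (b' \o c))%VF (c' \o c)%VF.
Proof.
apply/lfunP=> p; rewrite comp_lfunE !ublockE /= add_lfunE !comp_lfunE linearD /=.
by rewrite addrA.
Qed.

Lemma ublockD U V X Y (a a' : 'Hom(U, V)) (b b' : 'Hom(X, V)) (c c' : 'Hom(X, Y)) :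
  ublock a b c + ublock a' b' c' = ublock (a + a') (b + b') (c + c').
Proof.
apply/lfunP=> p; rewrite add_lfunE !ublockE /= !add_lfunE.
by congr (_, _); rewrite addrACA.
Qed.

Lemma ublockN U V X Y (a : 'Hom(U, V)) (b : 'Hom(X, V)) (c : 'Hom(X, Y)) :
  - ublock a b c = ublock (- a) (- b) (- c).
Proof.
apply/lfunP=> p; rewrite opp_lfunE !ublockE /= !opp_lfunE.
by congr (_, _); rewrite opprD.
Qed.

Lemma ublockB U V X Y (a a' : 'Hom(U, V)) (b b' : 'Hom(X, V)) (c c' : 'Hom(X, Y)) :
  ublock a b c - ublock a' b' c' = ublock (a - a') (b - b') (c - c').
Proof. by rewrite ublockN ublockD. Qed.

Lemma ublock1 U X : ublock \1 0 \1 = \1%VF :> 'End((U * X)%type).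
Proof.
apply/lfunP=> -[u x]; rewrite ublockE !id_lfunE zero_lfunE /=.
by rewrite addr0.
Qed.

Lemma ublock0 U V X Y : ublock 0 0 0 = 0 :> 'Hom((U * X)%type, (V * Y)%type).
Proof. by apply/lfunP=> p; rewrite ublockE !zero_lfunE addr0. Qed.

Lemma ublock_inj U V X Y (a a' : 'Hom(U, V)) (b b' : 'Hom(X, V))
    (c c' : 'Hom(X, Y)) :
  ublock a b c = ublock a' b' c' -> [/\ a = a', b = b' & c = c'].
Proof.
move=> /lfunP e; split; apply/lfunP=> x.
- by have := e (x, 0); rewrite !ublockE /= !linear0 !addr0 => -[].
- by have := e (0, x); rewrite !ublockE /= !linear0 !add0r => -[].
by have := e (0, x); rewrite !ublockE /= => -[].
Qed.

Definition ublock11 U V X Y (h : 'Hom((U * X)%type, (V * Y)%type)) : 'Hom(U, V) :=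
  (runit_lf V Y \o h \o inl_lf U X)%VF.

Definition ublock12 U V X Y (h : 'Hom((U * X)%type, (V * Y)%type)) : 'Hom(X, V) :=
  (runit_lf V Y \o h \o inr_lf U X)%VF.

Definition ublock22 U V X Y (h : 'Hom((U * X)%type, (V * Y)%type)) : 'Hom(X, Y) :=
  (lunit_lf V Y \o h \o inr_lf U X)%VF.

Lemma ublock11E U V X Y (a : 'Hom(U, V)) (b : 'Hom(X, V)) (c : 'Hom(X, Y)) :
  ublock11 (ublock a b c) = a.
Proof.
apply/lfunP=> v; rewrite !comp_lfunE inl_lfE ublockE runit_lfE /=.
by rewrite linear0 addr0.
Qed.

Lemma ublock12E U V X Y (a : 'Hom(U, V)) (b : 'Hom(X, V)) (c : 'Hom(X, Y)) :
  ublock12 (ublock a b c) = b.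
Proof.
apply/lfunP=> v; rewrite !comp_lfunE inr_lfE ublockE runit_lfE /=.
by rewrite linear0 add0r.
Qed.

Lemma ublock22E U V X Y (a : 'Hom(U, V)) (b : 'Hom(X, V)) (c : 'Hom(X, Y)) :
  ublock22 (ublock a b c) = c.
Proof. by apply/lfunP=> v; rewrite !comp_lfunE inr_lfE ublockE lunit_lfE. Qed.

(** Only the diagonal is recorded, so that composing and transporting triangular maps requires no
    formula for the off-diagonal entry. *)
Definition is_ublock U V X Y (a : 'Hom(U, V)) (c : 'Hom(X, Y))
    (h : 'Hom((U * X)%type, (V * Y)%type)) : Prop :=
  exists b, h = ublock a b c.

Lemma is_ublock_comp U V W X Y Z (a : 'Hom(U, V)) (c : 'Hom(X, Y))
    (a' : 'Hom(V, W)) (c' : 'Hom(Y, Z)) h h' :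
  is_ublock a c h -> is_ublock a' c' h' ->
  is_ublock (a' \o a)%VF (c' \o c)%VF (h' \o h)%VF.
Proof. by move=> [b ->] [b' ->]; eexists; apply: comp_ublock. Qed.

Lemma is_ublockD U V X Y (a a' : 'Hom(U, V)) (c c' : 'Hom(X, Y)) h h' :
  is_ublock a c h -> is_ublock a' c' h' -> is_ublock (a + a') (c + c') (h + h').
Proof. by move=> [b ->] [b' ->]; eexists; apply: ublockD. Qed.

Lemma is_ublockN U V X Y (a : 'Hom(U, V)) (c : 'Hom(X, Y)) h :
  is_ublock a c h -> is_ublock (- a) (- c) (- h).
Proof. by move=> [b ->]; eexists; apply: ublockN. Qed.

Lemma ublockP U V X Y (h : 'Hom((U * X)%type, (V * Y)%type)) :
  (forall u, (h (u, 0)).2 = 0) -> exists a b c, h = ublock a b c.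
Proof.
move=> hu; exists (ublock11 h), (ublock12 h), (ublock22 h).
apply/lfunP=> -[u x].
rewrite ublockE !comp_lfunE !inl_lfE !inr_lfE !runit_lfE lunit_lfE /=.
have -> : h (u, x) = h (u, 0) + h (0, x).
  by rewrite -linearD; congr (h (_, _)); rewrite ?addr0 ?add0r.
case: (h (u, 0)) (hu u) => a a2 /= ->; case: (h (0, x)) => b c /=.
by congr (_, _); rewrite add0r.
Qed.

End Ublock.

(** * Flags on direct sums and triangular form *)

Section FlagUblock.
Variable k : fieldType.
Implicit Types U V W X Y : flagspace k.

(** An injective map preserves dimensions, so the inclusions of images of graded pieces and of flag
    steps are equalities. *)
Lemma fg_iso_le V W (h : 'Hom(V, W)) :
  lker h = 0%VS -> (forall i, \dim (gr V i) = \dim (gr W i)) ->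
  \dim {: V} = \dim {: W} -> hdeg 0 h -> (forall j, h @: fl V j <= fl W j)%VS ->
  fg_iso h.
Proof.
move=> kh dgr dV h0 hf.
have dimh (A : {vspace V}) : \dim (h @: A) = \dim A.
  by rewrite limg_dim_eq // kh capv0.
split=> // [i|j]; apply/eqP; rewrite eqEdim dimh.
  by have := h0 i; rewrite addr0 => ->; rewrite dgr leqnn.
by rewrite hf !fl_dim dV leqnn.
Qed.

Lemma fg_iso_dim_gr V W (h : 'Hom(V, W)) : fg_iso h ->
  forall i, \dim (gr V i) = \dim (gr W i).
Proof. by case=> kh hg _ i; rewrite -hg limg_dim_eq // kh capv0. Qed.

Lemma fg_iso_dim V W (h : 'Hom(V, W)) : fg_iso h -> \dim {: V} = \dim {: W}.
Proof.
case=> kh _ hf; have := hf (\dim {: V} + \dim {: W})%N.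
by rewrite !fl_full ?leq_addl ?leq_addr // => <-; rewrite limg_dim_eq // kh capv0.
Qed.

Lemma mem_fl_tens V W j (p : V * W) :
  (p \in fl (tens_space V W) j) =
  (p.1 \in fl V j) && (p.2 \in fl W (j - \dim {: V})).
Proof. exact: memv_osum. Qed.

Lemma mem_gr_tens V W i (p : V * W) :
  (p \in gr (tens_space V W) i) = (p.1 \in gr V i) && (p.2 \in gr W i).
Proof. exact: memv_osum. Qed.

Lemma fl0 V : fl V 0 = 0%VS.
Proof. by apply/eqP; rewrite -dimv_eq0 fl_dim min0n. Qed.

Lemma hdeg_ublock U V X Y i (a : 'Hom(U, V)) (b : 'Hom(X, V)) (c : 'Hom(X, Y)) :
  hdeg i (ublock a b c : 'Hom(tens_space U X, tens_space V Y)) <->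
  [/\ hdeg i a, hdeg i b & hdeg i c].
Proof.
split=> [/hdegP h|[/hdegP a0 /hdegP b0 /hdegP c0]].
  split; apply/hdegP=> j x xj.
  - have := h j (x, 0); rewrite ublockE !mem_gr_tens /= xj mem0v linear0 addr0.
    by case/(_ isT)/andP.
  - have := h j (0, x); rewrite ublockE !mem_gr_tens /= xj mem0v linear0 add0r.
    by case/(_ isT)/andP.
  have := h j (0, x); rewrite ublockE !mem_gr_tens /= xj mem0v.
  by case/(_ isT)/andP.
apply/hdegP=> j p; rewrite ublockE !mem_gr_tens /= => /andP[p1 p2].
by rewrite memvD ?a0 ?b0 ?c0.
Qed.

Lemma fg_iso_ublock U V X Y (a : 'Hom(U, V)) (b : 'Hom(X, V)) (c : 'Hom(X, Y)) :
  fg_iso a -> hdeg 0 b -> fg_iso c ->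
  fg_iso (ublock a b c : 'Hom(tens_space U X, tens_space V Y)).
Proof.
move=> ia b0 ic; apply: fg_iso_le.
- apply/eqP/lker0P => -[u x] [u' x']; rewrite !ublockE /= => -[ax].
  move/(can_inj (fg_isoK ic)) => ex; rewrite ex in ax *.
  by move/addIr/(can_inj (fg_isoK ia)): ax => ->.
- by move=> i; rewrite !dim_osum (fg_iso_dim_gr ia) (fg_iso_dim_gr ic).
- by rewrite !dim_tens (fg_iso_dim ia) (fg_iso_dim ic).
- by apply/hdeg_ublock; split=> //; apply: fg_iso_hdeg.
move=> j; apply/subvP=> _ /memv_imgP[p + ->].
rewrite ublockE !mem_fl_tens /= => /andP[p1 p2].
have [_ _ fa] := ia; have [_ _ fc] := ic.
rewrite -(fg_iso_dim ia) -fc memv_img // andbT.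
have [le|lt] := leqP (\dim {: U}) j.
  by rewrite fl_full ?memvf // -(fg_iso_dim ia).
have p20 : p.2 = 0.
  by apply/eqP; move: p2; rewrite (eqP (ltnW lt)) fl0 memv0.
by rewrite p20 linear0 addr0 -fa memv_img.
Qed.

(** Step dim U of the flag of U + X is U itself, so preserving this one step kills the lower left
    block. *)
Lemma flag_ublock U V X Y (h : 'Hom(tens_space U X, tens_space V Y)) :
  \dim {: U} = \dim {: V} ->
  (h @: fl (tens_space U X) (\dim {: U}) <= fl (tens_space V Y) (\dim {: U}))%VS ->
  exists a b c, h = ublock a b c.
Proof.
move=> dUV /subvP hf; apply: ublockP => u; apply/eqP; rewrite -memv0 -(fl0 Y).
have := hf (h (u, 0)); rewrite memv_img; last first.
  by rewrite mem_fl_tens /= mem0v fl_full ?memvf.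
by rewrite mem_fl_tens dUV subnn => /(_ isT)/andP[].
Qed.

Lemma fg_iso_ublockP U X (h : 'End(tens_space U X)) : fg_iso h <->
  exists (a : 'End(U)) (b : 'Hom(X, U)) (c : 'End(X)),
    [/\ h = ublock a b c, fg_iso a, hdeg 0 b & fg_iso c].
Proof.
split=> [ih|[a [b [c [-> ia b0 ic]]]]]; last exact: fg_iso_ublock.
have [kh hg hf] := ih.
have [//||a [b [c eh]]] := @flag_ublock _ _ _ _ h; first by rewrite hf.
exists a, b, c; have [] := (hdeg_ublock 0 a b c).1; first by rewrite -eh; apply: fg_iso_hdeg.
move=> a0 b0 c0; rewrite eh in kh hg hf; split=> //.
  apply: fg_iso_le => // [|j].
    apply/eqP/lker0P=> u u' au; have /eqP/lker0P/(_ (u, 0) (u', 0)) := kh.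
    by rewrite !ublockE /= au !linear0 => /(_ erefl) [].
  apply/subvP=> _ /memv_imgP[u uj ->].
  have := memv_img (ublock a b c) (_ : (u, 0) \in fl (tens_space U X) j).
  by rewrite hf ublockE !mem_fl_tens /= mem0v linear0 addr0 uj => /(_ isT)/andP[].
(* Unlike [a], the block [c] does not inherit injectivity by restriction. It is onto because [h] is,
   and then injective by dimension. *)
have c_inj : lker c = 0%VS.
  have sc : limg c = fullv.
    apply/vspaceP=> y; rewrite memvf; apply/memv_imgP.
    have := hf (\dim {: U} + \dim {: X})%N; rewrite fl_full ?dim_tens // => /vspaceP/(_ (0, y)).
    rewrite memvf => /memv_imgP[[u x] _]; rewrite ublockE => -[_ ->].
    by exists x; rewrite ?memvf.
  apply/eqP; rewrite -dimv_eq0 -(eqn_add2r (\dim (limg c))) -[lker c]capfv limg_ker_dim sc.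
  by [].
apply: fg_iso_le => // j; apply/subvP=> _ /memv_imgP[x xj ->].
(* Step [dim U + j] of the flag on the sum induces step [j] on X. *)
have := memv_img (ublock a b c) (_ : (0, x) \in fl (tens_space U X) (\dim {: U} + j)).
rewrite hf ublockE !mem_fl_tens /= mem0v addKn xj => /(_ isT)/andP[].
by [].
Qed.

(** The entry [b] maps X into U, which lies below every step of the flag where X contributes; hence
    it is unconstrained. *)
Lemma lowers_flag_ublock U X (a : 'End(U)) (b : 'Hom(X, U)) (c : 'End(X)) :
  lowers_flag (ublock a b c : 'End(tens_space U X)) <->
  lowers_flag a /\ lowers_flag c.
Proof.
split=> [lt|[alt clt] j].
  split=> j; apply/subvP=> _ /memv_imgP[x xj ->].
    have := subvP (lt j) _ (memv_img _ (_ : (x, 0) \in fl (tens_space U X) j.+1)).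
    by rewrite ublockE !mem_fl_tens /= mem0v linear0 addr0 xj => /(_ isT)/andP[].
  have := subvP (lt (\dim {: U} + j)%N) _
    (memv_img _ (_ : (0, x) \in fl (tens_space U X) (\dim {: U} + j).+1)).
  by rewrite ublockE !mem_fl_tens /= mem0v -addnS !addKn xj => /(_ isT)/andP[].
apply/subvP=> _ /memv_imgP[p + ->]; rewrite !mem_fl_tens ublockE /= => /andP[p1 p2].
have [le|gt] := leqP (\dim {: U}) j.
  rewrite fl_full // memvf /=; apply: (subvP (clt _)); apply: memv_img.
  by rewrite -subSn.
have p20 : p.2 = 0 by apply/eqP; move: p2; rewrite (eqP gt) fl0 memv0.
rewrite p20 !linear0 addr0 mem0v andbT.
by apply: (subvP (alt _)); apply: memv_img.
Qed.

Lemma lowers_flag_ublockP U X (D : 'End(tens_space U X)) : lowers_flag D ->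
  exists a b c, D = ublock a b c.
Proof.
move=> Dlt; apply: flag_ublock => //.
exact: subv_trans (limgS D (@fl_incr _ (tens_space U X) _)) (Dlt _).
Qed.

Lemma is_diff_ublockP U X (D : 'End(tens_space U X)) : is_diff D <->
  exists (d : 'End(U)) (b : 'Hom(X, U)) (d' : 'End(X)),
    [/\ D = ublock d b d', is_diff d, is_diff d', hdeg 1 b
      & (d \o b)%VF + (b \o d')%VF = 0].
Proof.
split=> [[D1 Dlt D2]|[d [b [d' [-> ? ? ? ?]]]]]; last exact: is_diff_tens.
have [a [b [c eD]]] := lowers_flag_ublockP Dlt.
exists a, b, c; have [] := (hdeg_ublock 1 a b c).1; first by rewrite -eD.
move=> a1 b1 c1.
have := D2; rewrite eD comp_ublock -ublock0 => /ublock_inj[a2 ab c2].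
by have [] := (lowers_flag_ublock a b c).1; first by rewrite -eD.
Qed.

Lemma lfun_inv_eq V W (h : 'Hom(V, W)) (g : 'Hom(W, V)) : fg_iso h ->
  (g \o h)%VF = \1%VF -> h^-1%VF = g.
Proof.
move=> ih gh; apply/lfunP=> w; have /lfunP/(_ (h^-1%VF w)) := gh.
by rewrite comp_lfunE id_lfunE (fg_isoVK ih).
Qed.

Lemma fg_iso_compVl V W (h : 'Hom(V, W)) : fg_iso h -> (h^-1 \o h)%VF = \1%VF.
Proof. by move=> ih; apply/lfunP=> v; rewrite comp_lfunE id_lfunE fg_isoK. Qed.

Lemma fg_iso_compVr V W (h : 'Hom(V, W)) : fg_iso h -> (h \o h^-1)%VF = \1%VF.
Proof. by move=> ih; apply/lfunP=> v; rewrite comp_lfunE id_lfunE fg_isoVK. Qed.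

Lemma fg_iso_invK V W (h : 'Hom(V, W)) : fg_iso h -> (h^-1^-1)%VF = h.
Proof.
by move=> ih; apply: lfun_inv_eq; [exact: fg_iso_inv | exact: fg_iso_compVr].
Qed.

Lemma is_ublock_inv U V X Y (a : 'Hom(U, V)) (c : 'Hom(X, Y))
    (h : 'Hom(tens_space U X, tens_space V Y)) :
  fg_iso a -> fg_iso c -> fg_iso h -> is_ublock a c h ->
  is_ublock a^-1%VF c^-1%VF h^-1%VF.
Proof.
move=> ia ic ih [b eh]; exists (- (a^-1 \o b \o c^-1)%VF).
apply: (@lfun_inv_eq (tens_space U X) (tens_space V Y) h _ ih).
rewrite eh comp_ublock !fg_iso_compVl // comp_lfunNl -(comp_lfunA _ _ c).
by rewrite fg_iso_compVl // comp_lfun1r subrr ublock1.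
Qed.

End FlagUblock.

(** * Alternating exponents, and truncation of products over all natural numbers *)

Section SignPower.
Local Notation spow x i := ((x : rat) ^ ((-1 : int) ^+ i)).

Lemma spowE x i : spow x i = if odd i then x^-1 else x.
Proof. by rewrite -signr_odd; case: (odd i); rewrite ?expr0 ?expr1z // expr1 exprN1. Qed.

Lemma spowS x i : spow x i.+1 = (spow x i)^-1.
Proof. by rewrite !spowE /=; case: (odd i); rewrite ?invrK. Qed.

Lemma spow1 i : spow 1 i = 1.
Proof. by rewrite spowE invr1 if_same. Qed.

Lemma spowM x y i : spow (x * y) i = spow x i * spow y i.
Proof. by rewrite !spowE; case: (odd i); rewrite ?invfM. Qed.

Lemma spow_eq0 x i : (spow x i == 0) = (x == 0).
Proof. by rewrite spowE; case: (odd i); rewrite ?invr_eq0. Qed.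

Lemma fsbig_nat (A : pred nat) (F : nat -> rat) N :
  (forall i, (N <= i)%N -> F i = 1) ->
  \big[*%R/1]_(i \in classical_sets.mkset A) F i = \prod_(0 <= i < N | A i) F i.
Proof.
move=> F1; rewrite -(@bigfs _ _ _ _ (index_iota 0 N)) ?iota_uniq // => i _.
by rewrite mem_index_iota /= -leqNgt => /F1.
Qed.

Lemma fsbig_natT (F : nat -> rat) N :
  (forall i, (N <= i)%N -> F i = 1) ->
  \big[*%R/1]_(i \in @classical_sets.setT nat) F i = \prod_(0 <= i < N) F i.
Proof.
by move=> /(fsbig_nat predT) <-; apply: eq_fsbigl; apply/predeqP.
Qed.

End SignPower.

(** * The normalization constants in terms of [altc] *)

Section AltProducts.
Variable k : finFieldType.
Implicit Types U V W X Y : flagspace k.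
Local Notation spow x i := ((x : rat) ^ ((-1 : int) ^+ i)).

(** A nonzero map of degree -i joins some degree [j] of X to a degree [l = j - i] of U, whence
    [i <= |j| + |l|]. The bound used is crude: one more than the sum of the absolute values of the
    listed degrees. *)
Lemma homset_bound X U :
  exists N, forall i, (N <= i)%N -> homset X U (- i%:Z) = [set 0].
Proof.
have [s [us [p [pX _ _ psum]]]] := graded_proj (gr_direct X) (gr_full X).
have [t [ut [q [_ _ qne qsum]]]] := graded_proj (gr_direct U) (gr_full U).
exists (\sum_(j <- s) `|j|%N + \sum_(j <- t) `|j|%N).+1%N => i Ni.
apply/setP=> h; rewrite inE [RHS]inE; apply/asboolP/eqP => [/hdegP h0|->]; last exact: hdeg0.
apply/lfunP=> v; rewrite zero_lfunE [v]psum linear_sum big1_seq //= => j js.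
rewrite [LHS]qsum big1_seq // => l /andP[_ lt]; apply: qne (h0 j _ _) => //.
apply: contraTneq Ni => lj; rewrite -ltnNge ltnS.
have lej : (`|j|%N <= \sum_(j <- s) `|j|%N)%N by rewrite (big_rem _ js) /= leq_addr.
have lel : (`|l|%N <= \sum_(j <- t) `|j|%N)%N by rewrite (big_rem _ lt) /= leq_addr.
by apply: leq_trans (leq_add lej lel); rewrite lj; lia.
Qed.

Lemma card_homset_bound X U :
  exists N, forall i, (N <= i)%N -> #|homset X U (- i%:Z)| = 1%N.
Proof.
by have [N HN] := homset_bound X U; exists N => i /HN ->; rewrite cards1.
Qed.

(* The multiplicative Euler characteristic of the part of Hom(X, U) in degrees
   at most 0; up to the number of coboundaries of degree 1 it depends only on
   cohomology (altc_cohom). *)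
Definition altc X U : rat :=
  \big[*%R/1]_(i \in @classical_sets.setT nat) (spow #|homset X U (- i%:Z)|%:Q i).

(** Every large [N] is allowed, so that several products can be truncated at a common place. *)
Lemma altcE X U : exists N0, forall N, (N0 <= N)%N ->
  altc X U = \prod_(0 <= i < N) (spow #|homset X U (- i%:Z)|%:Q i).
Proof.
have [N0 H0] := card_homset_bound X U; exists N0 => N leN.
by apply: fsbig_natT => i Ni; rewrite H0 ?spow1 // (leq_trans leN).
Qed.

Lemma card_homset_neq0 X U i : #|homset X U i|%:Q != 0.
Proof.
by rewrite pnatr_eq0 -lt0n; apply/card_gt0P; exists 0; apply: homset0.
Qed.

Lemma altc_neq0 X U : altc X U != 0.
Proof.
have [N /(_ N (leqnn _)) ->] := altcE X U; rewrite prodf_seq_neq0; apply/allP => i _ /=.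
by rewrite spow_eq0 card_homset_neq0.
Qed.

(** The factors |Hom^{-i-1}(X, V)| with exponent (-1)^{i+1} are those of [altc X V] shifted by one,
    with the term of degree 0 missing. Hence the division by |Hom^0(X, V)|, and the truncation of
    [altc X V] at [N.+1] in the proof. *)
Lemma tens_coefE U X V Y :
  tens_coef U X V Y =
  altc X V / (altc X U * altc Y V * #|homset X V 0|%:Q).
Proof.
have [N1 H1] := altcE X U; have [N2 H2] := altcE Y V; have [N3 H3] := altcE X V.
have [M1 K1] := card_homset_bound X U; have [M2 K2] := card_homset_bound Y V.
have [M3 K3] := card_homset_bound X V.
pose N := (N1 + N2 + N3 + M1 + M2 + M3)%N.
rewrite (H1 N) ?(H2 N) ?(H3 N.+1); try by rewrite /N; lia.
have oppS (i : nat) : - (i : int) - 1 = - i.+1%:Z by rewrite -addn1 PoszD opprD.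
rewrite /tens_coef (@fsbig_natT _ N) => [|i Ni]; last first.
  by rewrite oppS K1 ?K2 ?K3 ?mulr1 ?spow1 //; move: Ni; rewrite /N; lia.
rewrite big_nat_recl // expr0 expr1z oppr0 invfM invfM.
rewrite !mulrA [RHS](ACl ((1*5)*2*(3*4))) /= mulfV ?card_homset_neq0 // mul1r.
rewrite -prodfV -prodfV -!big_split /=; apply: eq_bigr => i _.
by rewrite oppS -!spowS PoszM PoszM !intrM !spowM mulrC.
Qed.

Lemma card_homset_iso U U' V V' (phi : 'Hom(U, U')) (psi : 'Hom(V, V')) i :
  fg_iso phi -> fg_iso psi -> #|homset U V i| = #|homset U' V' i|.
Proof.
move=> iphi ipsi.
apply: (@card_bij (finvect_type 'Hom(U, V)) (finvect_type 'Hom(U', V')) _ _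
  (fun h => (psi \o h \o phi^-1)%VF) (fun h => (psi^-1 \o h \o phi)%VF)).
- move=> h /homsetP h0; apply/homsetP.
  apply: (hdeg_compE (fg_iso_hdeg (fg_iso_inv iphi)) (hdeg_compE h0 (fg_iso_hdeg ipsi) erefl)).
  by rewrite addr0 add0r.
- move=> h /homsetP h0; apply/homsetP.
  apply: (hdeg_compE (fg_iso_hdeg iphi) (hdeg_compE h0 (fg_iso_hdeg (fg_iso_inv ipsi)) erefl)).
  by rewrite addr0 add0r.
- move=> h _; rewrite -!comp_lfunA (fg_iso_compVl iphi) comp_lfun1r comp_lfunA.
  by rewrite (fg_iso_compVl ipsi) comp_lfun1l.
move=> h _; rewrite -!comp_lfunA (fg_iso_compVr iphi) comp_lfun1r comp_lfunA.
by rewrite (fg_iso_compVr ipsi) comp_lfun1l.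
Qed.

Lemma altc_iso U U' V V' (phi : 'Hom(U, U')) (psi : 'Hom(V, V')) :
  fg_iso phi -> fg_iso psi -> altc U V = altc U' V'.
Proof.
by move=> iphi ipsi; apply: eq_fsbigr => i _; rewrite (card_homset_iso _ iphi ipsi).
Qed.

Lemma tens_coef_iso U U' V V' X X' Y Y' (a : 'Hom(U, U')) (b : 'Hom(V, V'))
    (c : 'Hom(X, X')) (d : 'Hom(Y, Y')) :
  fg_iso a -> fg_iso b -> fg_iso c -> fg_iso d ->
  tens_coef U X V Y = tens_coef U' X' V' Y'.
Proof.
move=> ia ib ic id; rewrite !tens_coefE (altc_iso ic ib) (altc_iso ic ia).
by rewrite (altc_iso id ib) (card_homset_iso _ ic ib).
Qed.

Lemma endset_ltP V i (h : 'End(V)) :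
  reflect (hdeg i h /\ lowers_flag h) ((h : finvect_type 'End(V)) \in endset_lt V i).
Proof.
apply: (iffP idP) => [/setIdP[/homsetP h0 /asboolP lh]|[h0 lh]] //.
by apply/setIdP; split; [apply/homsetP | apply/asboolP].
Qed.

Lemma comp_coef_iso V V' (phi : 'Hom(V, V')) : fg_iso phi ->
  comp_coef V = comp_coef V'.
Proof.
move=> iphi; apply: eq_fsbigr => i _; congr ((Posz _)%:~R ^ _).
have sub W W' (psi : 'Hom(W, W')) (h : 'End(W)) : fg_iso psi ->
    (h : finvect_type _) \in endset_lt W (- i%:Z) ->
    ((psi \o h \o psi^-1)%VF : finvect_type 'End(W')) \in endset_lt W' (- i%:Z).
  move=> ipsi /endset_ltP[h0 lh]; apply/endset_ltP; split.
    apply: (hdeg_compE (fg_iso_hdeg (fg_iso_inv ipsi)) (hdeg_compE h0 (fg_iso_hdeg ipsi) erefl)).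
    by rewrite addr0 add0r.
  have [_ _ flp] := ipsi; have [_ _ flv] := fg_iso_inv ipsi.
  by move=> j; rewrite !limg_comp flv -flp; apply: limgS; apply: lh.
apply: (@card_bij (finvect_type 'End(V)) (finvect_type 'End(V')) _ _
  (fun h => (phi \o h \o phi^-1)%VF) (fun h => (phi^-1 \o h \o phi)%VF)).
- by move=> h; apply: sub.
- by move=> h /(sub _ _ _ _ (fg_iso_inv iphi)); rewrite (fg_iso_invK iphi).
- move=> h _; rewrite -!comp_lfunA (fg_iso_compVl iphi) comp_lfun1r comp_lfunA.
  by rewrite (fg_iso_compVl iphi) comp_lfun1l.
move=> h _; rewrite -!comp_lfunA (fg_iso_compVr iphi) comp_lfun1r comp_lfunA.
by rewrite (fg_iso_compVr iphi) comp_lfun1l.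
Qed.

Lemma card_endset_lt_tens U X i :
  #|endset_lt (tens_space U X) i| =
  (#|endset_lt U i| * #|endset_lt X i| * #|homset X U i|)%N.
Proof.
rewrite -!cardsX; apply/esym.
pose E := (finvect_type 'End(U) * finvect_type 'End(X) * finvect_type 'Hom(X, U))%type.
pose h (p : E) : finvect_type 'End(tens_space U X) := ublock p.1.1 p.2 p.1.2.
have h_inj : injective h.
  by move=> [[a c] b] [[a' c'] b'] /ublock_inj[/= -> -> ->].
rewrite -(card_imset _ h_inj); apply: eq_card => D; apply/imsetP/endset_ltP.
  move=> [[[a c] b] /setXP[/setXP[/endset_ltP[a0 la] /endset_ltP[c0 lc]] /homsetP b0] ->].
  by split; [apply/hdeg_ublock | apply/lowers_flag_ublock].
move=> [D0 lD]; have [a [b [c eD]]] := lowers_flag_ublockP lD.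
rewrite eD in D0 lD *; move: D0 lD => /hdeg_ublock[a0 b0 c0] /lowers_flag_ublock[la lc].
exists (a, c, b) => //; apply/setXP; split; last exact/homsetP.
by apply/setXP; split; apply/endset_ltP.
Qed.

Lemma endset_lt0 V i : 0 \in endset_lt V i.
Proof.
by apply/endset_ltP; split=> [|j]; [apply: hdeg0 | rewrite lim0g sub0v].
Qed.

Lemma card_endset_lt_neq0 V i : #|endset_lt V i|%:Q != 0.
Proof.
by rewrite pnatr_eq0 -lt0n; apply/card_gt0P; exists 0; apply: endset_lt0.
Qed.

Lemma comp_coefE V : exists N0, forall N, (N0 <= N)%N ->
  comp_coef V = \prod_(0 <= i < N | (0 < i)%N) (spow #|endset_lt V (- i%:Z)|%:Q i).
Proof.
have [N0 H0] := homset_bound V V; exists N0 => N leN.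
apply: (@fsbig_nat (fun i => 0 < i)%N) => i Ni.
suff -> : endset_lt V (- i%:Z) = [set 0] by rewrite cards1 spow1.
apply/eqP; rewrite eqEsubset; apply/andP; split; apply/subsetP=> h.
  by case/setIdP=> + _; rewrite H0 // (leq_trans leN).
by move/set1P->; apply: endset_lt0.
Qed.

Lemma comp_coef_neq0 V : comp_coef V != 0.
Proof.
have [N /(_ N (leqnn _)) ->] := comp_coefE V; rewrite prodf_seq_neq0.
by apply/allP => i _ /=; rewrite spow_eq0 card_endset_lt_neq0 implybT.
Qed.

(** Flag-lowering maps of U + X have a free off-diagonal entry, which contributes |Hom^{-i}(X, U)|.
    The product defining [comp_coef] starts at i = 1 and that of [altc] at i = 0; |Hom^0(X, U)|
    makes up the difference. *)
Lemma comp_coef_tens U X :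
  comp_coef (tens_space U X) * #|homset X U 0|%:Q =
  comp_coef U * comp_coef X * altc X U.
Proof.
have [N1 H1] := comp_coefE U; have [N2 H2] := comp_coefE X.
have [N3 H3] := altcE X U; have [N4 H4] := comp_coefE (tens_space U X).
pose N := (N1 + N2 + N3 + N4)%N.
rewrite (H1 N.+1) ?(H2 N.+1) ?(H3 N.+1) ?(H4 N.+1); try by rewrite /N; lia.
rewrite big_mkcond /= [X in X * _ * _]big_mkcond /= [X in _ * X * _]big_mkcond /=.
rewrite !big_nat_recl //= !mul1r expr0 expr1z oppr0 mulrCA mulrC; congr (_ * _).
rewrite -!big_split /=; apply: eq_bigr => i _.
by rewrite card_endset_lt_tens !PoszM !intrM !spowM.
Qed.

Lemma card_homset_tensr X U V i :
  #|homset X (tens_space U V) i| = (#|homset X U i| * #|homset X V i|)%N.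
Proof.
rewrite -cardsX.
apply: (@card_bij (finvect_type 'Hom(X, tens_space U V))
  (finvect_type 'Hom(X, U) * finvect_type 'Hom(X, V))%type _ _
  (fun h => ((runit_lf U V \o h)%VF, (lunit_lf U V \o h)%VF))
  (fun p => (inl_lf U V \o p.1)%VF + (inr_lf U V \o p.2)%VF)).
- move=> h /homsetP/hdegP h0; apply/setXP; split; apply/homsetP/hdegP=> j x xj.
    by have := h0 j x xj; rewrite comp_lfunE runit_lfE mem_gr_tens => /andP[].
  by have := h0 j x xj; rewrite comp_lfunE lunit_lfE mem_gr_tens => /andP[].
- move=> [a b] /setXP[/homsetP/hdegP a0 /homsetP/hdegP b0].
  apply/homsetP/hdegP=> j x xj; rewrite mem_gr_tens add_lfunE !comp_lfunE.
  by rewrite inl_lfE inr_lfE /= addr0 add0r a0 ?b0.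
- move=> h _; apply/lfunP=> x; rewrite add_lfunE !comp_lfunE.
  rewrite inl_lfE inr_lfE runit_lfE lunit_lfE /=; case: (h x) => u v /=.
  by congr (_, _); rewrite ?addr0 ?add0r.
move=> [a b] _; congr (_, _); apply/lfunP=> x.
  by rewrite comp_lfunE runit_lfE add_lfunE !comp_lfunE inl_lfE inr_lfE /= addr0.
by rewrite comp_lfunE lunit_lfE add_lfunE !comp_lfunE inl_lfE inr_lfE /= add0r.
Qed.

Lemma card_homset_tensl X Y U i :
  #|homset (tens_space X Y) U i| = (#|homset X U i| * #|homset Y U i|)%N.
Proof.
rewrite -cardsX.
apply: (@card_bij (finvect_type 'Hom(tens_space X Y, U))
  (finvect_type 'Hom(X, U) * finvect_type 'Hom(Y, U))%type _ _
  (fun h => ((h \o inl_lf X Y)%VF, (h \o inr_lf X Y)%VF))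
  (fun p => (p.1 \o runit_lf X Y)%VF + (p.2 \o lunit_lf X Y)%VF)).
- move=> h /homsetP/hdegP h0; apply/setXP; split; apply/homsetP/hdegP=> j x xj.
    by rewrite comp_lfunE inl_lfE h0 // mem_gr_tens /= xj mem0v.
  by rewrite comp_lfunE inr_lfE h0 // mem_gr_tens /= xj mem0v.
- move=> [a b] /setXP[/homsetP/hdegP a0 /homsetP/hdegP b0].
  apply/homsetP/hdegP=> j p; rewrite mem_gr_tens add_lfunE !comp_lfunE.
  by rewrite runit_lfE lunit_lfE => /andP[p1 p2]; rewrite memvD ?a0 ?b0.
- move=> h _; apply/lfunP=> -[x y]; rewrite add_lfunE !comp_lfunE.
  rewrite inl_lfE inr_lfE runit_lfE lunit_lfE /= -linearD.
  by congr (h (_, _)); rewrite ?addr0 ?add0r.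
move=> [a b] _; congr (_, _); apply/lfunP=> x.
  by rewrite comp_lfunE inl_lfE add_lfunE !comp_lfunE runit_lfE lunit_lfE /= linear0 addr0.
by rewrite comp_lfunE inr_lfE add_lfunE !comp_lfunE runit_lfE lunit_lfE /= linear0 add0r.
Qed.

Lemma altc_split X U X1 U1 X2 U2 :
  (forall i, #|homset X U i| = (#|homset X1 U1 i| * #|homset X2 U2 i|)%N) ->
  altc X U = altc X1 U1 * altc X2 U2.
Proof.
move=> H.
have [N1 H1] := altcE X U; have [N2 H2] := altcE X1 U1; have [N3 H3] := altcE X2 U2.
pose N := (N1 + N2 + N3)%N; rewrite (H1 N) ?(H2 N) ?(H3 N); try by rewrite /N; lia.
by rewrite -big_split /=; apply: eq_bigr => i _; rewrite H !PoszM !intrM !spowM.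
Qed.

(** [altc] and |Hom^0| are multiplicative for direct sums in either argument; an identity of
    monomials remains. *)
Lemma tens_coef_assoc U V X Y Z W :
  tens_coef U X V Y * tens_coef (tens_space U X) Z (tens_space V Y) W =
  tens_coef X Z Y W * tens_coef U (tens_space X Z) V (tens_space Y W).
Proof.
rewrite !tens_coefE card_homset_tensr card_homset_tensl.
rewrite (altc_split (fun i => card_homset_tensr Z V Y i)).
rewrite (altc_split (fun i => card_homset_tensr Z U X i)).
rewrite (altc_split (fun i => card_homset_tensr W V Y i)).
rewrite (altc_split (fun i => card_homset_tensl X Z V i)).
rewrite (altc_split (fun i => card_homset_tensl X Z U i)).
rewrite (altc_split (fun i => card_homset_tensl Y W V i)).
rewrite !PoszM !intrM; field.
by rewrite !altc_neq0 !card_homset_neq0.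
Qed.

End AltProducts.

(** * Multiplicative Euler characteristics and their dependence on cohomology *)

Section Cohomology.
Variable k : finFieldType.
Implicit Types U V W X Y : flagspace k.
Local Notation spow x i := ((x : rat) ^ ((-1 : int) ^+ i)).

Section Telescope.
Variables (X U : flagspace k) (d : 'End(X)) (e : 'End(U)).

Let cob i : rat := #|coboundaries d e (1 - i%:Z) ((-1) ^+ i.+1)|%:Q.

(** The order of the cohomology of the Hom complex in degree -i. *)
Definition cohom_card i : rat :=
  #|cocycles d e (- i%:Z) ((-1) ^+ i)|%:Q /
  #|coboundaries d e (- i%:Z) ((-1) ^+ i)|%:Q.

Lemma cob_neq0 i eps : #|coboundaries d e i eps|%:Q != 0.
Proof.
by rewrite pnatr_eq0 -lt0n; apply/card_gt0P; exists 0; apply: coboundaries0.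
Qed.

(** |Hom^{-i}| is [cob i], times the order of cohomology in degree -i, times [cob i.+1]. In the
    alternating product the coboundary factors cancel in pairs, except for [cob 0] and the one at
    the upper end. *)
Lemma cohom_card_prod N :
  (\prod_(0 <= i < N) (spow #|homset X U (- i%:Z)|%:Q i)) * spow (cob N) N =
  cob 0 * \prod_(0 <= i < N) spow (cohom_card i) i.
Proof.
elim: N => [|N IHN]; first by rewrite !big_geq // mulr1 mul1r expr0 expr1z.
rewrite !big_nat_recr //= mulrA -IHN.
have -> : - N%:Z = 1 - N%:Z - 1 by rewrite addrAC subrr sub0r.
rewrite (card_homset d e _ ((-1) ^+ N.+1)) PoszM intrM spowM exprS mulN1r opprK.
have -> : 1 - N%:Z - 1 = - N%:Z by rewrite addrAC subrr sub0r.
rewrite -/(cob N) /cohom_card spowM spowS [cob N.+1]/cob.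
have -> : 1 - N.+1%:Z = - N%:Z by rewrite -addn1 PoszD opprD addrCA subrr addr0.
rewrite !exprS mulN1r mulN1r opprK.
have -> : spow (#|coboundaries d e (- N%:Z) ((-1) ^+ N)|%:Q)^-1 N =
  (spow #|coboundaries d e (- N%:Z) ((-1) ^+ N)|%:Q N)^-1.
  by rewrite !spowE; case: (odd N).
by rewrite /cob exprS mulN1r !mulrA.
Qed.

Lemma altc_cohom : exists N0, forall N, (N0 <= N)%N ->
  altc X U = #|coboundaries d e 1 (-1)|%:Q * \prod_(0 <= i < N) spow (cohom_card i) i.
Proof.
have [N1 H1] := altcE X U; have [N2 H2] := card_homset_bound X U.
exists (N1 + N2)%N => N leN; have := cohom_card_prod N.
rewrite -(H1 N) ?(leq_trans (leq_addr _ _) leN) // {2}/cob subr0 expr1 => <-.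
(* The upper end of the telescope is trivial: [cob N] divides |Hom^{-N}|, which is 1 for large
   [N]. *)
suff -> : cob N = 1 by rewrite spow1 mulr1.
apply/eqP; rewrite /cob -[1]/(1%:Q) eqr_int eqz_nat.
have HN := H2 N (leq_trans (leq_addl _ _) leN).
have eN : - N%:Z = 1 - N%:Z - 1 by rewrite addrAC subrr sub0r.
move: HN; rewrite eN (card_homset d e _ ((-1) ^+ N.+1)) -eN => /eqP.
by rewrite muln_eq1 => /andP[].
Qed.

End Telescope.

Lemma cohom_card_post X U V (dX : 'End(X)) (dU : 'End(U)) (dV : 'End(V))
    (f : 'Hom(U, V)) i :
  is_diff dX -> is_diff dU -> is_diff dV -> quasi_iso dU dV f ->
  cohom_card dX dU i = cohom_card dX dV i.
Proof.
move=> hX hU hV qf; apply/eqP; rewrite eqr_div ?cob_neq0 //.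
rewrite -!intrM -!PoszM (card_post _ hX hU hV qf) //.
by rewrite -exprMn mulrNN mulr1 expr1n.
Qed.

Lemma cohom_card_pre V X Y (dV : 'End(V)) (dX : 'End(X)) (dY : 'End(Y))
    (g : 'Hom(X, Y)) i :
  is_diff dV -> is_diff dX -> is_diff dY -> quasi_iso dX dY g ->
  cohom_card dY dV i = cohom_card dX dV i.
Proof.
move=> hV hX hY qg; apply/eqP; rewrite eqr_div ?cob_neq0 //.
rewrite -!intrM -!PoszM (card_pre _ hV hX hY qg) //.
by rewrite -exprMn mulrNN mulr1 expr1n.
Qed.

(** The cohomological products agree and drop out, leaving the coboundaries of degree 1 where the
    complexes are cut off. *)
Lemma altc_cohom_eq X U Y V (dX : 'End(X)) (dU : 'End(U)) (dY : 'End(Y))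
    (dV : 'End(V)) :
  (forall i, cohom_card dX dU i = cohom_card dY dV i) ->
  altc X U * #|coboundaries dY dV 1 (-1)|%:Q =
  altc Y V * #|coboundaries dX dU 1 (-1)|%:Q.
Proof.
move=> H; have [N1 H1] := altc_cohom dX dU; have [N2 H2] := altc_cohom dY dV.
rewrite (H1 (N1 + N2)%N) ?leq_addr // (H2 (N1 + N2)%N) ?leq_addl //.
rewrite (eq_bigr _ (fun i _ => congr1 (fun x : rat => spow x i) (H i))).
by rewrite mulrAC [RHS]mulrAC [X in X * _ = _]mulrC.
Qed.

End Cohomology.

(** * Transport of triples and morphisms along isomorphisms of objects *)

Section Transport.
Variable k : finFieldType.
Implicit Types U V W X Y : flagspace k.

Lemma qtriple_ext U V (s t : qtriple U V) :
  dsrc s = dsrc t -> qmap s = qmap t -> dtgt s = dtgt t -> s = t.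
Proof.
case: s t => [[[d f] e] hs] [[[d' f'] e'] ht]; rewrite /dsrc /qmap /dtgt /=.
by move=> ed ef ee; apply: val_inj; rewrite /= ed ef ee.
Qed.

Lemma dsrc_diff U V (s : qtriple U V) : is_diff (dsrc s).
Proof. by case: (qtripleP s). Qed.

Lemma dtgt_diff U V (s : qtriple U V) : is_diff (dtgt s).
Proof. by case: (qtripleP s). Qed.

Lemma qmap_qiso U V (s : qtriple U V) : quasi_iso (dsrc s) (dtgt s) (qmap s).
Proof. by case: (qtripleP s). Qed.

Lemma qmap_chain U V (s : qtriple U V) :
  (qmap s \o dsrc s)%VF = (dtgt s \o qmap s)%VF.
Proof. by case: (qmap_qiso s). Qed.

Lemma qmap_hdeg U V (s : qtriple U V) : hdeg 0 (qmap s).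
Proof. by case: (qmap_qiso s). Qed.

Lemma dsrc_hdeg U V (s : qtriple U V) : hdeg 1 (dsrc s).
Proof. by case: (dsrc_diff s). Qed.

Lemma dtgt_hdeg U V (s : qtriple U V) : hdeg 1 (dtgt s).
Proof. by case: (dtgt_diff s). Qed.

Lemma quasi_iso_fg_iso U V (phi : 'Hom(U, V)) (d : 'End(U)) (e : 'End(V)) :
  fg_iso phi -> (phi \o d)%VF = (e \o phi)%VF -> quasi_iso d e phi.
Proof.
move=> ip cp; have pK := fg_isoK ip; have pVK := fg_isoVK ip.
have cE v : phi (d v) = e (phi v) by have /lfunP/(_ v) := cp; rewrite !comp_lfunE.
split=> [||v dv [w pv]|w ew] //; first exact: fg_iso_hdeg.
  by exists (phi^-1%VF w); apply: (can_inj pK); rewrite cE pVK.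
exists (phi^-1%VF w); first by apply: (can_inj pK); rewrite cE pVK ew linear0.
by exists 0; rewrite pVK linear0 addr0.
Qed.

Lemma quasi_iso_homotopic U V (d : 'End(U)) (e : 'End(V)) (f g : 'Hom(U, V)) :
  (d \o d)%VF = 0 -> (e \o e)%VF = 0 -> hdeg 1 d -> hdeg 1 e ->
  quasi_iso d e f -> homotopic d e f g -> quasi_iso d e g.
Proof.
move=> d2 e2 d1 e1 [f0 fd finj fsurj] [h h1 fg].
have eg : g = f - ((e \o h)%VF + (h \o d)%VF) by rewrite -fg opprB addrC subrK.
have {}d2 v : d (d v) = 0 by have /lfunP/(_ v) := d2; rewrite comp_lfunE zero_lfunE.
have gE v : g v = f v - (e (h v) + h (d v)).
  by rewrite eg add_lfunE opp_lfunE add_lfunE !comp_lfunE.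
split.
- rewrite eg; apply: hdegB => //; apply: hdegD; first exact: (hdeg_compE h1 e1).
  exact: (hdeg_compE d1 h1).
- rewrite eg comp_lfunBl comp_lfunBr fd comp_lfunDl comp_lfunDr.
  rewrite -[((h \o d) \o d)%VF]comp_lfunA (comp_lfunA e e) e2 comp_lfun0l add0r.
  have -> : (d \o d)%VF = 0 by apply/lfunP=> v; rewrite comp_lfunE d2 zero_lfunE.
  by rewrite comp_lfun0r addr0 comp_lfunA.
- move=> v dv [w gv]; apply: finj => //; exists (w + h v).
  by rewrite linearD /= -gv gE dv linear0 addr0 subrK.
move=> w ew; have [v dv [w' ->]] := fsurj w ew; exists v => //.
by exists (w' + h v); rewrite gE dv linear0 addr0 linearD /= addrA addrAC subrK.
Qed.

(* The relation of qtriple_equiv for prescribed isomorphisms phi, psi, which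
   may change the underlying flagged spaces. *)
Definition gequiv U V U' V' (phi : 'Hom(U, U')) (psi : 'Hom(V, V'))
    (s : qtriple U V) (s' : qtriple U' V') : Prop :=
  [/\ fg_iso phi, fg_iso psi, (phi \o dsrc s)%VF = (dsrc s' \o phi)%VF,
      (psi \o dtgt s)%VF = (dtgt s' \o psi)%VF
    & homotopic (dsrc s) (dtgt s') (psi \o qmap s)%VF (qmap s' \o phi)%VF].

Lemma gequiv_equiv U V (s t : qtriple U V) :
  qtriple_equiv s t <-> exists phi psi, gequiv phi psi s t.
Proof.
split=> [[phi [psi [[? ?] [? ?] ?]]]|[phi [psi [? ? ? ? ?]]]]; by exists phi, psi.
Qed.

Lemma homotopic_eq U V (d : 'End(U)) (e : 'End(V)) (f g : 'Hom(U, V)) :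
  f = g -> homotopic d e f g.
Proof.
move=> ->; exists 0; first exact: hdeg0.
by rewrite subrr comp_lfun0l comp_lfun0r addr0.
Qed.

Lemma homotopic_trans U V (d : 'End(U)) (e : 'End(V)) (f g h : 'Hom(U, V)) :
  homotopic d e f g -> homotopic d e g h -> homotopic d e f h.
Proof.
move=> [a a1 ea] [b b1 eb]; exists (a + b); first exact: hdegD.
rewrite comp_lfunDl comp_lfunDr addrACA -ea -eb addrA subrK //.
Qed.

Lemma homotopic_sym U V (d : 'End(U)) (e : 'End(V)) (f g : 'Hom(U, V)) :
  homotopic d e f g -> homotopic d e g f.
Proof.
move=> [a a1 ea]; exists (- a); first exact: hdegN.
by rewrite comp_lfunNl comp_lfunNr -opprD -ea opprB.
Qed.

Lemma homotopic_post U V W (d : 'End(U)) (e : 'End(V)) (c : 'End(W))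
    (f g : 'Hom(U, V)) (p : 'Hom(V, W)) :
  hdeg 0 p -> (p \o e)%VF = (c \o p)%VF -> homotopic d e f g ->
  homotopic d c (p \o f)%VF (p \o g)%VF.
Proof.
move=> p0 pe [a a1 ea]; exists (p \o a)%VF; first by apply: (hdeg_compE a1 p0); rewrite addr0.
by rewrite -comp_lfunBr ea comp_lfunDr !comp_lfunA pe.
Qed.

Lemma homotopic_pre U V W (d : 'End(U)) (e : 'End(V)) (c : 'End(W))
    (f g : 'Hom(V, W)) (p : 'Hom(U, V)) :
  hdeg 0 p -> (p \o d)%VF = (e \o p)%VF -> homotopic e c f g ->
  homotopic d c (f \o p)%VF (g \o p)%VF.
Proof.
move=> p0 pe [a a1 ea]; exists (a \o p)%VF; first by apply: (hdeg_compE p0 a1); rewrite add0r.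
by rewrite -comp_lfunBl ea comp_lfunDl -!comp_lfunA pe.
Qed.

Lemma gequiv_refl U V (s : qtriple U V) : gequiv \1%VF \1%VF s s.
Proof.
by split; rewrite ?comp_lfun1l ?comp_lfun1r //; [exact: fg_iso1 | exact: fg_iso1 |
  exact: homotopic_eq].
Qed.

Lemma gequiv_trans U V U' V' U2 V2 (phi : 'Hom(U, U')) (psi : 'Hom(V, V'))
    (phi' : 'Hom(U', U2)) (psi' : 'Hom(V', V2)) s s' s2 :
  gequiv phi psi s s' -> gequiv phi' psi' s' s2 ->
  gequiv (phi' \o phi)%VF (psi' \o psi)%VF s s2.
Proof.
move=> [i1 i2 c1 c2 h] [i1' i2' c1' c2' h']; split; try exact: fg_iso_comp.
- by rewrite -comp_lfunA c1 !comp_lfunA c1'.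
- by rewrite -comp_lfunA c2 !comp_lfunA c2'.
rewrite -comp_lfunA; apply: homotopic_trans (homotopic_post (fg_iso_hdeg i2') c2' h) _.
by rewrite !comp_lfunA; apply: homotopic_pre (fg_iso_hdeg i1) c1 h'.
Qed.

Lemma fg_iso_conjV U U' (phi : 'Hom(U, U')) (d : 'End(U)) (d' : 'End(U')) :
  fg_iso phi -> (phi \o d)%VF = (d' \o phi)%VF ->
  (phi^-1 \o d')%VF = (d \o phi^-1)%VF.
Proof.
move=> ip cp; apply/lfunP=> v; apply: (can_inj (fg_isoK ip)).
by have /lfunP/(_ (phi^-1%VF v)) := cp; rewrite !comp_lfunE !fg_isoVK // => ->.
Qed.

Lemma gequiv_sym U V U' V' (phi : 'Hom(U, U')) (psi : 'Hom(V, V')) s s' :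
  gequiv phi psi s s' -> gequiv phi^-1%VF psi^-1%VF s' s.
Proof.
move=> [i1 i2 c1 c2 h]; have j1 := fg_iso_inv i1; have j2 := fg_iso_inv i2.
have d1 := fg_iso_conjV i1 c1; have d2 := fg_iso_conjV i2 c2.
split=> //; apply: homotopic_sym.
have := homotopic_post (fg_iso_hdeg j2) d2 (homotopic_pre (fg_iso_hdeg j1) d1 h).
rewrite !comp_lfunA fg_iso_compVl // comp_lfun1l.
by rewrite -[((psi^-1 \o qmap s') \o phi \o _)%VF]comp_lfunA fg_iso_compVr // comp_lfun1r.
Qed.

Section Translate.
Variables (U V U' V' : flagspace k) (phi : 'Hom(U, U')) (psi : 'Hom(V, V')).
Variables (h : 'Hom(U, V')) (iphi : fg_iso phi) (ipsi : fg_iso psi).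
Hypothesis h1 : hdeg (-1) h.
Variable s : qtriple U V.

Let d' : 'End(U') := (phi \o dsrc s \o phi^-1)%VF.
Let e' : 'End(V') := (psi \o dtgt s \o psi^-1)%VF.
(** The solution of [psi f - f' phi = e' h + h d] for [f']: translation may also move the
    quasi-isomorphism within its homotopy class. *)
Let f' : 'Hom(U', V') :=
  (((psi \o qmap s) - ((e' \o h) + (h \o dsrc s))) \o phi^-1)%VF.

Fact translate_proof : is_qtriple d' f' e'.
Proof.
have dd' : is_diff d' by apply: is_diff_push => //; apply: dsrc_diff.
have de' : is_diff e' by apply: is_diff_push => //; apply: dtgt_diff.
have cphi : (phi \o dsrc s)%VF = (d' \o phi)%VF.
  by rewrite /d' -[RHS]comp_lfunA fg_iso_compVl // comp_lfun1r.
have cpsi : (psi \o dtgt s)%VF = (e' \o psi)%VF.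
  by rewrite /e' -[RHS]comp_lfunA fg_iso_compVl // comp_lfun1r.
have [ds1 _ ds2] := dsrc_diff s; have [e1 _ e2] := dtgt_diff s.
have [e'1 _ e'2] := de'; split=> //.
apply: (@quasi_iso_comp _ U' U V' d' (dsrc s) e') => //.
  by apply: quasi_iso_fg_iso; [exact: fg_iso_inv | exact: fg_iso_conjV].
apply: (@quasi_iso_homotopic _ _ _ _ (psi \o qmap s)%VF) => //.
  by apply: quasi_iso_comp (qmap_qiso s) _ => //; apply: quasi_iso_fg_iso.
by exists h => //; rewrite opprD addrA subrr sub0r opprK.
Qed.

Definition translate : qtriple U' V' := mk_qtriple translate_proof.

Lemma dsrc_translate : dsrc translate = d'. Proof. by []. Qed.
Lemma dtgt_translate : dtgt translate = e'. Proof. by []. Qed.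
Lemma qmap_translate : qmap translate = f'. Proof. by []. Qed.

Lemma gequiv_translate : gequiv phi psi s translate.
Proof.
split=> //; rewrite ?dsrc_translate ?dtgt_translate ?qmap_translate.
- by rewrite /d' -[RHS]comp_lfunA fg_iso_compVl // comp_lfun1r.
- by rewrite /e' -[RHS]comp_lfunA fg_iso_compVl // comp_lfun1r.
exists h => //; rewrite /f' -[in X in _ - X]comp_lfunA fg_iso_compVl // comp_lfun1r.
by rewrite opprB addrC subrK.
Qed.

End Translate.

(** The isomorphisms and the homotopy determine the second triple from the first. This replaces the
    relation by an explicit map, which can then be used for reindexing sums. *)
Lemma gequiv_translateP U V U' V' (phi : 'Hom(U, U')) (psi : 'Hom(V, V')) s s' :
  gequiv phi psi s s' -> exists h (ip : fg_iso phi) (iq : fg_iso psi)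
    (h1 : hdeg (-1) h), s' = translate ip iq h1 s.
Proof.
move=> [ip iq c1 c2 [h h1 eh]]; exists h, ip, iq, h1.
have e1 : dsrc s' = (phi \o dsrc s \o phi^-1)%VF.
  by rewrite c1 -comp_lfunA fg_iso_compVr // comp_lfun1r.
have e2 : dtgt s' = (psi \o dtgt s \o psi^-1)%VF.
  by rewrite c2 -comp_lfunA fg_iso_compVr // comp_lfun1r.
apply: qtriple_ext; rewrite ?dsrc_translate ?dtgt_translate ?qmap_translate -?e1 -?e2 //.
rewrite -eh opprB addrC subrK.
by rewrite -comp_lfunA fg_iso_compVr // comp_lfun1r.
Qed.

(** Translations are bijections, the inverse being the translation by the inverse isomorphisms and
    the conjugated homotopy with opposite sign. *)
Lemma translateK U V U' V' (phi : 'Hom(U, U')) (psi : 'Hom(V, V')) h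
    (ip : fg_iso phi) (iq : fg_iso psi) (h1 : hdeg (-1) h) :
  exists h' (jp : fg_iso phi^-1%VF) (jq : fg_iso psi^-1%VF) (h'1 : hdeg (-1) h'),
    [/\ h' = - (psi^-1 \o h \o phi^-1)%VF,
        cancel (translate ip iq h1) (translate jp jq h'1)
      & cancel (translate jp jq h'1) (translate ip iq h1)].
Proof.
exists (- (psi^-1 \o h \o phi^-1)%VF), (fg_iso_inv ip), (fg_iso_inv iq).
have h'1 : hdeg (-1) (- (psi^-1 \o h \o phi^-1)%VF).
  apply: hdegN; apply: (hdeg_compE (fg_iso_hdeg (fg_iso_inv ip)) (hdeg_compE h1 (fg_iso_hdeg (fg_iso_inv iq)) erefl)).
  by rewrite addr0 add0r.
have pl := fg_iso_compVl ip; have pr := fg_iso_compVr ip.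
have ql := fg_iso_compVl iq; have qr := fg_iso_compVr iq.
exists h'1; split=> // s.
  apply: qtriple_ext; rewrite ?dsrc_translate ?dtgt_translate ?qmap_translate.
  - rewrite (fg_iso_invK ip); apply/lfunP=> v; rewrite !comp_lfunE.
    by rewrite !(fg_isoK ip).
  - apply/lfunP=> v; rewrite !(comp_lfunE, add_lfunE, opp_lfunE) (fg_iso_invK ip) (fg_iso_invK iq).
    rewrite !(comp_lfunE, fg_isoK ip, fg_isoK iq, fg_isoVK iq, linearN, linearB, linearD) /=.
    rewrite !(fg_isoK ip, fg_isoK iq, fg_isoVK iq).
    by rewrite !opprK -addrA addrACA !addNr !addr0.
  rewrite (fg_iso_invK iq); apply/lfunP=> v; rewrite !comp_lfunE.
  by rewrite !(fg_isoK iq).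
apply: qtriple_ext; rewrite ?dsrc_translate ?dtgt_translate ?qmap_translate.
- rewrite (fg_iso_invK ip); apply/lfunP=> v; rewrite !comp_lfunE.
  by rewrite !(fg_isoVK ip).
- apply/lfunP=> v; rewrite !(comp_lfunE, add_lfunE, opp_lfunE) (fg_iso_invK ip) (fg_iso_invK iq).
  rewrite !(comp_lfunE, fg_isoVK ip, fg_isoK iq, fg_isoVK iq, linearN, linearB, linearD) /=.
  rewrite !(fg_isoVK ip, fg_isoK iq, fg_isoVK iq).
  by rewrite !opprK -addrA addrACA !addrN !addr0.
rewrite (fg_iso_invK iq); apply/lfunP=> v; rewrite !comp_lfunE.
by rewrite !(fg_isoVK iq).
Qed.

Lemma linear_sumE (A B : lmodType rat) (F : A -> B) : linear F ->
  forall (I : Type) (r : seq I) (P : pred I) (c : I -> rat) (x : I -> A),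
  F (\sum_(i <- r | P i) c i *: x i) = \sum_(i <- r | P i) c i *: F (x i).
Proof.
move=> linF I r P c x; pose F' : {linear A -> B} := HB.pack F (GRing.isLinear.Build rat A B *:%R F linF).
have -> : F = F' by []; rewrite linear_sum; apply: eq_bigr => i _.
by rewrite linearZ.
Qed.

Lemma sum_cls U V (x : Hhom U V) : x = \sum_c x c *: cls (qrepr c).
Proof.
apply/ffunP=> c; rewrite sum_ffunE (bigD1 c) //= big1 ?addr0.
  by rewrite /cls qreprK /Hbasis !ffunE eqxx; apply/esym/mulr1.
move=> c' /negPf c'c; rewrite /cls qreprK /Hbasis !ffunE eq_sym c'c.
exact: mulr0.
Qed.

Lemma Hhom_ext (B : lmodType rat) U V (F G : Hhom U V -> B) :
  linear F -> linear G -> (forall t, F (cls t) = G (cls t)) -> F =1 G.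
Proof.
move=> linF linG FG x; rewrite [x]sum_cls !linear_sumE //.
by apply: eq_bigr => c _; rewrite FG.
Qed.

Lemma cls_equiv U V (s t : qtriple U V) : qtriple_equiv s t -> cls s = cls t.
Proof. by move=> st; congr Hbasis; apply/eqP/qclassP. Qed.

Lemma cls_gequiv U V phi psi (s t : qtriple U V) :
  gequiv phi psi s t -> cls s = cls t.
Proof. by move=> st; apply/cls_equiv/gequiv_equiv; exists phi, psi. Qed.

Lemma qrepr_equiv U V (t : qtriple U V) : qtriple_equiv (qrepr (qclass t)) t.
Proof. by apply/qclassP; rewrite qreprK. Qed.

Definition class_gequiv U V U' V' (phi : 'Hom(U, U')) (psi : 'Hom(V, V'))
    (c : Bset U V) (c' : Bset U' V') : Prop :=
  exists s s', [/\ qclass s = c, qclass s' = c' & gequiv phi psi s s'].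

(* The action on morphisms of a pair of isomorphisms of objects; it is defined
   through the relation so as not to depend on proofs of fg_iso. *)
Definition Htr U V U' V' (phi : 'Hom(U, U')) (psi : 'Hom(V, V'))
    (x : Hhom U V) : Hhom U' V' :=
  [ffun c' => \sum_c x c * (`[< class_gequiv phi psi c c' >])%:R].

Lemma Htr_linear U V U' V' (phi : 'Hom(U, U')) (psi : 'Hom(V, V')) :
  linear (Htr phi psi).
Proof.
move=> a x y; apply/ffunP=> c'; rewrite !ffunE.
rewrite scaler_sumr -big_split /=; apply: eq_bigr => c _.
by rewrite !ffunE mulrDl scalerAl.
Qed.

(** Two images of one class are equivalent: go back along one relation and forward along the other.
    So each class has exactly one image. *)
Lemma Htr_cls U V U' V' (phi : 'Hom(U, U')) (psi : 'Hom(V, V')) s s' :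
  gequiv phi psi s s' -> Htr phi psi (cls s) = cls s'.
Proof.
move=> e; apply/ffunP=> c'; rewrite !ffunE (bigD1 (qclass s)) //= big1 ?addr0.
  rewrite ffunE eqxx mul1r; congr (nat_of_bool _)%:R.
  apply/asboolP/eqP => [[s1 [s1' [/eqP/qclassP/gequiv_equiv[a [b e1]] <- e2]]]|->].
    apply/eqP/qclassP/gequiv_equiv; do 2 eexists.
    exact: gequiv_trans (gequiv_trans (gequiv_sym e2) e1) e.
  by exists s, s'.
by move=> c /negPf sc; rewrite ffunE sc mul0r.
Qed.

Lemma Htr_Htr U V U' V' U2 V2 (phi : 'Hom(U, U')) (psi : 'Hom(V, V'))
    (phi' : 'Hom(U', U2)) (psi' : 'Hom(V', V2)) x :
  fg_iso phi -> fg_iso psi -> fg_iso phi' -> fg_iso psi' ->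
  Htr phi' psi' (Htr phi psi x) = Htr (phi' \o phi)%VF (psi' \o psi)%VF x.
Proof.
move=> i1 i2 i1' i2'; move: x; apply: Hhom_ext; try exact: Htr_linear.
  by move=> a x y /=; rewrite !Htr_linear.
move=> s; have e := gequiv_translate i1 i2 (hdeg0 _ _ _) s.
have e' := gequiv_translate i1' i2' (hdeg0 _ _ _) (translate i1 i2 (hdeg0 _ _ _) s).
by rewrite (Htr_cls e) (Htr_cls e') (Htr_cls (gequiv_trans e e')).
Qed.

Lemma Htr1 U V (x : Hhom U V) : Htr \1%VF \1%VF x = x.
Proof.
move: x; apply: Hhom_ext => [|//|s]; first exact: Htr_linear.
exact/Htr_cls/gequiv_refl.
Qed.

Lemma gequiv_push U V W (phi : 'Hom(V, W)) (ip : fg_iso phi) (s : qtriple U V) :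
  gequiv \1%VF phi s (push_qtriple ip s).
Proof.
split=> //; first exact: fg_iso1.
- by rewrite comp_lfun1l comp_lfun1r.
- by rewrite -[RHS]comp_lfunA fg_iso_compVl // comp_lfun1r.
by apply: homotopic_eq; rewrite comp_lfun1r.
Qed.

Lemma Hpush_Htr U V W (phi : 'Hom(V, W)) (ip : fg_iso phi) (x : Hhom U V) :
  Hpush ip x = Htr \1%VF phi x.
Proof.
rewrite [in RHS](sum_cls x) linear_sumE; last exact: Htr_linear.
by apply: eq_bigr => c _; rewrite (Htr_cls (gequiv_push ip _)).
Qed.

End Transport.

(** * Composition: well-definedness, associativity, identities *)

Section Composition.
Variable k : finFieldType.
Implicit Types U V W X Y : flagspace k.

(** Automorphisms of the two objects are built into the equivalence of triples, so they act
    trivially on classes. *)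
Lemma Htr_endo U V (phi : 'End(U)) (psi : 'End(V)) (x : Hhom U V) :
  fg_iso phi -> fg_iso psi -> Htr phi psi x = x.
Proof.
move=> ip iq; move: x; apply: Hhom_ext => [|//|s]; first exact: Htr_linear.
have e := gequiv_translate ip iq (hdeg0 _ _ _) s.
by rewrite (Htr_cls e) (cls_gequiv e).
Qed.

(** A total form of [cls] on raw maps, with default 0; sums can then be rewritten without carrying
    proofs in the summand. *)
Definition clsr U V (d : 'End(U)) (f : 'Hom(U, V)) (e : 'End(V)) : Hhom U V :=
  if pselect (is_qtriple d f e) is left h then cls (mk_qtriple h) else 0.

Lemma clsrE U V (t : qtriple U V) d f e :
  dsrc t = d -> qmap t = f -> dtgt t = e -> clsr d f e = cls t.
Proof.
move=> ed ef ee; rewrite /clsr; case: pselect => [h|[]].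
  by congr (cls _); apply: qtriple_ext.
by rewrite -ed -ef -ee; apply: qtripleP.
Qed.

Definition comp_qtriple U V W (t : qtriple V W) (s : qtriple U V) b
    (hb : cx_iso (dtgt s) (dsrc t) b) : qtriple U W :=
  mk_qtriple (comp_qtriple_proof hb).

Lemma clsr_comp U V W (t : qtriple V W) (s : qtriple U V) b
    (hb : cx_iso (dtgt s) (dsrc t) b) :
  clsr (dsrc s) (qmap t \o b \o qmap s)%VF (dtgt t) = cls (comp_qtriple hb).
Proof. exact: clsrE. Qed.

Lemma comp_repE U V W (t : qtriple V W) (s : qtriple U V) :
  comp_rep t s = comp_coef V *:
    \sum_(b : finvect_type 'End(V) | `[< cx_iso (dtgt s) (dsrc t) b >])
      clsr (dsrc s) (qmap t \o b \o qmap s)%VF (dtgt t).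
Proof.
congr (_ *: _); apply: sum_sig => b; apply/esym.
exact: (clsr_comp (asboolW (valP b))).
Qed.

Lemma gequiv_comp U V W U' V' W' (phi : 'Hom(U, U')) (psi psi2 : 'Hom(V, V'))
    (chi : 'Hom(W, W')) (s : qtriple U V) (s' : qtriple U' V')
    (t : qtriple V W) (t' : qtriple V' W') b b'
    (hb : cx_iso (dtgt s) (dsrc t) b) (hb' : cx_iso (dtgt s') (dsrc t') b') :
  gequiv phi psi s s' -> gequiv psi2 chi t t' -> (psi2 \o b)%VF = (b' \o psi)%VF ->
  gequiv phi chi (comp_qtriple hb) (comp_qtriple hb').
Proof.
move=> [ip iq cp cq hs] [ip2 ic cp2 cc ht] eb; split=> //.
have [ib cb] := hb; have [ib' cb'] := hb'.
have ht1 := homotopic_pre (qmap_hdeg s) (qmap_chain s)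
  (homotopic_pre (fg_iso_hdeg ib) cb ht).
have tb' : ((qmap t' \o b') \o dtgt s' = dtgt t' \o (qmap t' \o b'))%VF.
  by rewrite -comp_lfunA cb' !comp_lfunA qmap_chain.
have hs1 := homotopic_post (hdeg_compE (fg_iso_hdeg ib') (qmap_hdeg t') (esym (addr0 0))) tb' hs.
rewrite !comp_lfunA in hs1 ht1 *.
rewrite -[((qmap t' \o psi2) \o b)%VF]comp_lfunA eb !comp_lfunA in ht1.
exact: homotopic_trans ht1 hs1.
Qed.

(** The isomorphisms [psi] and [psi2] of the middle object may differ, because the sum runs over all
    [b]: they are absorbed by the bijection [b |-> psi2 b psi^-1]. *)
Lemma comp_rep_tr U V W U' V' W' (phi : 'Hom(U, U')) (psi psi2 : 'Hom(V, V'))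
    (chi : 'Hom(W, W')) (s : qtriple U V) (s' : qtriple U' V')
    (t : qtriple V W) (t' : qtriple V' W') :
  gequiv phi psi s s' -> gequiv psi2 chi t t' ->
  comp_rep t' s' = Htr phi chi (comp_rep t s).
Proof.
move=> hs ht; have [ip iq cp cq _] := hs; have [ip2 ic cp2 cc _] := ht.
have -> : Htr phi chi (comp_rep t s) = comp_coef V *:
    \sum_(b : finvect_type 'End(V) | `[< cx_iso (dtgt s) (dsrc t) b >])
      Htr phi chi (clsr (dsrc s) (qmap t \o b \o qmap s)%VF (dtgt t)).
  rewrite comp_repE scaler_sumr linear_sumE; last exact: Htr_linear.
  by rewrite scaler_sumr.
rewrite comp_repE -(comp_coef_iso iq); congr (_ *: _).
pose tr (b : finvect_type 'End(V)) : finvect_type 'End(V') := (psi2 \o b \o psi^-1)%VF.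
have trP (b : finvect_type 'End(V)) : `[< cx_iso (dtgt s) (dsrc t) b >] ->
    cx_iso (dtgt s') (dsrc t') (tr b).
  move=> /asboolP[ib cb]; split.
    by apply: fg_iso_comp (fg_iso_comp ib ip2); apply: fg_iso_inv.
  by rewrite /tr -comp_lfunA (fg_iso_conjV iq cq) !comp_lfunA -cp2 -(comp_lfunA psi2) cb comp_lfunA.
have trE (b : finvect_type 'End(V)) : (psi2 \o b)%VF = (tr b \o psi)%VF.
  by rewrite /tr -[RHS]comp_lfunA (fg_iso_compVl iq) comp_lfun1r.
apply/esym; apply: (sum_bij (h := tr)
  (h' := fun b' : 'End(V') => (psi2^-1 \o b' \o psi)%VF)).
- by move=> b /trP ?; apply/asboolP.
- move=> b /asboolP[ib cb]; apply/asboolP; split.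
    by apply: fg_iso_comp (fg_iso_comp ib _) => //; apply: fg_iso_inv.
  rewrite -[LHS]comp_lfunA cq !comp_lfunA -(comp_lfunA _ b) cb !comp_lfunA.
  by rewrite (fg_iso_conjV ip2 cp2).
- move=> b _; rewrite /tr -!comp_lfunA (fg_iso_compVl iq) comp_lfun1r comp_lfunA.
  by rewrite (fg_iso_compVl ip2) comp_lfun1l.
- move=> b _; rewrite /tr -!comp_lfunA (fg_iso_compVr iq) comp_lfun1r comp_lfunA.
  by rewrite (fg_iso_compVr ip2) comp_lfun1l.
move=> b hb; have hb' := trP b hb; move/asboolP in hb.
rewrite (clsr_comp hb) (clsr_comp hb'); apply: Htr_cls.
exact: gequiv_comp hs ht (trE b).
Qed.

Lemma big_cls (M : lmodType rat) U V (s : qtriple U V) (F : Bset U V -> M) :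
  \sum_c cls s c *: F c = F (qclass s).
Proof.
rewrite (bigD1 (qclass s)) //= big1 ?addr0 => [|c /negPf sc].
  by rewrite ffunE eqxx scale1r.
by rewrite ffunE sc scale0r.
Qed.

Lemma HcompE U V W (y : Hhom V W) (x : Hhom U V) :
  Hcomp y x = \sum_c y c *: \sum_b x b *: comp_rep (qrepr c) (qrepr b).
Proof.
apply: eq_bigr => c _; rewrite scaler_sumr; apply: eq_bigr => b _.
by rewrite scalerA.
Qed.

(** Changing representatives changes [comp_rep] by the transport along automorphisms of the outer
    objects, which is trivial by [Htr_endo]. *)
Lemma Hcomp_cls U V W (t : qtriple V W) (s : qtriple U V) :
  Hcomp (cls t) (cls s) = comp_rep t s.
Proof.
rewrite HcompE big_cls big_cls.
have /gequiv_equiv[a [b e]] := qrepr_equiv s.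
have /gequiv_equiv[a' [b' e']] := qrepr_equiv t.
rewrite (comp_rep_tr e e') Htr_endo //; [by case: e | by case: e'].
Qed.

Lemma Hcomp_linr U V W (y : Hhom V W) : linear (@Hcomp k U V W y).
Proof.
move=> a x x'; rewrite !HcompE scaler_sumr -big_split; apply: eq_bigr => c _ /=.
rewrite scalerA mulrC -scalerA -scalerDr; congr (_ *: _); rewrite scaler_sumr -big_split.
by apply: eq_bigr => b _; rewrite !ffunE scalerDl /= (scalerA a).
Qed.

Lemma Hcomp_linl U V W (x : Hhom U V) : linear (fun y : Hhom V W => Hcomp y x).
Proof.
move=> a y y'; rewrite !HcompE scaler_sumr -big_split; apply: eq_bigr => c _ /=.
by rewrite !ffunE scalerDl scalerA.
Qed.

Lemma Hcomp_sumr U V W (y : Hhom V W) a (I : finType) (P : pred I) (x : I -> Hhom U V) :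
  Hcomp y (a *: \sum_(i | P i) x i) = a *: \sum_(i | P i) Hcomp y (x i).
Proof.
by rewrite scaler_sumr linear_sumE ?scaler_sumr //; apply: Hcomp_linr.
Qed.

Lemma Hcomp_suml U V W (x : Hhom U V) a (I : finType) (P : pred I) (y : I -> Hhom V W) :
  Hcomp (a *: \sum_(i | P i) y i) x = a *: \sum_(i | P i) Hcomp (y i) x.
Proof.
have := @linear_sumE _ _ (fun y : Hhom V W => Hcomp y x) (Hcomp_linl _) _ (index_enum I) P (fun=> a) y.
by rewrite -!scaler_sumr.
Qed.

Lemma Hcomp_assoc U V W X (z : Hhom W X) (y : Hhom V W) (x : Hhom U V) :
  Hcomp z (Hcomp y x) = Hcomp (Hcomp z y) x.
Proof.
move: x; apply: Hhom_ext; [by move=> a x x'; rewrite !Hcomp_linr |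
  by move=> a x x'; rewrite !Hcomp_linr | move=> s].
move: y; apply: Hhom_ext; [by move=> a x x'; rewrite Hcomp_linl Hcomp_linr |
  by move=> a x x'; rewrite Hcomp_linr Hcomp_linl | move=> t].
move: z; apply: Hhom_ext; [by move=> a x x'; rewrite Hcomp_linl |
  by move=> a x x'; rewrite !Hcomp_linl | move=> r].
rewrite !Hcomp_cls !comp_repE Hcomp_sumr Hcomp_suml.
pose G (b : 'End(V)) (b' : 'End(W)) := clsr (dsrc s)
  (qmap r \o b' \o (qmap t \o b \o qmap s))%VF (dtgt r).
transitivity (comp_coef V *:
  \sum_(b : finvect_type 'End(V) | `[< cx_iso (dtgt s) (dsrc t) b >]) comp_coef W *:
  \sum_(b' : finvect_type 'End(W) | `[< cx_iso (dtgt t) (dsrc r) b' >]) G b b').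
  congr (_ *: _); apply: eq_bigr => b /asboolP hb.
  by rewrite (clsr_comp hb) Hcomp_cls comp_repE.
transitivity (comp_coef W *:
  \sum_(b' : finvect_type 'End(W) | `[< cx_iso (dtgt t) (dsrc r) b' >]) comp_coef V *:
  \sum_(b : finvect_type 'End(V) | `[< cx_iso (dtgt s) (dsrc t) b >]) G b b').
  by rewrite -!scaler_sumr !scalerA mulrC exchange_big.
congr (_ *: _); apply: eq_bigr => b' /asboolP hb'.
rewrite (clsr_comp hb') Hcomp_cls comp_repE; congr (_ *: _).
by apply: eq_bigr => b _; rewrite /G !comp_lfunA.
Qed.

Definition automorphisms V : {set finvect_type 'End(V)} :=
  [set b : finvect_type 'End(V) | `[< fg_iso (b : 'End(V)) >]].

Lemma automorphismsP V (b : 'End(V)) :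
  reflect (fg_iso b) ((b : finvect_type 'End(V)) \in automorphisms V).
Proof. by rewrite inE; apply: asboolP. Qed.

(* Given d, each automorphism b of V intertwines d with exactly one
   differential, b d b^-1: hence the normalization. *)
Definition Hid V : Hhom V V :=
  (comp_coef V * #|automorphisms V|%:R)^-1 *:
    \sum_(d : finvect_type 'End(V) | `[< is_diff (d : 'End(V)) >]) clsr d \1%VF d.

Lemma id_qtriple_proof V (d : 'End(V)) : is_diff d -> is_qtriple d \1%VF d.
Proof.
move=> dd; split=> //; apply: quasi_iso_cx_iso; split; first exact: fg_iso1.
by rewrite comp_lfun1l comp_lfun1r.
Qed.

Definition id_qtriple V (d : 'End(V)) (dd : is_diff d) : qtriple V V :=
  mk_qtriple (id_qtriple_proof dd).

Lemma clsr_id V (d : 'End(V)) (dd : is_diff d) :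
  clsr d \1%VF d = cls (id_qtriple dd).
Proof. exact: clsrE. Qed.

Lemma card_automorphisms_neq0 V : #|automorphisms V|%:R != 0 :> rat.
Proof.
rewrite pnatr_eq0 -lt0n; apply/card_gt0P; exists \1%VF.
exact/automorphismsP/fg_iso1.
Qed.

Lemma Hid_coef V (M : lmodType rat) (x : M) :
  (comp_coef V * #|automorphisms V|%:R)^-1 *: (comp_coef V *: (x *+ #|automorphisms V|)) = x.
Proof.
rewrite -scaler_nat !scalerA -mulrA mulVf ?scale1r //.
by rewrite mulf_neq0 ?comp_coef_neq0 ?card_automorphisms_neq0.
Qed.

Lemma Hcomp_idl U V (x : Hhom U V) : Hcomp (Hid V) x = x.
Proof.
move: x; apply: Hhom_ext => [|//|s]; first exact: Hcomp_linr.
rewrite Hcomp_suml -[RHS](Hid_coef V); congr (_ *: _).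
pose E := finvect_type 'End(V).
transitivity (\sum_(d : E | `[< is_diff (d : 'End(V)) >]) comp_coef V *:
  \sum_(b : E | `[< cx_iso (dtgt s) d b >]) cls s).
  apply: eq_bigr => d /asboolP dd; rewrite (clsr_id dd) Hcomp_cls comp_repE.
  congr (_ *: _); apply: eq_bigr => b /asboolP hb; rewrite (clsr_comp (t := id_qtriple dd) hb).
  (* The composite is [(dsrc s, b \o qmap s, d)], equivalent to [s] through the pair [(1, b)]. *)
  apply/esym; apply: (@cls_gequiv _ _ _ \1%VF b); case: (hb) => ib cb.
  split=> //; first exact: fg_iso1.
    by rewrite comp_lfun1l comp_lfun1r.
  by apply: homotopic_eq; rewrite comp_lfun1r; congr (_ \o _)%VF; rewrite comp_lfun1l.
rewrite -scaler_sumr; congr (_ *: _); rewrite pair_big_dep /= -sumr_const.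
pose e (b : E) : E := (b \o dtgt s \o b^-1)%VF.
apply: (sum_bij (I := (E * E)%type) (h := snd) (h' := fun b => (e b, b))) => //.
- by move=> [d b] /= /andP[_ /asboolP[ib _]]; apply/automorphismsP.
- move=> b /automorphismsP ib /=; apply/andP; split; apply/asboolP.
    exact/is_diff_push/dtgt_diff.
  by split=> //; rewrite /e -[RHS]comp_lfunA fg_iso_compVl // comp_lfun1r.
move=> [d b] /= /andP[_ /asboolP[ib cb]]; congr (_, _).
by rewrite /e cb -comp_lfunA fg_iso_compVr // comp_lfun1r.
Qed.

Lemma Hcomp_idr V W (x : Hhom V W) : Hcomp x (Hid V) = x.
Proof.
move: x; apply: Hhom_ext => [|//|s]; first exact: Hcomp_linl.
rewrite Hcomp_sumr -[RHS](Hid_coef V); congr (_ *: _).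
pose E := finvect_type 'End(V).
transitivity (\sum_(d : E | `[< is_diff (d : 'End(V)) >]) comp_coef V *:
  \sum_(b : E | `[< cx_iso d (dsrc s) b >]) cls s).
  apply: eq_bigr => d /asboolP dd; rewrite (clsr_id dd) Hcomp_cls comp_repE.
  congr (_ *: _); apply: eq_bigr => b /asboolP hb; rewrite (clsr_comp (s := id_qtriple dd) hb).
  apply: (@cls_gequiv _ _ _ b \1%VF); case: (hb) => ib cb.
  split=> //; first exact: fg_iso1.
    by rewrite comp_lfun1l comp_lfun1r.
  by apply: homotopic_eq; rewrite comp_lfun1l; apply: comp_lfun1r.
rewrite -scaler_sumr; congr (_ *: _); rewrite pair_big_dep /= -sumr_const.
pose e (b : E) : E := (b^-1 \o dsrc s \o b)%VF.
apply: (sum_bij (I := (E * E)%type) (h := snd) (h' := fun b => (e b, b))) => //.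
- by move=> [d b] /= /andP[_ /asboolP[ib _]]; apply/automorphismsP.
- move=> b /automorphismsP ib /=; apply/andP; split; apply/asboolP.
    have := is_diff_push (fg_iso_inv ib) (dsrc_diff s).
    by rewrite (fg_iso_invK ib).
  by split=> //; rewrite /e !comp_lfunA fg_iso_compVr // comp_lfun1l.
move=> [d b] /= /andP[_ /asboolP[ib cb]]; congr (_, _).
by rewrite /e -comp_lfunA -cb comp_lfunA fg_iso_compVl // comp_lfun1l.
Qed.

Lemma Htr_comp U V W U' V' W' (phi : 'Hom(U, U')) (psi : 'Hom(V, V'))
    (chi : 'Hom(W, W')) (y : Hhom V W) (x : Hhom U V) :
  fg_iso phi -> fg_iso psi -> fg_iso chi ->
  Hcomp (Htr psi chi y) (Htr phi psi x) = Htr phi chi (Hcomp y x).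
Proof.
move=> ip iq ic.
move: x; apply: Hhom_ext; [by move=> a x x'; rewrite Htr_linear Hcomp_linr |
  by move=> a x x'; rewrite Hcomp_linr Htr_linear | move=> s].
move: y; apply: Hhom_ext; [by move=> a x x'; rewrite Htr_linear Hcomp_linl |
  by move=> a x x'; rewrite Hcomp_linl Htr_linear | move=> t].
have es := gequiv_translate ip iq (hdeg0 _ _ _) s.
have et := gequiv_translate iq ic (hdeg0 _ _ _) t.
by rewrite (Htr_cls es) (Htr_cls et) !Hcomp_cls (comp_rep_tr es et).
Qed.

Lemma fg_iso_conj V V' (phi : 'Hom(V, V')) (b : 'End(V)) :
  fg_iso phi -> fg_iso b -> fg_iso (phi \o b \o phi^-1)%VF.
Proof. by move=> ip ib; apply: fg_iso_comp (fg_iso_inv ip) (fg_iso_comp ib ip). Qed.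

Lemma conjK V V' (phi : 'Hom(V, V')) (b : 'End(V)) : fg_iso phi ->
  (phi^-1 \o (phi \o b \o phi^-1) \o phi^-1^-1)%VF = b.
Proof.
move=> ip; apply/lfunP=> v; rewrite (fg_iso_invK ip) !comp_lfunE.
by rewrite !(fg_isoK ip).
Qed.

Lemma conjVK V V' (phi : 'Hom(V, V')) (b : 'End(V')) : fg_iso phi ->
  (phi \o (phi^-1 \o b \o phi^-1^-1) \o phi^-1)%VF = b.
Proof. by move=> ip; have := conjK b (fg_iso_inv ip); rewrite (fg_iso_invK ip). Qed.

Lemma Htr_id V V' (phi : 'Hom(V, V')) : fg_iso phi -> Htr phi phi (Hid V) = Hid V'.
Proof.
move=> ip; rewrite /Hid -(comp_coef_iso ip).
pose c (b : finvect_type 'End(V)) : finvect_type 'End(V') := (phi \o b \o phi^-1)%VF.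
pose c' (b : finvect_type 'End(V')) : finvect_type 'End(V) := (phi^-1 \o b \o phi^-1^-1)%VF.
have -> : #|automorphisms V'| = #|automorphisms V|.
  apply: (@card_bij _ _ _ _ c' c).
  - by move=> b /automorphismsP ib; apply/automorphismsP/fg_iso_conj => //; apply: fg_iso_inv.
  - by move=> b /automorphismsP ib; apply/automorphismsP/fg_iso_conj.
  - by move=> b _; apply: conjVK.
  by move=> b _; apply: conjK.
rewrite scaler_sumr linear_sumE; last exact: Htr_linear.
rewrite -scaler_sumr; congr (_ *: _).
apply: (sum_bij (h := c) (h' := c')).
- by move=> d /asboolP dd; apply/asboolP/is_diff_push.
- by move=> d /asboolP dd; apply/asboolP/is_diff_push => //; apply: fg_iso_inv.
- by move=> b _; apply: conjK.
- by move=> b _; apply: conjVK.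
move=> d /asboolP dd; have dd' : is_diff (c d) by apply: is_diff_push.
rewrite (clsr_id dd) (clsr_id dd'); apply: Htr_cls.
have cp : (phi \o d)%VF = (c d \o phi)%VF.
  by rewrite /c -[RHS]comp_lfunA fg_iso_compVl // comp_lfun1r.
split=> //.
by apply: homotopic_eq; rewrite [RHS]comp_lfun1l; apply: comp_lfun1r.
Qed.

End Composition.

(** * Extensions of a pair of triples, and their number *)

Section TensorExtensions.
Variable k : finFieldType.
Implicit Types U V W X Y : flagspace k.

(** Extensions are taken as triples on the direct sums with prescribed diagonal blocks. The
    equations on delta become the off-diagonal parts of the axioms of a triple, and transport acts
    on such triples directly. *)
Definition qext U V X Y (s : qtriple U V) (t : qtriple X Y)
    (u : qtriple (tens_space U X) (tens_space V Y)) : Prop :=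
  [/\ is_ublock (dsrc s) (dsrc t) (dsrc u), is_ublock (qmap s) (qmap t) (qmap u)
    & is_ublock (dtgt s) (dtgt t) (dtgt u)].

Definition tens_exts U V X Y (s : qtriple U V) (t : qtriple X Y) :
    {set qtriple (tens_space U X) (tens_space V Y)} :=
  [set u | `[< qext s t u >]].

Lemma tens_extsP U V X Y (s : qtriple U V) (t : qtriple X Y) u :
  reflect (qext s t u) (u \in tens_exts s t).
Proof. by rewrite inE; apply: asboolP. Qed.

(** The entries delta_11, delta_12, delta_22 as one element of a finite abelian group, in which the
    solutions form a subgroup. *)
Definition blocks X U V Y : finZmodType :=
  (finvect_type 'Hom(X, U) * finvect_type 'Hom(X, V) * finvect_type 'Hom(Y, V))%type.

Definition ext_blocks U V X Y (s : qtriple U V) (t : qtriple X Y) :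
    {set blocks X U V Y} :=
  [set p : blocks X U V Y | `[< is_tens_ext s t p.1.1 p.1.2 p.2 >]].

Lemma ext_blocksP U V X Y (s : qtriple U V) (t : qtriple X Y) (p : blocks X U V Y) :
  reflect (is_tens_ext s t p.1.1 p.1.2 p.2) (p \in ext_blocks s t).
Proof. by rewrite inE; apply: asboolP. Qed.

Definition block_qtriple U V X Y (s : qtriple U V) (t : qtriple X Y)
    (p : tens_ext s t) : qtriple (tens_space U X) (tens_space V Y) :=
  mk_qtriple (tens_qtriple_proof (asboolW (valP p))).

Lemma block_qtriple_inj U V X Y (s : qtriple U V) (t : qtriple X Y) :
  injective (@block_qtriple U V X Y s t).
Proof.
move=> [[[a b] c] hp] [[[a' b'] c'] hp'] e; apply: val_inj => /=.
have := congr1 (@dsrc _ _ _) e; have := congr1 (@qmap _ _ _) e.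
have := congr1 (@dtgt _ _ _) e; rewrite /dsrc /qmap /dtgt /=.
by move=> /ublock_inj[_ -> _] /ublock_inj[_ -> _] /ublock_inj[_ -> _].
Qed.

Lemma tens_exts_imset U V X Y (s : qtriple U V) (t : qtriple X Y) :
  tens_exts s t = [set block_qtriple p | p in [set: tens_ext s t]].
Proof.
apply/setP=> u; apply/tens_extsP/imsetP => [[[a ea] [b eb] [c ec]]|[p _ ->]]; last first.
  by split; eexists.
have ha : hdeg 1 a.
  by have := dsrc_hdeg u; rewrite ea => /hdeg_ublock[].
have hb : hdeg 0 b.
  by have := qmap_hdeg u; rewrite eb => /hdeg_ublock[].
have hc : hdeg 1 c.
  by have := dtgt_hdeg u; rewrite ec => /hdeg_ublock[].
have ext : is_tens_ext s t a b c.
  split=> //.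
  - have [_ _] := dsrc_diff u; rewrite ea comp_ublock -ublock0.
    by case/ublock_inj.
  - have [_ _] := dtgt_diff u; rewrite ec comp_ublock -ublock0.
    by case/ublock_inj.
  by have := qmap_chain u; rewrite ea eb ec !comp_ublock => /ublock_inj[_ + _]; rewrite addrC.
have extb : `[< is_tens_ext s t (a, b, c).1.1 (a, b, c).1.2 (a, b, c).2 >] by apply/asboolP.
exists (exist (fun p : finvect_type 'Hom(X, U) * finvect_type 'Hom(X, V) *
           finvect_type 'Hom(Y, V) => `[< is_tens_ext s t p.1.1 p.1.2 p.2 >]) (a, b, c) extb) => //.
by apply: qtriple_ext; rewrite ?ea ?eb ?ec.
Qed.

Lemma sum_tens_exts (M : nmodType) U V X Y (s : qtriple U V) (t : qtriple X Y)
    (G : 'End(tens_space U X) -> 'Hom(tens_space U X, tens_space V Y) ->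
         'End(tens_space V Y) -> M) :
  \sum_(u in tens_exts s t) G (dsrc u) (qmap u) (dtgt u) =
  \sum_(p in ext_blocks s t) G (ublock (dsrc s) p.1.1 (dsrc t))
    (ublock (qmap s) p.1.2 (qmap t)) (ublock (dtgt s) p.2 (dtgt t)).
Proof.
rewrite tens_exts_imset big_imset => [|x y _ _]; last exact: block_qtriple_inj.
under eq_bigl => x do rewrite in_setT.
rewrite (eq_bigl (fun p : blocks X U V Y => `[< is_tens_ext s t p.1.1 p.1.2 p.2 >])) => [|p].
  exact: (sum_sig (P := fun p : blocks X U V Y => `[< is_tens_ext s t p.1.1 p.1.2 p.2 >])).
by rewrite inE.
Qed.

Lemma tens_repE U V X Y (s : qtriple U V) (t : qtriple X Y) :
  tens_rep s t = tens_coef U X V Y *: \sum_(u in tens_exts s t) cls u.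
Proof.
congr (_ *: _); rewrite tens_exts_imset big_imset => [|x y _ _]; last exact: block_qtriple_inj.
by apply: eq_bigl => x; rewrite in_setT.
Qed.

Lemma is_tens_ext_sub U V X Y (s : qtriple U V) (t : qtriple X Y)
    (a a' : 'Hom(X, U)) (b b' : 'Hom(X, V)) (c c' : 'Hom(Y, V)) :
  is_tens_ext s t a b c -> is_tens_ext s t a' b' c' ->
  is_tens_ext s t (a - a') (b - b') (c - c').
Proof.
move=> [[a0 b0 c0] e1 e2 e3] [[a0' b0' c0'] e1' e2' e3'].
split; first by split; apply: hdegB.
- by rewrite comp_lfunBr comp_lfunBl addrACA -opprD e1 e1' subrr.
- by rewrite comp_lfunBr comp_lfunBl addrACA -opprD e2 e2' subrr.
by rewrite !comp_lfunBr !comp_lfunBl addrACA [RHS]addrACA -!opprD e3 e3'.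
Qed.

Lemma ext_blocksB U V X Y (s : qtriple U V) (t : qtriple X Y) (p q : blocks X U V Y) :
  p \in ext_blocks s t -> q \in ext_blocks s t -> p - q \in ext_blocks s t.
Proof.
case: p q => [[a b] c] [[a' b'] c'] /ext_blocksP hp /ext_blocksP hq.
by apply/ext_blocksP; rewrite !pairB /=; apply: is_tens_ext_sub.
Qed.

Lemma cocycle1P (A B : flagspace k) (d : 'End(A)) (e : 'End(B)) (h : 'Hom(A, B)) :
  reflect (hdeg 1 h /\ (e \o h)%VF + (h \o d)%VF = 0)
    ((h : finvect_type 'Hom(A, B)) \in cocycles d e 1 (-1)).
Proof.
apply: (iffP (cocyclesP _ _ _ _ _)); rewrite scaleN1r => -[h0 hE]; split=> //.
  by rewrite hE addNr.
by apply/eqP; rewrite -addr_eq0 hE.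
Qed.

Lemma cocycle0P (A B : flagspace k) (d : 'End(A)) (e : 'End(B)) (h : 'Hom(A, B)) :
  reflect (hdeg 0 h /\ (h \o d)%VF = (e \o h)%VF)
    ((h : finvect_type 'Hom(A, B)) \in cocycles d e 0 1).
Proof. by apply: (iffP (cocyclesP _ _ _ _ _)); rewrite scale1r => -[]. Qed.

Lemma coboundary1P (A B : flagspace k) (d : 'End(A)) (e : 'End(B)) (h : 'Hom(A, B)) :
  reflect (exists2 h' : 'Hom(A, B), hdeg 0 h' & h = (e \o h')%VF - (h' \o d)%VF)
    ((h : finvect_type 'Hom(A, B)) \in coboundaries d e 1 (-1)).
Proof.
by apply: (iffP (coboundariesP _ _ _ _ _)) => -[h' h0 hE]; exists h' => //;
  rewrite hE scaleN1r.
Qed.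

Section Count.
Variables (U V X Y : flagspace k) (s : qtriple U V) (t : qtriple X Y).
Let Z1 := cocycles (dtgt t) (dtgt s) 1 (-1).
Let B1 := coboundaries (dsrc t) (dsrc s) 1 (-1).
Let Z0 := cocycles (dsrc t) (dtgt s) 0 1.

Let sgn2 : (-1 : k) * -1 = 1. Proof. by rewrite mulrNN mulr1. Qed.

(** Write [f], [g] for the two quasi-isomorphisms. Every cocycle delta_22 occurs, because delta_22 g
    is cohomologous to some f delta_11. If delta_22 = 0, then f delta_11 is a coboundary, hence so
    is delta_11. If both vanish, delta_12 is any cocycle of degree 0. *)
Lemma card_ext_blocks : #|ext_blocks s t| = (#|Z1| * (#|B1| * #|Z0|))%N.
Proof.
have := @card_surj (blocks X U V Y) (finvect_type 'Hom(Y, V)) (ext_blocks s t) Z1 snd.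
move=> -> //; first 1 last.
- exact: ext_blocksB.
- by move=> p /ext_blocksP[[_ _ c0] _ e2 _]; apply/cocycle1P.
- move=> c cZ; have [c0 ec] := elimT (cocycle1P _ _ _) cZ.
  have := pre_cocycle (qmap_qiso t) cZ.
  move/(post_surj (dsrc_diff s) (dtgt_diff s) (qmap_qiso s)) => [a aZ [h h0 eh]].
  (* Moving the coboundary of [h] to the other side of [eh] gives the mixed relation with delta_12 =
     - h. *)
  exists (a, - h, c) => //; apply/ext_blocksP.
  have [a0 ea] := elimT (cocycle1P _ _ _) aZ.
  split=> //=; first by split=> //; apply: hdegN.
  by rewrite eh comp_lfunNl comp_lfunNr scaleN1r addrCA addKr addrC.
congr (_ * _)%N.
have := @card_surj (blocks X U V Y) (finvect_type 'Hom(X, U))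
  [set p in ext_blocks s t | p.2 == 0] B1 (fun p => p.1.1).
move=> -> //; first 1 last.
- move=> p q /setIdP[pT /eqP p0] /setIdP[qT /eqP q0]; apply/setIdP.
  by split; [apply: ext_blocksB | rewrite /= p0 q0 subrr].
- move=> [[a b] c] /setIdP[/ext_blocksP[/= [a0 b0 _] e1 _ e3] /= /eqP c0].
  apply: (post_inj (dsrc_diff s) (dtgt_diff s) (qmap_qiso s)); first exact/cocycle1P.
  apply/coboundary1P; exists b => //.
  by move: e3; rewrite c0 comp_lfun0l addr0 => <-; rewrite addrC addKr.
- move=> a aB; have := post_coboundary (qmap_qiso s) aB.
  have := subsetP (coboundary_cocycle _ (dsrc_diff t) (dsrc_diff s) sgn2) _ aB.
  move=> /cocycle1P[a0 ea] /coboundary1P[h h0 eh]; exists (a, h, 0) => //.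
  apply/setIdP; split=> //; apply/ext_blocksP; split=> /=.
  - by split=> //; apply: hdeg0.
  - by [].
  - by rewrite comp_lfun0l comp_lfun0r addr0.
  by rewrite eh comp_lfun0l addr0 addrC subrK.
congr (_ * _)%N; apply: (@card_bij _ (finvect_type 'Hom(X, V)) _ _
  (fun p : blocks X U V Y => p.1.2) (fun b => (0, b, 0))) => //.
- move=> [[a b] c] /setIdP[/setIdP[/ext_blocksP[/= [_ b0 _] _ _ e3] /eqP /= c0] /eqP /= a0].
  by apply/cocycle0P; move: e3; rewrite a0 c0 comp_lfun0l comp_lfun0r !addr0.
- move=> b /cocycle0P[b0 eb]; apply/setIdP; split=> //; apply/setIdP; split=> //.
  apply/ext_blocksP; split=> /=.
  - by split=> //; apply: hdeg0.
  - by rewrite comp_lfun0l comp_lfun0r addr0.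
  - by rewrite comp_lfun0l comp_lfun0r addr0.
  by rewrite comp_lfun0l comp_lfun0r !addr0.
by move=> [[a b] c] /setIdP[/setIdP[_ /eqP /= ->] /eqP /= ->].
Qed.

End Count.
End TensorExtensions.

(** * Composable pairs of extensions and their composites *)

Section Gluing.
Variable k : finFieldType.
Variables (A B C A' B' C' : flagspace k).
Variables (s : qtriple A B) (t : qtriple B C) (r : qtriple A C).
Variables (s' : qtriple A' B') (t' : qtriple B' C') (r' : qtriple A' C').
Hypotheses (st : dtgt s = dsrc t) (rs : dsrc r = dsrc s)
  (rm : qmap r = (qmap t \o qmap s)%VF) (rt : dtgt r = dtgt t).
Hypotheses (st' : dtgt s' = dsrc t') (rs' : dsrc r' = dsrc s')
  (rm' : qmap r' = (qmap t' \o qmap s')%VF) (rt' : dtgt r' = dtgt t').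

(** The off-diagonal block [p.1.2] of the differential on B + B' is stored once and shared by both
    extensions, which encodes their agreement there. *)
Definition glued_blocks : finZmodType :=
  (blocks A' A B B' * (finvect_type 'Hom(B', C) * finvect_type 'Hom(C', C)))%type.

Definition glued_exts : {set glued_blocks} :=
  [set p : glued_blocks | (p.1 \in ext_blocks s s') &&
     (((p.1.2, p.2.1, p.2.2) : blocks B' B C C') \in ext_blocks t t')].

Lemma in_glued_exts (p : glued_blocks) :
  (p \in glued_exts) = (p.1 \in ext_blocks s s') &&
    (((p.1.2, p.2.1, p.2.2) : blocks B' B C C') \in ext_blocks t t').
Proof. by rewrite /glued_exts in_set. Qed.

Lemma glued_extsP (p : glued_blocks) :
  reflect (is_tens_ext s s' p.1.1.1 p.1.1.2 p.1.2 /\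
           is_tens_ext t t' p.1.2 p.2.1 p.2.2) (p \in glued_exts).
Proof.
rewrite in_glued_exts; apply: (iffP andP) => [[/ext_blocksP ? /ext_blocksP ?]|[? ?]] //.
by split; apply/ext_blocksP.
Qed.

(** The middle entry is the off-diagonal block of the product of the two triangular
    quasi-isomorphisms; the differential on B + B' is forgotten. *)
Definition glue (p : glued_blocks) : blocks A' A C C' :=
  (p.1.1.1, (qmap t \o p.1.1.2)%VF + (p.2.1 \o qmap s')%VF, p.2.2).

(* Adding the coboundary y to the off-diagonal block of the quasi-isomorphism
   changes it by a homotopy. *)
Definition glue_homotopy (y : finvect_type 'Hom(A', C)) : blocks A' A C C' :=
  (0, y, 0).

Definition glue_homotopies : {set blocks A' A C C'} :=
  [set glue_homotopy y | y in coboundaries (dsrc s') (dtgt t) 0 1].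

Lemma glue_homotopiesP n :
  reflect (exists2 y, y \in coboundaries (dsrc s') (dtgt t) 0 1 & n = glue_homotopy y)
    (n \in glue_homotopies).
Proof. by rewrite /glue_homotopies; apply: imsetP. Qed.

Let sgn2 : (-1 : k) * -1 = 1. Proof. by rewrite mulrNN mulr1. Qed.
Let one2 : (1 : k) * 1 = 1. Proof. by rewrite mulr1. Qed.

Lemma glued_extsB p q : p \in glued_exts -> q \in glued_exts -> p - q \in glued_exts.
Proof.
case: p q => [[[a b] c] [x y]] [[[a' b'] c'] [x' y']].
move=> /glued_extsP[p1 p2] /glued_extsP[q1 q2]; apply/glued_extsP; rewrite !pairB /=; split.
  exact: is_tens_ext_sub p1 q1.
exact: is_tens_ext_sub p2 q2.
Qed.

Lemma glue_ext p n : p \in glued_exts -> n \in glue_homotopies ->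
  glue p + n \in ext_blocks r r'.
Proof.
case: p => [[[a b] c] [x y]].
move=> /glued_extsP[] /= [[a0 b0 c0] ea ec eb] [[_ x0 y0] _ ey ex].
move=> /glue_homotopiesP[n2 nB ->].
have /cocycle0P[n0 en] := subsetP (coboundary_cocycle _ (dsrc_diff s') (dtgt_diff t) one2) _ nB.
apply/ext_blocksP; split; rewrite /= ?rs ?rt ?rm ?rs' ?rt' ?rm' ?addr0 //.
  split=> //; apply: hdegD => //; apply: hdegD.
    by apply: (hdeg_compE b0 (qmap_hdeg t)); rewrite addr0.
  by apply: (hdeg_compE (qmap_hdeg s') x0); rewrite addr0.
apply/lfunP=> v; have /lfunP/(_ v) := eb; have /lfunP/(_ (qmap s' v)) := ex.
have /lfunP/(_ v) := en; rewrite !(add_lfunE, comp_lfunE) => env exv ebv.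
have sv : qmap s' (dsrc s' v) = dsrc t' (qmap s' v).
  by have /lfunP/(_ v) := qmap_chain s'; rewrite !comp_lfunE st'.
have tv u : qmap t (dtgt s u) = dtgt t (qmap t u).
  by have /lfunP/(_ u) := qmap_chain t; rewrite !comp_lfunE st.
apply: (addIr (qmap t (c (qmap s' v)))).
rewrite [LHS](ACl ((1*4)*(2*5)*3)) /= -linearD ebv sv exv env !linearD /= tv.
by rewrite [RHS](ACl ((1*5)*(2*4)*3)).
Qed.

(** Write [f], [g], [f'], [g'] for the maps of [s], [t], [s'], [t']. As [f'] is a quasi-isomorphism,
    [f w1] is cohomologous to [c f'] for some cocycle [c], which becomes the differential block on B
    + B'. The relation for [w] shows that [g c - w3 g'] becomes a coboundary after composition with
    [f']; it therefore is one, of some [y]. The entry B' -> C is [y], corrected by a cocycle. *)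
Lemma glue_surj w : w \in ext_blocks r r' ->
  exists p n, [/\ p \in glued_exts, n \in glue_homotopies & w = glue p + n].
Proof.
case: w => [[w1 w2] w3] /ext_blocksP[]; rewrite /= ?rs ?rt ?rm ?rs' ?rt' ?rm'.
move=> [w10 w20 w30] e1 e3 e2.
have dA' := dsrc_diff s'; have dB : is_diff (dsrc t) := dsrc_diff t.
have dB' := dsrc_diff t'; have dC := dtgt_diff t; have dC' := dtgt_diff t'.
have f'q := qmap_qiso s'; rewrite st' in f'q.
have fq := qmap_qiso s; rewrite st in fq.
have gq := qmap_qiso t; have g'q := qmap_qiso t'.
have w1Z : (w1 : finvect_type _) \in cocycles (dsrc s') (dsrc s) 1 (-1) by apply/cocycle1P.
have w3Z : (w3 : finvect_type _) \in cocycles (dtgt t') (dtgt t) 1 (-1) by apply/cocycle1P.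
have [c cZ [h h0 eh]] := pre_surj dA' dB' f'q sgn2 (post_cocycle fq w1Z).
have [c0 ec] := elimT (cocycle1P _ _ _) cZ.
have gcZ := post_cocycle gq cZ; have wg'Z := pre_cocycle g'q w3Z.
have [y y0 ey] : exists2 y : 'Hom(B', C), hdeg 0 y &
    ((qmap t \o c) - (w3 \o qmap t'))%VF = (dtgt t \o y)%VF - (y \o dsrc t')%VF.
  apply/coboundary1P; apply: (pre_inj dA' dB' f'q sgn2); first exact: cocyclesB.
  apply/coboundary1P; exists (w2 - (qmap t \o h)%VF).
    by apply: hdegB => //; apply: (hdeg_compE h0 (qmap_hdeg t)); rewrite addr0.
  apply/lfunP=> v; have /lfunP/(_ v) := eh; have /lfunP/(_ v) := e2.
  rewrite !(add_lfunE, opp_lfunE, comp_lfunE, scale_lfunE) scaleN1r => e2v ehv.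
  have tv u : qmap t (dsrc t u) = dtgt t (qmap t u).
    by have /lfunP/(_ u) := qmap_chain t; rewrite !comp_lfunE.
  have -> : qmap t (c (qmap s' v)) = qmap t (qmap s (w1 v)) - dtgt t (qmap t (h v)) + qmap t (h (dsrc s' v)).
    by rewrite ehv -tv !linearD linearN /= !addrA [RHS](ACl (1*(2*4)*(3*5))) /= subrr addNr !addr0.
  have -> : qmap t (qmap s (w1 v)) = dtgt t (w2 v) + w3 (qmap t' (qmap s' v)) - w2 (dsrc s' v).
    by rewrite -e2v addrC addKr.
  by rewrite linearB /= opprB [LHS](ACl ((1*4)*(5*3)*(2*6))) /= subrr addr0.
(* With [y] as entry, the glued block misses [w2] by a cocycle of degree 0. Up to a coboundary this
   cocycle is [z f'], so replacing [y] by [y + z] leaves only a homotopy. *)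
have zeta : ((w2 - ((qmap t \o h)%VF + (y \o qmap s')%VF)) : finvect_type 'Hom(A', C))
    \in cocycles (dsrc s') (dtgt t) 0 1.
  apply/cocycle0P; split.
    apply: hdegB => //; apply: hdegD; first by apply: (hdeg_compE h0 (qmap_hdeg t)); rewrite addr0.
    by apply: (hdeg_compE (qmap_hdeg s') y0); rewrite addr0.
  apply/lfunP=> v; have /lfunP/(_ v) := eh; have /lfunP/(_ v) := e2.
  have /lfunP/(_ (qmap s' v)) := ey.
  rewrite !(add_lfunE, opp_lfunE, comp_lfunE, scale_lfunE) scaleN1r => eyv e2v ehv.
  have tv u : qmap t (dsrc t u) = dtgt t (qmap t u).
    by have /lfunP/(_ u) := qmap_chain t; rewrite !comp_lfunE.
  have sv : qmap s' (dsrc s' v) = dsrc t' (qmap s' v).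
    by have /lfunP/(_ v) := qmap_chain s'; rewrite !comp_lfunE st'.
  rewrite sv (linearB (dtgt t)) (linearD (dtgt t)) /= -tv.
  have -> : w2 (dsrc s' v) = dtgt t (w2 v) + w3 (qmap t' (qmap s' v)) - qmap t (qmap s (w1 v)).
    by rewrite -e2v addrK.
  have -> : w3 (qmap t' (qmap s' v)) = qmap t (c (qmap s' v)) - (dtgt t (y (qmap s' v)) - y (dsrc t' (qmap s' v))).
    by rewrite -eyv opprB addrC subrK.
  rewrite ehv (linearD (qmap t)) (linearB (qmap t)) /= !opprD !opprK !addrA.
  by rewrite [LHS](ACl (1*6*3*(2*5)*(4*9)*(7*8))) /= !subrr !addr0.
have [z zZ [h2 h20 eh2]] := pre_surj dA' dB' f'q one2 zeta.
have [z0 ez] := elimT (cocycle0P _ _ _) zZ.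
pose n : 'Hom(A', C) := (dtgt t \o h2)%VF + (h2 \o dsrc s')%VF.
exists ((w1, h, c), (y + z, w3)), (glue_homotopy n).
split.
- apply/glued_extsP; rewrite /=; split; split; rewrite ?st ?st' //.
  + apply/lfunP=> v; have /lfunP/(_ v) := eh.
    rewrite !(add_lfunE, opp_lfunE, comp_lfunE, scale_lfunE) scaleN1r => ->.
    by rewrite addrCA [_ + (_ - _)]addrC subrK addrC.
  + by split=> //; apply: hdegD.
  rewrite comp_lfunDl comp_lfunDr ez.
  have -> : (qmap t \o c)%VF = (dtgt t \o y)%VF - (y \o dsrc t')%VF + (w3 \o qmap t')%VF.
    by rewrite -ey subrK.
  by rewrite !addrA [LHS](ACl ((1*4)*3*2*5)) /= subrr add0r.
- apply/glue_homotopiesP; exists n => //.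
  by apply/coboundariesP; exists h2 => //; rewrite scale1r.
congr (_, _, _); rewrite /= ?addr0 //.
rewrite (canRL (subrK _) eh2) scale1r comp_lfunDl.
by rewrite [LHS]addrC !addrA.
Qed.

(** Every extension of [(s, s')] continues: postcomposing its block on B + B' with [qmap t] gives a
    cocycle, cohomologous to some [z \o qmap t']. Over the zero extension, [p.2.2] runs over
    coboundaries, and once it vanishes [p.2.1] runs over cocycles of degree 0. *)
Lemma card_glued_exts : #|glued_exts| =
  (#|ext_blocks s s'| * (#|coboundaries (dtgt t') (dtgt t) 1 (-1)%R| *
                         #|cocycles (dsrc t') (dtgt t) 0 1%R|))%N.
Proof.
have dB' := dsrc_diff t'; have dC := dtgt_diff t; have dC' := dtgt_diff t'.
have gq := qmap_qiso t; have g'q := qmap_qiso t'.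
have := @card_surj glued_blocks (blocks A' A B B') glued_exts (ext_blocks s s') fst.
move=> -> //; first 1 last.
- exact: glued_extsB.
- by move=> p /setIdP[].
- move=> p pT; have [[_ _ c0] _ ec _] := elimT (ext_blocksP _ _ _) pT.
  have cZ : (p.2 : finvect_type 'Hom(B', B)) \in cocycles (dsrc t') (dsrc t) 1 (-1).
    by apply/cocycle1P; rewrite -st -st'.
  have [z zZ [h h0 eh]] := pre_surj dB' dC' g'q sgn2 (post_cocycle gq cZ).
  have [z0 ez] := elimT (cocycle1P _ _ _) zZ.
  have [_ ec'] := elimT (cocycle1P _ _ _) cZ.
  exists (p, (h, z)) => //; apply/glued_extsP; split=> /=; first exact/ext_blocksP.
  by split=> //; rewrite eh scaleN1r addrCA [_ + (_ - _)]addrC subrK addrC.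
congr (_ * _)%N.
pose K := [set p : glued_blocks in glued_exts | p.1 == 0].
have := @card_surj glued_blocks (finvect_type 'Hom(C', C)) K
  (coboundaries (dtgt t') (dtgt t) 1 (-1)) (fun p => p.2.2).
rewrite -/K => -> //; first 1 last.
- move=> p q /setIdP[pT /eqP p0] /setIdP[qT /eqP q0]; apply/setIdP.
  by split; [apply: glued_extsB | rewrite pairB /= p0 q0 subrr].
- move=> [p [x y]] /setIdP[/glued_extsP[_ [[_ x0 y0] _ ey e]] /= /eqP p0].
  move: e; rewrite p0 /= comp_lfun0r addr0 => e.
  apply: (pre_inj dB' dC' g'q sgn2); first exact/cocycle1P.
  apply/coboundary1P; exists (- x); first exact: hdegN.
  by rewrite comp_lfunNl comp_lfunNr opprK e addKr.
- move=> y yB; have := pre_coboundary g'q yB.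
  have /cocycle1P[y0 ey] := subsetP (coboundary_cocycle _ dC' dC sgn2) _ yB.
  move=> /coboundary1P[h h0 eh]; exists (0, (- h, y)) => //; apply/setIdP; split=> //.
  apply/glued_extsP; split; split=> /=; rewrite ?comp_lfun0l ?comp_lfun0r ?addr0 //.
  + by split; exact: hdeg0.
  + by split=> //; [exact: hdeg0 | exact: hdegN].
  by rewrite eh comp_lfunNl comp_lfunNr addKr.
congr (_ * _)%N; apply: (@card_bij _ (finvect_type 'Hom(B', C)) _ _
  (fun p : glued_blocks => p.2.1) (fun x => (0, (x, 0)))) => //.
- move=> [p [x y]] /setIdP[/setIdP[/glued_extsP[_ [[_ x0 _] _ _ e]] /eqP /= p0] /eqP /= y0].
  by apply/cocycle0P; split=> //; move: e; rewrite p0 y0 /= comp_lfun0l comp_lfun0r !addr0.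
- move=> x /cocycle0P[x0 ex]; apply/setIdP; split=> //; apply/setIdP; split=> //.
  apply/glued_extsP; split; split=> /=; rewrite ?comp_lfun0l ?comp_lfun0r ?addr0 //.
  + by split; exact: hdeg0.
  by split=> //; exact: hdeg0.
by move=> [p [x y]] /setIdP[/setIdP[_ /eqP /= ->] /eqP /= ->].
Qed.

Lemma sum_glue (M : nmodType) (c : blocks A' A C C' -> M) :
  (forall w n, w \in ext_blocks r r' -> n \in glue_homotopies -> c (w + n) = c w) ->
  (\sum_(p in glued_exts) c (glue p)) *+ (#|glue_homotopies| * #|ext_blocks r r'|) =
  (\sum_(w in ext_blocks r r') c w) *+ (#|glued_exts| * #|glue_homotopies|).
Proof.
move=> cN; rewrite mulrnA; apply: sum_surj_mod.
- exact: glued_extsB.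
- move=> _ _ /glue_homotopiesP[n nB ->] /glue_homotopiesP[m mB ->]; apply/glue_homotopiesP.
  exists (n - m); first exact: coboundariesB.
  by rewrite !pairB /glue_homotopy /= !subrr.
- move=> [[[a b] c0] [x y]] [[[a' b'] c'] [x' y']]; rewrite !pairB /glue /=.
  by congr (_, _, _); rewrite comp_lfunBr comp_lfunBl opprD addrACA.
- exact: glue_ext.
- exact: glue_surj.
move=> p n pS nN; have g0 : 0 \in glue_homotopies.
  by apply/glue_homotopiesP; exists 0; first exact: coboundaries0.
by rewrite cN //; have := glue_ext pS g0; rewrite addr0.
Qed.

Lemma card_glue_homotopies_gt0 : (0 < #|glue_homotopies|)%N.
Proof.
by rewrite card_gt0; apply/set0Pn; exists (glue_homotopy 0); rewrite imset_f ?coboundaries0.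
Qed.

End Gluing.

(** * Well-definedness and bilinearity of the tensor product, and its compatibility with
    transport *)

Section TensorTransport.
Variable k : finFieldType.
Implicit Types U V W X Y : flagspace k.

Lemma qext_translate U V X Y U' V' X' Y' (phi : 'Hom(U, U')) (psi : 'Hom(V, V')) h
    (phi2 : 'Hom(X, X')) (psi2 : 'Hom(Y, Y')) h2
    (Phi : 'Hom(tens_space U X, tens_space U' X'))
    (Psi : 'Hom(tens_space V Y, tens_space V' Y'))
    (H : 'Hom(tens_space U X, tens_space V' Y'))
    (ip : fg_iso phi) (iq : fg_iso psi) (h1 : hdeg (-1) h)
    (ip2 : fg_iso phi2) (iq2 : fg_iso psi2) (h21 : hdeg (-1) h2)
    (iP : fg_iso Phi) (iQ : fg_iso Psi) (H1 : hdeg (-1) H) s t u :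
  is_ublock phi phi2 Phi -> is_ublock psi psi2 Psi -> is_ublock h h2 H ->
  qext s t u ->
  qext (translate ip iq h1 s) (translate ip2 iq2 h21 t) (translate iP iQ H1 u).
Proof.
move=> bP bQ bH [b1 b2 b3].
have bPi := is_ublock_inv ip ip2 iP bP; have bQi := is_ublock_inv iq iq2 iQ bQ.
have e3 := is_ublock_comp bQi (is_ublock_comp b3 bQ).
split.
- exact: is_ublock_comp bPi (is_ublock_comp b1 bP).
- apply: is_ublock_comp bPi _; apply: is_ublockD; first exact: is_ublock_comp b2 bQ.
  apply: is_ublockN; apply: is_ublockD; first exact: is_ublock_comp bH e3.
  exact: is_ublock_comp b1 bH.
exact: e3.
Qed.

(** Any triangular [Phi], [Psi] with the right diagonals will do: together with the block diagonal
    homotopy they translate the extensions of [(s, t)] bijectively onto those of [(s', t')]. *)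
Lemma tens_rep_tr U V X Y U' V' X' Y' (phi : 'Hom(U, U')) (psi : 'Hom(V, V'))
    (phi2 : 'Hom(X, X')) (psi2 : 'Hom(Y, Y'))
    (Phi : 'Hom(tens_space U X, tens_space U' X'))
    (Psi : 'Hom(tens_space V Y, tens_space V' Y')) s s' t t' :
  gequiv phi psi s s' -> gequiv phi2 psi2 t t' -> fg_iso Phi -> fg_iso Psi ->
  is_ublock phi phi2 Phi -> is_ublock psi psi2 Psi ->
  tens_rep s' t' = Htr Phi Psi (tens_rep s t).
Proof.
move=> /gequiv_translateP[h [ip [iq [h1 ->]]]] /gequiv_translateP[h2 [ip2 [iq2 [h21 ->]]]].
move=> iP iQ bP bQ; rewrite !tens_repE -(tens_coef_iso ip iq ip2 iq2).
rewrite scaler_sumr [in RHS]scaler_sumr linear_sumE; last exact: Htr_linear.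
rewrite -!scaler_sumr; congr (_ *: _); apply/esym.
have H1 : hdeg (-1) (ublock h 0 h2 : 'Hom(tens_space U X, tens_space V' Y')).
  by apply/hdeg_ublock; split=> //; apply: hdeg0.
have [h' [jp [jq [h'1 [eh' sK _]]]]] := translateK ip iq h1.
have [h2' [jp2 [jq2 [h2'1 [eh2' tK _]]]]] := translateK ip2 iq2 h21.
have [H' [jP [jQ [H'1 [eH' uK uVK]]]]] := translateK iP iQ H1.
have bH : is_ublock h h2 (ublock h 0 h2 : 'Hom(tens_space U X, tens_space V' Y')).
  by exists 0.
have bPi := is_ublock_inv ip ip2 iP bP; have bQi := is_ublock_inv iq iq2 iQ bQ.
have bH' : is_ublock h' h2' H'.
  rewrite eh' eh2' eH'; apply: is_ublockN; apply: is_ublock_comp bPi _.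
  exact: is_ublock_comp bH bQi.
apply: (sum_bij (h := translate iP iQ H1) (h' := translate jP jQ H'1)).
- by move=> u /tens_extsP qu; apply/tens_extsP; apply: qext_translate.
- move=> u /tens_extsP qu; apply/tens_extsP; rewrite -[s]sK -[t]tK.
  by apply: qext_translate.
- by move=> u _.
- by move=> u _.
by move=> u _; apply: Htr_cls; apply: gequiv_translate.
Qed.

Lemma HtensE U V X Y (x : Hhom U V) (y : Hhom X Y) :
  Htens x y = \sum_c x c *: \sum_b y b *: tens_rep (qrepr c) (qrepr b).
Proof.
apply: eq_bigr => c _; rewrite scaler_sumr; apply: eq_bigr => b _.
by rewrite scalerA.
Qed.

Lemma Htens_cls U V X Y (s : qtriple U V) (t : qtriple X Y) :
  Htens (cls s) (cls t) = tens_rep s t.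
Proof.
rewrite HtensE big_cls big_cls.
have /gequiv_equiv[a [b e]] := qrepr_equiv s.
have /gequiv_equiv[a' [b' e']] := qrepr_equiv t.
have [ia ib _ _ _] := e; have [ia' ib' _ _ _] := e'.
have iP := fg_iso_ublock ia (hdeg0 _ _ _) ia'.
have iQ := fg_iso_ublock ib (hdeg0 _ _ _) ib'.
rewrite (tens_rep_tr e e' iP iQ) ?Htr_endo //; by exists 0.
Qed.

Lemma Htens_linr U V X Y (x : Hhom U V) : linear (@Htens k U V X Y x).
Proof.
move=> a y y'; rewrite !HtensE scaler_sumr -big_split; apply: eq_bigr => c _ /=.
rewrite scalerA mulrC -scalerA -scalerDr; congr (_ *: _).
rewrite scaler_sumr -big_split.
by apply: eq_bigr => b _; rewrite !ffunE scalerDl /= (scalerA a).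
Qed.

Lemma Htens_linl U V X Y (y : Hhom X Y) : linear (fun x : Hhom U V => Htens x y).
Proof.
move=> a x x'; rewrite !HtensE scaler_sumr -big_split; apply: eq_bigr => c _ /=.
by rewrite !ffunE scalerDl scalerA.
Qed.

Lemma Htens_sumr U V X Y (x : Hhom U V) a (I : finType) (P : pred I) (y : I -> Hhom X Y) :
  Htens x (a *: \sum_(i | P i) y i) = a *: \sum_(i | P i) Htens x (y i).
Proof.
by rewrite scaler_sumr linear_sumE ?scaler_sumr //; apply: Htens_linr.
Qed.

Lemma Htens_suml U V X Y (y : Hhom X Y) a (I : finType) (P : pred I) (x : I -> Hhom U V) :
  Htens (a *: \sum_(i | P i) x i) y = a *: \sum_(i | P i) Htens (x i) y.
Proof.
have := @linear_sumE _ _ (fun x : Hhom U V => Htens x y) (Htens_linl _) _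
  (index_enum I) P (fun=> a) x.
by rewrite -!scaler_sumr.
Qed.

Lemma Htr_tens U V X Y U' V' X' Y' (phi : 'Hom(U, U')) (psi : 'Hom(V, V'))
    (phi2 : 'Hom(X, X')) (psi2 : 'Hom(Y, Y')) (x : Hhom U V) (y : Hhom X Y) :
  fg_iso phi -> fg_iso psi -> fg_iso phi2 -> fg_iso psi2 ->
  Htens (Htr phi psi x) (Htr phi2 psi2 y) =
  @Htr k (tens_space U X) (tens_space V Y) (tens_space U' X') (tens_space V' Y')
    (ublock phi 0 phi2) (ublock psi 0 psi2) (Htens x y).
Proof.
move=> ip iq ip2 iq2.
move: x; apply: Hhom_ext; [by move=> a x x'; rewrite Htr_linear Htens_linl |
  by move=> a x x'; rewrite Htens_linl Htr_linear | move=> s].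
move: y; apply: Hhom_ext; [by move=> a x x'; rewrite Htr_linear Htens_linr |
  by move=> a x x'; rewrite Htens_linr Htr_linear | move=> t].
have es := gequiv_translate ip iq (hdeg0 _ _ _) s.
have et := gequiv_translate ip2 iq2 (hdeg0 _ _ _) t.
rewrite (Htr_cls es) (Htr_cls et) !Htens_cls.
have iP := fg_iso_ublock ip (hdeg0 _ _ _) ip2.
have iQ := fg_iso_ublock iq (hdeg0 _ _ _) iq2.
by rewrite (tens_rep_tr es et iP iQ) //; exists 0.
Qed.

End TensorTransport.

(** * The multiplicity of composites, and the resulting tensor product *)

Section GluedSum.
Variable k : finFieldType.
Variables (A B C A' B' C' : flagspace k).
Variables (s : qtriple A B) (t : qtriple B C) (r : qtriple A C).
Variables (s' : qtriple A' B') (t' : qtriple B' C') (r' : qtriple A' C').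
Hypotheses (st : dtgt s = dsrc t) (rs : dsrc r = dsrc s)
  (rm : qmap r = (qmap t \o qmap s)%VF) (rt : dtgt r = dtgt t).
Hypotheses (st' : dtgt s' = dsrc t') (rs' : dsrc r' = dsrc s')
  (rm' : qmap r' = (qmap t' \o qmap s')%VF) (rt' : dtgt r' = dtgt t').

(** The Hom complexes for (B', B), (B', C), (A', B), (A', C) have cohomology of the same order, so
    each [altc] is [altc B' B] times a ratio of coboundary counts. With |Hom^0| split into
    coboundaries and cocycles, everything cancels. The factor [altc B' B] on the left is the one
    that [comp_coef_tens] produces on B + B'. *)
Lemma glue_coef :
  tens_coef B B' C C' * tens_coef A A' B B' * altc B' B * #|glued_exts s t s' t'|%:R =
  tens_coef A A' C C' * #|ext_blocks r r'|%:R.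
Proof.
have dA' := dsrc_diff s'; have dB : is_diff (dsrc t) := dsrc_diff t.
have dB' := dsrc_diff t'; have dC := dtgt_diff t; have dC' := dtgt_diff t'.
have f'q := qmap_qiso s'; rewrite st' in f'q.
have gq := qmap_qiso t; have g'q := qmap_qiso t'.
have h1 i : cohom_card (dsrc t') (dsrc t) i = cohom_card (dsrc t') (dtgt t) i.
  exact: (cohom_card_post _ dB' dB dC gq).
have h2 i : cohom_card (dsrc t') (dsrc t) i = cohom_card (dsrc s') (dsrc t) i.
  exact: (cohom_card_pre _ dB dA' dB' f'q).
have h3 i : cohom_card (dsrc s') (dsrc t) i = cohom_card (dsrc s') (dtgt t) i.
  exact: (cohom_card_post _ dA' dB dC gq).
have a1 := altc_cohom_eq h1; have a2 := altc_cohom_eq h2.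
have a3 := altc_cohom_eq (fun i => etrans (h2 i) (h3 i)).
have sgn2 : (-1 : k) * -1 = 1 by rewrite mulrNN mulr1.
have z1 := card_post 1 dB' dB dC gq sgn2.
have z2 := card_pre 1 dC dB' dC' g'q sgn2.
have hom0 (X U : flagspace k) (d : 'End(X)) (e : 'End(U)) : #|homset X U 0|%:R =
    #|coboundaries d e 1 (-1)|%:R * #|cocycles d e 0 1|%:R :> rat.
  by have := card_homset d e 1 (-1); rewrite subrr opprK => ->; rewrite natrM.
rewrite card_glued_exts // !card_ext_blocks !tens_coefE.
rewrite !rs !rt !rs' !rt' !st !st' !natrM -!pmulrn.
rewrite -!pmulrn in a1 a2 a3.
rewrite (hom0 B' C (dsrc t') (dtgt t)) (hom0 A' B (dsrc s') (dsrc t)).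
rewrite (hom0 A' C (dsrc s') (dtgt t)).
have b0 (X U : flagspace k) (d : 'End(X)) (e : 'End(U)) :
    #|coboundaries d e 1 (-1)|%:R != 0 :> rat.
  by have := cob_neq0 d e 1 (-1); rewrite -pmulrn.
have c0 (X U : flagspace k) (d : 'End(X)) (e : 'End(U)) :
    #|cocycles d e 0 1|%:R != 0 :> rat.
  by rewrite pnatr_eq0 -lt0n; apply/card_gt0P; exists 0; apply: cocycles0.
have z3 : #|cocycles (dsrc t') (dsrc t) 1 (-1)|%:R *
    #|coboundaries (dtgt t') (dtgt t) 1 (-1)|%:R =
    #|cocycles (dtgt t') (dtgt t) 1 (-1)|%:R *
    #|coboundaries (dsrc t') (dsrc t) 1 (-1)|%:R :> rat.
  apply: (mulIf (b0 _ _ (dsrc t') (dtgt t))); rewrite -!natrM; congr (_%:R).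
  by rewrite mulnAC z1 mulnAC [in RHS]mulnAC z2 mulnAC.
have aE1 := canRL (mulfK (b0 _ _ _ _)) (esym a1).
have aE2 := canRL (mulfK (b0 _ _ _ _)) (esym a2).
have aE3 := canRL (mulfK (b0 _ _ _ _)) (esym a3).
have zE := canRL (mulfK (b0 _ _ _ _)) z3.
rewrite aE1 aE2 aE3 zE; field.
by rewrite !altc_neq0 !b0 !c0.
Qed.

Definition block_cls (w : blocks A' A C C') :
    Hhom (tens_space A A') (tens_space C C') :=
  @clsr k (tens_space A A') (tens_space C C') (ublock (dsrc r) w.1.1 (dsrc r')) (ublock (qmap r) w.1.2 (qmap r'))
    (ublock (dtgt r) w.2 (dtgt r')).

Lemma block_cls_homotopy w n : w \in ext_blocks r r' ->
  n \in glue_homotopies A C' t s' -> block_cls (w + n) = block_cls w.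
Proof.
case: w => [[a b] c] /ext_blocksP wT /glue_homotopiesP[y /coboundariesP[h h1 ey] ->].
have -> : (a, b, c) + glue_homotopy A C' y = (a, b + y, c) :> blocks A' A C C'.
  by congr (_, _, _); apply: addr0.
rewrite scale1r in ey; have [h0 e1 e2 e3] := wT.
have r1 := dsrc_hdeg r'; have r2 := dtgt_hdeg r.
have y0 : hdeg 0 (y : 'Hom(A', C)).
  rewrite ey; apply: hdegD; first by apply: (hdeg_compE h1 _ _); [rewrite -rt; exact: r2 | ].
  by apply: (hdeg_compE _ h1 _); [rewrite -rs'; exact: r1 | ].
have wnT : is_tens_ext r r' a (b + y) c.
  have [a0 b0 c0] := h0; split=> //; first by split=> //; apply: hdegD.
  rewrite comp_lfunDl comp_lfunDr addrAC e3 [RHS]addrAC; congr (_ + _).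
  have [_ _ d2] := dsrc_diff r'; have [_ _ e2'] := dtgt_diff r.
  rewrite ey rs' rt comp_lfunDl comp_lfunDr -rs' -rt.
  by rewrite -[in LHS]comp_lfunA -[((h \o _) \o _)%VF]comp_lfunA d2 !comp_lfunA e2' comp_lfun0r comp_lfun0l addr0 add0r.
rewrite /block_cls (clsrE (t := mk_qtriple (tens_qtriple_proof wnT)) erefl erefl erefl).
rewrite (clsrE (t := mk_qtriple (tens_qtriple_proof wT)) erefl erefl erefl).
apply: (@cls_gequiv _ _ _ \1%VF \1%VF); split; rewrite ?comp_lfun1l ?comp_lfun1r //; try exact: fg_iso1.
(* A primitive [h] of [y], placed off the diagonal, is a homotopy between the two block
   quasi-isomorphisms. *)
exists (ublock 0 h 0 : 'Hom(tens_space A A', tens_space C C')).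
  by apply/hdeg_ublock; split=> //; apply: hdeg0.
rewrite ublockB !subrr !comp_ublock !comp_lfun0l !comp_lfun0r ublockD !addr0 add0r.
by rewrite addrAC subrr add0r ey rt rs'.
Qed.

Lemma tens_rep_glue :
  (tens_coef B B' C C' * tens_coef A A' B B' * altc B' B) *:
    \sum_(p in glued_exts s t s' t') block_cls (glue t s' p) = tens_rep r r'.
Proof.
have sumE := sum_glue st rs rm rt st' rs' rm' rt' block_cls_homotopy.
have glE := glue_coef.
have nT : #|ext_blocks r r'|%:R != 0 :> rat.
  rewrite card_ext_blocks pnatr_eq0 -lt0n !muln_gt0; apply/and3P.
  by split; apply/card_gt0P; exists 0; rewrite ?cocycles0 ?coboundaries0.
have nN : #|glue_homotopies A C' t s'|%:R != 0 :> rat.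
  by rewrite pnatr_eq0 -lt0n card_glue_homotopies_gt0.
have -> : \sum_(p in glued_exts s t s' t') block_cls (glue t s' p) =
    (#|glued_exts s t s' t'|%:R / #|ext_blocks r r'|%:R) *: \sum_(w in ext_blocks r r') block_cls w.
  apply: (scalerI (a := #|glue_homotopies A C' t s'|%:R * #|ext_blocks r r'|%:R : rat)).
    by rewrite mulf_neq0.
  rewrite scalerA -natrM scaler_nat sumE -scaler_nat; congr (_ *: _).
  by rewrite !natrM; field.
rewrite scalerA mulrA glE mulfK // tens_repE; congr (_ *: _).
rewrite -(sum_tens_exts r r' (@clsr k (tens_space A A') (tens_space C C'))).
by apply: eq_bigr => u _; apply: clsrE.
Qed.

End GluedSum.

(** * The interchange law *)

Section Interchange.
Variable k : finFieldType.
Implicit Types U V W X Y Z : flagspace k.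

Lemma qext_push U V W X Y Z (b : 'Hom(V, W)) (b' : 'Hom(Y, Z))
    (beta : 'Hom(tens_space V Y, tens_space W Z)) (ib : fg_iso b) (ib' : fg_iso b')
    (ibeta : fg_iso beta) (s : qtriple U V) (t : qtriple X Y) u :
  is_ublock b b' beta -> qext s t u ->
  qext (push_qtriple ib s) (push_qtriple ib' t) (push_qtriple ibeta u).
Proof.
move=> bb [b1 b2 b3]; split=> //; first exact: is_ublock_comp b2 bb.
exact: is_ublock_comp (is_ublock_inv ib ib' ibeta bb) (is_ublock_comp b3 bb).
Qed.

Lemma push_qtripleK U V W (b : 'Hom(V, W)) (ib : fg_iso b) (jb : fg_iso b^-1%VF)
    (s : qtriple U V) : push_qtriple jb (push_qtriple ib s) = s.
Proof.
apply: qtriple_ext => //; apply/lfunP=> v; rewrite /qmap /dtgt /=.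
  by rewrite !comp_lfunE (fg_isoK ib).
by rewrite (fg_iso_invK ib) !comp_lfunE !(fg_isoK ib).
Qed.

Lemma push_qtripleVK U V W (b : 'Hom(V, W)) (ib : fg_iso b) (jb : fg_iso b^-1%VF)
    (s : qtriple U W) : push_qtriple ib (push_qtriple jb s) = s.
Proof.
apply: qtriple_ext => //; apply/lfunP=> v; rewrite /qmap /dtgt /=.
  by rewrite !comp_lfunE (fg_isoVK ib).
by rewrite /dtgt /= (fg_iso_invK ib) !comp_lfunE !(fg_isoVK ib).
Qed.

Section Matched.
Variables (A B C A' B' C' : flagspace k).
Variables (s : qtriple A B) (t : qtriple B C).
Variables (s' : qtriple A' B') (t' : qtriple B' C').
Hypotheses (st : dtgt s = dsrc t) (st' : dtgt s' = dsrc t').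

Lemma sum_matched (M : nmodType)
    (G : 'End(tens_space A A') -> 'Hom(tens_space A A', tens_space C C') ->
         'End(tens_space C C') -> M) :
  \sum_(v in tens_exts t t') \sum_(u in tens_exts s s' | dtgt u == dsrc v)
    G (dsrc u) (qmap v \o qmap u)%VF (dtgt v) =
  \sum_(p in glued_exts s t s' t') G (ublock (dsrc s) (glue t s' p).1.1 (dsrc s'))
    (ublock (qmap t \o qmap s)%VF (glue t s' p).1.2 (qmap t' \o qmap s')%VF)
    (ublock (dtgt t) (glue t s' p).2 (dtgt t')).
Proof.
(* The matching condition is moved into the summand as a default 0, so that each sum over extensions
   can be turned into a sum over blocks separately. *)
pose G1 (d2 : 'End(tens_space B B')) (g : 'Hom(tens_space B B', tens_space C C'))
    (e2 : 'End(tens_space C C')) (d : 'End(tens_space A A'))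
    (f : 'Hom(tens_space A A', tens_space B B')) (e : 'End(tens_space B B')) : M :=
  if e == d2 then G d (g \o f)%VF e2 else 0.
transitivity (\sum_(v in tens_exts t t') \sum_(u in tens_exts s s')
    G1 (dsrc v) (qmap v) (dtgt v) (dsrc u) (qmap u) (dtgt u)).
  by apply: eq_bigr => v _; rewrite big_mkcondr.
under eq_bigr => v _ do rewrite (sum_tens_exts s s' (G1 (dsrc v) (qmap v) (dtgt v))).
rewrite (sum_tens_exts t t' (fun d f e => \sum_(p in ext_blocks s s') G1 d f e
  (ublock (dsrc s) p.1.1 (dsrc s')) (ublock (qmap s) p.1.2 (qmap s'))
  (ublock (dtgt s) p.2 (dtgt s')))).
transitivity (\sum_(q in ext_blocks t t') \sum_(p in ext_blocks s s' | p.2 == q.1.1)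
   G (ublock (dsrc s) p.1.1 (dsrc s'))
    (ublock (qmap t) q.1.2 (qmap t') \o ublock (qmap s) p.1.2 (qmap s'))%VF
    (ublock (dtgt t) q.2 (dtgt t'))).
  apply: eq_bigr => q _; rewrite big_mkcondr; apply: eq_bigr => p _; rewrite /G1.
  suff -> : (ublock (dtgt s) p.2 (dtgt s') == ublock (dsrc t) q.1.1 (dsrc t')) = (p.2 == q.1.1) by [].
  rewrite st st'; apply/eqP/eqP => [/ublock_inj[]|->] //.
rewrite pair_big_dep /=.
apply: (sum_bij (I := (blocks B' B C C' * blocks A' A B B')%type)
  (J := glued_blocks A B C A' B' C')
  (h := fun z => (z.2, (z.1.1.2, z.1.2)))
  (h' := fun p => ((p.1.2, p.2.1, p.2.2), p.1))).
- move=> [[[x y] z] [[a b] c]] /= /andP[qT /andP[pT /eqP /= e]].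
  rewrite -e in qT; rewrite in_glued_exts /=; apply/andP; split; [exact: pT | exact: qT].
- move=> [[[a b] c] [x y]]; rewrite in_glued_exts /= => /andP[pT qT].
  by apply/andP; split; [exact: qT | apply/andP; split; [exact: pT | apply: eqxx]].
- by move=> [[[x y] z] [[a b] c]] /= /andP[_ /andP[_ /eqP /= ->]].
- by move=> [[[a b] c] [x y]] _.
by move=> [[[x y] z] [[a b] c]] _ /=; rewrite comp_ublock.
Qed.

Lemma tens_rep_matched (r : qtriple A C) (r' : qtriple A' C') :
  dsrc r = dsrc s -> qmap r = (qmap t \o qmap s)%VF -> dtgt r = dtgt t ->
  dsrc r' = dsrc s' -> qmap r' = (qmap t' \o qmap s')%VF -> dtgt r' = dtgt t' ->
  (tens_coef B B' C C' * tens_coef A A' B B' * altc B' B) *: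
    (\sum_(v in tens_exts t t') \sum_(u in tens_exts s s' | dtgt u == dsrc v)
      clsr (dsrc u) (qmap v \o qmap u)%VF (dtgt v)) = tens_rep r r'.
Proof.
move=> rs rm rt rs' rm' rt'.
rewrite -(tens_rep_glue st rs rm rt st' rs' rm' rt'); congr (_ *: _).
rewrite (sum_matched (@clsr k (tens_space A A') (tens_space C C'))).
by apply: eq_bigr => p _; rewrite /block_cls rs rm rt rs' rm' rt'.
Qed.

End Matched.

Section Unmatched.
Variables (A B C A' B' C' : flagspace k).
Variables (s : qtriple A B) (t : qtriple B C).
Variables (s' : qtriple A' B') (t' : qtriple B' C').

(** The contribution of a single isomorphism [beta] on B + B' to the composite of the two tensor
    products, without the normalizing constants. *)
Definition intertwined (beta : 'End(tens_space B B')) :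
    Hhom (tens_space A A') (tens_space C C') :=
  \sum_(v in tens_exts t t')
    \sum_(u in tens_exts s s' | (beta \o dtgt u)%VF == (dsrc v \o beta)%VF)
      clsr (dsrc u) (qmap v \o beta \o qmap u)%VF (dtgt v).

(** Pushing [u] along [beta] makes its target differential equal to the source differential of [v],
    and pushes [s], [s'] along [b], [b']. This is the matched case, and the result is independent of
    [x]. *)
Lemma intertwined_tens b b' (x : 'Hom(B', B)) (hb : cx_iso (dtgt s) (dsrc t) b)
    (hb' : cx_iso (dtgt s') (dsrc t') b') : hdeg 0 x ->
  (tens_coef B B' C C' * tens_coef A A' B B' * altc B' B) *:
    intertwined (ublock b x b') =
  tens_rep (comp_qtriple hb) (comp_qtriple hb').
Proof.
move=> x0; have [ib cb] := hb; have [ib' cb'] := hb'.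
have ibeta : fg_iso (ublock b x b' : 'End(tens_space B B')) by apply: fg_iso_ublock.
have jb := fg_iso_inv ib; have jb' := fg_iso_inv ib'; have jbeta := fg_iso_inv ibeta.
have bb : is_ublock b b' (ublock b x b') by exists x.
have bbV := is_ublock_inv ib ib' ibeta bb.
pose s1 := push_qtriple ib s; pose s1' := push_qtriple ib' s'.
have st : dtgt s1 = dsrc t.
  by rewrite [LHS]/dtgt /= cb -comp_lfunA (fg_iso_compVr ib) comp_lfun1r.
have st' : dtgt s1' = dsrc t'.
  by rewrite [LHS]/dtgt /= cb' -comp_lfunA (fg_iso_compVr ib') comp_lfun1r.
rewrite -(@tens_rep_matched _ _ _ _ _ _ s1 t s1' t' st st' (comp_qtriple hb) (comp_qtriple hb')) //; last 2 first.
- by rewrite [LHS]/qmap /= -comp_lfunA.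
- by rewrite [LHS]/qmap /= -comp_lfunA.
congr (_ *: _); apply: eq_bigr => v _.
apply: (sum_bij (h := push_qtriple ibeta) (h' := push_qtriple jbeta)).
- move=> u /andP[/tens_extsP uT /eqP e]; apply/andP; split.
    by apply/tens_extsP; apply: qext_push.
  by apply/eqP; rewrite [LHS]/dtgt /= e -comp_lfunA (fg_iso_compVr ibeta) comp_lfun1r.
- move=> u /andP[/tens_extsP uT /eqP e]; apply/andP; split.
    apply/tens_extsP; rewrite -(push_qtripleK ib jb s) -(push_qtripleK ib' jb' s').
    by apply: qext_push.
  by apply/eqP; rewrite [dtgt _]/dtgt /= (fg_iso_invK ibeta) e !comp_lfunA (fg_iso_compVr ibeta) comp_lfun1l.
- by move=> u _; apply: push_qtripleK.
- by move=> u _; apply: push_qtripleVK.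
by move=> u _; rewrite [qmap (push_qtriple _ _)]/qmap /= comp_lfunA.
Qed.

(** The diagonal blocks of the relation imposed on [beta] are the chain map conditions for [b] and
    [b']; if either fails, the sum is empty. *)
Lemma intertwined0 b b' (x : 'Hom(B', B)) : fg_iso b -> fg_iso b' ->
  ~ (cx_iso (dtgt s) (dsrc t) b /\ cx_iso (dtgt s') (dsrc t') b') ->
  intertwined (ublock b x b') = 0.
Proof.
move=> ib ib' nbb; rewrite /intertwined big1 // => v /tens_extsP[[v1 e1] _ _].
rewrite big1 // => u /andP[/tens_extsP[_ _ [u1 e2]] /eqP].
rewrite e1 e2 !comp_ublock => /ublock_inj[eb _ eb'].
by case: nbb.
Qed.

Lemma Htens_comp_cls :
  Htens (Hcomp (cls t) (cls s)) (Hcomp (cls t') (cls s')) =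
  Hcomp (Htens (cls t) (cls t')) (Htens (cls s) (cls s')).
Proof.
pose P b := cx_iso (dtgt s) (dsrc t) b; pose P' b := cx_iso (dtgt s') (dsrc t') b.
pose E := finvect_type 'End(B); pose E' := finvect_type 'End(B').
pose T := finvect_type 'End(tens_space B B').
pose R (b : 'End(B)) (b' : 'End(B')) : Hhom (tens_space A A') (tens_space C C') :=
  Htens (clsr (dsrc s) (qmap t \o b \o qmap s)%VF (dtgt t))
        (clsr (dsrc s') (qmap t' \o b' \o qmap s')%VF (dtgt t')).
pose tc := tens_coef B B' C C' * tens_coef A A' B B'.
have tc0 : tc * altc B' B != 0.
  by rewrite /tc !tens_coefE !mulf_neq0 ?invr_eq0 ?mulf_neq0 ?altc_neq0 ?card_homset_neq0.
transitivity ((comp_coef B * comp_coef B') *: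
    \sum_(b : E | `[< P b >]) \sum_(b' : E' | `[< P' b' >]) R b b').
  rewrite !Hcomp_cls !comp_repE Htens_suml -scalerA; congr (_ *: _).
  by rewrite [in RHS]scaler_sumr; apply: eq_bigr => b _; rewrite Htens_sumr.
transitivity ((tc * comp_coef (tens_space B B')) *:
    \sum_(beta : T | `[< fg_iso (beta : 'End(tens_space B B')) >]) intertwined beta); last first.
  rewrite !Htens_cls !tens_repE Hcomp_suml -!scalerA; congr (_ *: _).
  rewrite [in RHS](eq_bigr (fun v => tens_coef A A' B B' *: (comp_coef (tens_space B B') *:
    \sum_(u in tens_exts s s') \sum_(beta : T | `[< cx_iso (dtgt u) (dsrc v) beta >])
      clsr (dsrc u) (qmap v \o beta \o qmap u)%VF (dtgt v)))); last first.
    move=> v _; rewrite Hcomp_sumr; congr (_ *: _); rewrite scaler_sumr.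
    by apply: eq_bigr => u _; rewrite Hcomp_cls comp_repE.
  rewrite -!scaler_sumr; do 2!congr (_ *: _).
  rewrite exchange_big /=; apply: eq_bigr => v _.
  rewrite (exchange_big_dep (fun u => u \in tens_exts s s')) /=; last by move=> beta u _ /andP[].
  apply: eq_bigr => u uT; apply: eq_bigl => beta; rewrite uT.
  by apply/andP/asboolP => [[/asboolP ? /eqP ?]|[? ?]]; split=> //; [apply/asboolP | apply/eqP].
(* Each pair [(b, b')] is repeated |Hom^0(B', B)| times, once for every [x]; [comp_coef_tens] shows
   that the constants match. *)
transitivity ((tc * comp_coef (tens_space B B')) *:
    \sum_(b : E | `[< P b >]) \sum_(b' : E' | `[< P' b' >])
      \sum_(x in homset B' B 0) intertwined (ublock b x b')).
  rewrite [in RHS](eq_bigr (fun b => \sum_(b' : E' | `[< P' b' >])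
     (tc * altc B' B)^-1 *: (R b b' *+ #|homset B' B 0|))); last first.
    move=> b /asboolP hb; apply: eq_bigr => b' /asboolP hb'.
    rewrite -sumr_const scaler_sumr; apply: eq_bigr => x /homsetP x0.
    rewrite /R (clsr_comp hb) (clsr_comp hb') Htens_cls -(intertwined_tens hb hb' x0).
    by rewrite scalerA -/tc mulVf ?scale1r.
  rewrite [in RHS](eq_bigr (fun b => (tc * altc B' B)^-1 *:
    ((\sum_(b' : E' | `[< P' b' >]) R b b') *+ #|homset B' B 0|))); last first.
    by move=> b _; rewrite -scaler_sumr sumrMnl.
  rewrite -[in RHS]scaler_sumr sumrMnl -scaler_nat !scalerA; congr (_ *: _).
  apply: (mulIf (altc_neq0 B' B)); rewrite -(comp_coef_tens B B') -pmulrn.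
  have tcn : tc != 0 by apply: contraNneq tc0 => ->; rewrite mul0r.
  by field; rewrite tcn altc_neq0.
congr (_ *: _).
pose H := finvect_type 'Hom(B', B).
pose F (z : E * (E' * H)) := intertwined (ublock z.1 z.2.2 z.2.1).
transitivity (\sum_(z : E * (E' * H) |
    `[< P z.1 >] && (`[< P' z.2.1 >] && (z.2.2 \in homset B' B 0))) F z).
  rewrite -(pair_big (fun b : E => `[< P b >])
    (fun z : E' * H => `[< P' z.1 >] && (z.2 \in homset B' B 0)) (fun b z => F (b, z))) /=.
  apply: eq_bigr => b _.
  by rewrite (pair_big (fun b' : E' => `[< P' b' >]) (fun x : H => x \in homset B' B 0)).
(* The chain map conditions may be dropped from the index set because the added terms vanish by
   [intertwined0]. What remains parametrizes all automorphisms of B + B'. *)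
transitivity (\sum_(z : E * (E' * H) | [&& `[< fg_iso (z.1 : 'End(B)) >],
    `[< fg_iso (z.2.1 : 'End(B')) >] & z.2.2 \in homset B' B 0]) F z).
  rewrite [RHS](bigID (fun z => `[< P z.1 >] && `[< P' z.2.1 >])) /=.
  rewrite [X in _ = _ + X]big1 ?addr0; last first.
    move=> [b [b' x]] /= /andP[/and3P[/asboolP ib /asboolP ib' _] nP].
    apply: intertwined0 => // -[hb hb']; case/negP: nP.
    by apply/andP; split; apply/asboolP.
  apply: eq_bigl => -[b [b' x]] /=.
  apply/idP/idP => [/and3P[hb hb' xH]|/andP[/and3P[_ _ xH] /andP[hb hb']]]; last first.
    by rewrite hb hb' xH.
  rewrite hb hb' xH !andbT; apply/andP; split; apply/asboolP.
    by move/asboolP: hb => [].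
  by move/asboolP: hb' => [].
apply: (sum_bij (I := (E * (E' * H))%type) (J := T)
  (h := fun z => ublock z.1 z.2.2 z.2.1)
  (h' := fun beta => (ublock11 beta, (ublock22 beta, ublock12 beta)))).
- move=> [b [b' x]] /= /and3P[/asboolP ib /asboolP ib' /homsetP x0]; apply/asboolP.
  exact: fg_iso_ublock.
- move=> beta /asboolP/fg_iso_ublockP[b [x [b' [-> ib x0 ib']]]] /=.
  rewrite ublock11E ublock12E ublock22E; apply/and3P; split; [exact/asboolP | exact/asboolP | exact/homsetP].
- by move=> [b [b' x]] _ /=; rewrite ublock11E ublock12E ublock22E.
- move=> beta /asboolP/fg_iso_ublockP[b [x [b' [-> _ _ _]]]] /=.
  by rewrite ublock11E ublock12E ublock22E.
by [].
Qed.

End Unmatched.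
End Interchange.

(** * Bilinear form of the interchange law, and tensor products of identities *)

Section TensorIdentity.
Variable k : finFieldType.
Implicit Types U V W X Y Z : flagspace k.

Lemma Htens_comp A B C A' B' C' (g : Hhom B C) (f : Hhom A B) (g' : Hhom B' C')
    (f' : Hhom A' B') :
  Htens (Hcomp g f) (Hcomp g' f') = Hcomp (Htens g g') (@Htens k _ _ _ _ f f').
Proof.
move: f; apply: Hhom_ext; [by move=> a x y; rewrite Hcomp_linr Htens_linl |
  by move=> a x y; rewrite Htens_linl Hcomp_linr | move=> s].
move: g; apply: Hhom_ext; [by move=> a x y; rewrite Hcomp_linl Htens_linl |
  by move=> a x y; rewrite Htens_linl Hcomp_linl | move=> t].
move: f'; apply: Hhom_ext; [by move=> a x y; rewrite Hcomp_linr Htens_linr |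
  by move=> a x y; rewrite Htens_linr Hcomp_linr | move=> s'].
move: g'; apply: Hhom_ext; [by move=> a x y; rewrite Hcomp_linl Htens_linr |
  by move=> a x y; rewrite Htens_linr Hcomp_linl | move=> t'].
exact: Htens_comp_cls.
Qed.

Lemma card_automorphisms_tens U X :
  #|automorphisms (tens_space U X)| =
  (#|automorphisms U| * #|automorphisms X| * #|homset X U 0|)%N.
Proof.
rewrite -!cardsX; apply/esym.
pose E := (finvect_type 'End(U) * finvect_type 'End(X) * finvect_type 'Hom(X, U))%type.
pose h (p : E) : finvect_type 'End(tens_space U X) := ublock p.1.1 p.2 p.1.2.
have h_inj : injective h.
  by move=> [[a c] b] [[a' c'] b'] /ublock_inj[/= -> -> ->].
rewrite -(card_imset _ h_inj); apply: eq_card => D; apply/imsetP/automorphismsP.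
  move=> [[[a c] b] /setXP[/setXP[/automorphismsP ia /automorphismsP ic] /homsetP b0] ->].
  exact: fg_iso_ublock.
move=> /fg_iso_ublockP[a [b [c [-> ia b0 ic]]]].
exists (a, c, b) => //; apply/setXP; split; last exact/homsetP.
by apply/setXP; split; apply/automorphismsP.
Qed.

Lemma cls_iso_id V (u : qtriple V V) : fg_iso (qmap u) ->
  cls u = clsr (dsrc u) \1%VF (dsrc u).
Proof.
move=> iu; rewrite (clsr_id (dsrc_diff u)); apply/esym.
apply: (@cls_gequiv _ _ _ \1%VF (qmap u)); split=> //; first exact: fg_iso1.
- by rewrite comp_lfun1l comp_lfun1r.
- exact: qmap_chain.
exact: homotopic_eq.
Qed.

(** For identity triples the mixed relation determines delta_22 from delta_11 and delta_12, while
    delta_12 is an arbitrary map of degree 0. *)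
Lemma sum_id_exts (M : nmodType) U X (d : 'End(U)) (d' : 'End(X)) (dd : is_diff d)
    (dd' : is_diff d') (F : finvect_type 'Hom(X, U) -> M) :
  \sum_(p in ext_blocks (id_qtriple dd) (id_qtriple dd')) F p.1.1 =
  (\sum_(a in cocycles d' d 1 (-1)) F a) *+ #|homset X U 0|.
Proof.
rewrite -sumrMnl; under [RHS]eq_bigr do rewrite -sumr_const.
rewrite (pair_big (mem (cocycles d' d 1 (-1))) (mem (homset X U 0)) (fun a _ => F a)) /=.
have [d1 _ d2] := dd; have [d'1 _ d'2] := dd'.
apply: (sum_bij (I := blocks X U U X)
  (J := (finvect_type 'Hom(X, U) * finvect_type 'Hom(X, U))%type)
  (h := fun p => (p.1.1, p.1.2))
  (h' := fun z => (z.1, z.2,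
    ((z.2 : 'Hom(X, U)) \o d')%VF + (z.1 : 'Hom(X, U)) - (d \o (z.2 : 'Hom(X, U)))%VF))).
- move=> [[a b] c] /ext_blocksP[/= [a0 b0 _] ea _ _]; apply/andP; split.
    exact/cocycle1P.
  exact/homsetP.
- move=> [a b] /= /andP[/cocycle1P[a1 ea] /homsetP b0].
  apply/ext_blocksP; split=> /=.
  + split=> //; apply: hdegB; first apply: hdegD => //.
      by apply: (hdeg_compE d'1 b0); rewrite addr0.
    by apply: (hdeg_compE b0 d1); rewrite add0r.
  + exact: ea.
  + apply/lfunP=> v; have /lfunP/(_ v) := ea.
    have /lfunP/(_ (b v)) := d2; have /lfunP/(_ v) := d'2.
    rewrite !(add_lfunE, opp_lfunE, comp_lfunE, zero_lfunE) linearB linearD /= => -> ->.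
    rewrite linear0 /dtgt /= => e; rewrite (linear0 b) addr0 add0r !addrA.
    by rewrite [LHS](ACl ((2*3)*(1*4))) /= e add0r subrr.
  rewrite [qmap (id_qtriple dd)]/qmap [qmap (id_qtriple dd')]/qmap /= comp_lfun1l comp_lfun1r.
  by rewrite [RHS]addrC subrK.
- move=> [[a b] c] /ext_blocksP[_ _ _ /= e]; congr (_, _, _).
  move: e; rewrite [qmap (id_qtriple dd)]/qmap [qmap (id_qtriple dd')]/qmap /=.
  rewrite comp_lfun1l comp_lfun1r => ->.
  by rewrite addrC addKr.
- by move=> [a b].
by move=> [[a b] c].
Qed.

(** Every extension of two identity triples has an invertible triangular quasi-isomorphism, so its
    class depends only on its source differential. These differentials exhaust those of U + X. The
    constants agree because [tens_coef U X U X] times |Hom^0(X, U)| is the inverse of [altc X U]. *)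
Lemma Htens_id U X : Htens (Hid U) (Hid X) = Hid (tens_space U X).
Proof.
pose E := finvect_type 'End(U); pose E' := finvect_type 'End(X).
pose H := finvect_type 'Hom(X, U).
pose c (d : E) (a : H) (d' : E') : Hhom (tens_space U X) (tens_space U X) :=
  clsr (ublock d a d' : 'End(tens_space U X)) \1%VF (ublock d a d' : 'End(tens_space U X)).
pose K V : rat := (comp_coef V * #|automorphisms V|%:R)^-1.
transitivity ((K U * K X * (tens_coef U X U X * #|homset X U 0|%:R)) *:
  \sum_(d : E | `[< is_diff (d : 'End(U)) >])
    \sum_(d' : E' | `[< is_diff (d' : 'End(X)) >])
      \sum_(a in cocycles d' d 1 (-1)) c d a d').
  rewrite Htens_suml -!scalerA; congr (_ *: _); rewrite !scaler_sumr.
  apply: eq_bigr => d /asboolP dd; rewrite Htens_sumr; congr (_ *: _).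
  rewrite !scaler_sumr; apply: eq_bigr => d' /asboolP dd'.
  rewrite (clsr_id dd) (clsr_id dd') Htens_cls tens_repE; congr (_ *: _).
  rewrite scaler_nat -(sum_id_exts dd dd' (fun a => c d a d')).
  rewrite -(sum_tens_exts (id_qtriple dd) (id_qtriple dd')
    (fun D _ _ => @clsr k (tens_space U X) (tens_space U X) D \1%VF D)).
  apply: eq_bigr => u /tens_extsP[_ [x ex] _]; apply: cls_iso_id.
  rewrite ex; apply: fg_iso_ublock; try exact: fg_iso1.
  by have := qmap_hdeg u; rewrite ex => /hdeg_ublock[].
rewrite /Hid; congr (_ *: _).
  have h0 : #|homset X U 0|%:R != 0 :> rat by have := card_homset_neq0 X U 0; rewrite -pmulrn.
  have := comp_coef_tens U X; rewrite -pmulrn => /(canRL (mulfK h0)) ccE.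
  rewrite /K card_automorphisms_tens tens_coefE !natrM -pmulrn ccE; field.
  by rewrite !comp_coef_neq0 !card_automorphisms_neq0 !altc_neq0 h0.
transitivity (\sum_(z : E * (E' * H) | `[< is_diff (z.1 : 'End(U)) >] &&
    (`[< is_diff (z.2.1 : 'End(X)) >] && (z.2.2 \in cocycles z.2.1 z.1 1 (-1)))) c z.1 z.2.2 z.2.1).
  rewrite -(pair_big_dep (fun d : E => `[< is_diff (d : 'End(U)) >])
    (fun d (z : E' * H) => `[< is_diff (z.1 : 'End(X)) >] && (z.2 \in cocycles z.1 d 1 (-1)))
    (fun d z => c d z.2 z.1)) /=.
  apply: eq_bigr => d _.
  by rewrite (pair_big_dep (fun d' : E' => `[< is_diff (d' : 'End(X)) >])
    (fun d' (x : H) => x \in cocycles d' d 1 (-1)) (fun d' x => c d x d')).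
apply: (sum_bij (I := (E * (E' * H))%type) (J := finvect_type 'End(tens_space U X))
  (h := fun z => ublock z.1 z.2.2 z.2.1)
  (h' := fun D => (ublock11 D, (ublock22 D, ublock12 D)))).
- move=> [d [d' a]] /= /and3P[/asboolP dd /asboolP dd' /cocycle1P[a0 ea]].
  by apply/asboolP; apply: is_diff_tens.
- move=> D /asboolP/is_diff_ublockP[d [a [d' [-> dd dd' a0 ea]]]] /=.
  rewrite ublock11E ublock12E ublock22E; apply/and3P; split; [exact/asboolP | exact/asboolP | exact/cocycle1P].
- by move=> [d [d' a]] _ /=; rewrite ublock11E ublock12E ublock22E.
- move=> D /asboolP/is_diff_ublockP[d [a [d' [-> _ _ _ _]]]] /=.
  by rewrite ublock11E ublock12E ublock22E.
by [].
Qed.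

End TensorIdentity.

(** * Associativity through 3 x 3 block triangular triples *)

Section Associativity.
Variable k : finFieldType.
Implicit Types U V W X Y Z : flagspace k.

(** Rebracketing of a 3 x 3 upper triangular matrix: the U'-part of the last column [p] joins the
    first row, and its V'-part the lower right block. *)
Lemma assoc_ublock (U U' V V' W W' : vectType k) (a : 'Hom(U, U'))
    (x : 'Hom(V, U')) (b : 'Hom(V, V')) (p : 'Hom(W, (U' * V')%type)) (c : 'Hom(W, W')) :
  (assoc_lf U' V' W' \o ublock (ublock a x b) p c)%VF =
  (ublock a ((x \o runit_lf V W) + (runit_lf U' V' \o p \o lunit_lf V W))
     (ublock b (lunit_lf U' V' \o p) c) \o assoc_lf U V W)%VF.
Proof.
apply/lfunP=> -[[u v] w].
rewrite !(comp_lfunE, ublockE, assoc_lfE) /= !(add_lfunE, comp_lfunE, runit_lfE, lunit_lfE) /=.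
by rewrite addrA.
Qed.

Lemma assoc_ublockV (U U' V V' W W' : vectType k) (a : 'Hom(U, U'))
    (q : 'Hom((V * W)%type, U')) (b : 'Hom(V, V')) (y : 'Hom(W, V')) (c : 'Hom(W, W')) :
  (ublock a q (ublock b y c) \o assoc_lf U V W)%VF =
  (assoc_lf U' V' W' \o ublock (ublock a (q \o inl_lf V W) b)
    ((inl_lf U' V' \o q \o inr_lf V W) + (inr_lf U' V' \o y)) c)%VF.
Proof.
apply/lfunP=> -[[u v] w].
rewrite !(comp_lfunE, ublockE, assoc_lfE) /= !(add_lfunE, comp_lfunE, inl_lfE, inr_lfE) /=.
rewrite addr0 add0r; congr (_, _); rewrite -addrA -linearD; congr (_ + q (_, _)).
  by rewrite addr0.
by rewrite add0r.
Qed.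

Lemma snd_ublock (U V X Y : vectType k) (a : 'Hom(U, V)) (b : 'Hom(X, V)) (c : 'Hom(X, Y)) :
  (lunit_lf V Y \o ublock a b c)%VF = (c \o lunit_lf U X)%VF.
Proof. by apply/lfunP=> p; rewrite !comp_lfunE !lunit_lfE ublockE. Qed.

Lemma ublock_inl (U V X Y : vectType k) (a : 'Hom(U, V)) (b : 'Hom(X, V)) (c : 'Hom(X, Y)) :
  (ublock a b c \o inl_lf U X)%VF = (inl_lf V Y \o a)%VF.
Proof.
apply/lfunP=> u; rewrite !comp_lfunE !inl_lfE ublockE /= !linear0 addr0.
by [].
Qed.

Lemma hdeg_lunit U V : hdeg 0 (lunit_lf U V : 'Hom(tens_space U V, V)).
Proof.
by apply/hdegP=> j p; rewrite addr0 lunit_lfE mem_gr_tens => /andP[].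
Qed.

Lemma hdeg_inl U V : hdeg 0 (inl_lf U V : 'Hom(U, tens_space U V)).
Proof.
by apply/hdegP=> j u uj; rewrite addr0 inl_lfE mem_gr_tens /= uj mem0v.
Qed.

Section Triples.
Variables (U U' V V' W W' : flagspace k).
Variables (s : qtriple U U') (t : qtriple V V') (r : qtriple W W').

Definition left_exts := [set w | [exists u in tens_exts s t, w \in tens_exts u r]].
Definition right_exts := [set w | [exists v in tens_exts t r, w \in tens_exts s v]].

(** The intermediate [u] is the upper left 2 x 2 block of [w], so the union over [u] is disjoint. *)
Lemma sum_left_exts (M : nmodType) (F : _ -> M) :
  \sum_(u in tens_exts s t) \sum_(w in tens_exts u r) F w = \sum_(w in left_exts) F w.
Proof.
rewrite (exchange_big_dep (mem left_exts)) /= => [|u w uT wT]; last first.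
  by rewrite inE; apply/exists_inP; exists u.
apply: eq_bigr => w; rewrite inE => /exists_inP[u uT wT].
rewrite (bigD1 u) /=; last by apply/andP.
rewrite big1 ?addr0 // => u' /andP[/andP[_ /tens_extsP[[? e1] [? e2] [? e3]]] /negP[]].
have /tens_extsP[[? f1] [? f2] [? f3]] := wT; apply/eqP/qtriple_ext.
- by move: e1; rewrite f1 => /ublock_inj[].
- by move: e2; rewrite f2 => /ublock_inj[].
by move: e3; rewrite f3 => /ublock_inj[].
Qed.

Lemma sum_right_exts (M : nmodType) (F : _ -> M) :
  \sum_(v in tens_exts t r) \sum_(w in tens_exts s v) F w = \sum_(w in right_exts) F w.
Proof.
rewrite (exchange_big_dep (mem right_exts)) /= => [|u w uT wT]; last first.
  by rewrite inE; apply/exists_inP; exists u.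
apply: eq_bigr => w; rewrite inE => /exists_inP[u uT wT].
rewrite (bigD1 u) /=; last by apply/andP.
rewrite big1 ?addr0 // => u' /andP[/andP[_ /tens_extsP[[? e1] [? e2] [? e3]]] /negP[]].
have /tens_extsP[[? f1] [? f2] [? f3]] := wT; apply/eqP/qtriple_ext.
- by move: e1; rewrite f1 => /ublock_inj[].
- by move: e2; rewrite f2 => /ublock_inj[].
by move: e3; rewrite f3 => /ublock_inj[].
Qed.

Let L := tens_space (tens_space U V) W.
Let L' := tens_space (tens_space U' V') W'.
Let R := tens_space U (tens_space V W).
Let R' := tens_space U' (tens_space V' W').
Let a : 'Hom(L, R) := assoc_lf U V W.
Let a' : 'Hom(L', R') := assoc_lf U' V' W'.
Let ia : fg_iso a := fg_iso_assoc U V W.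
Let ia' : fg_iso a' := fg_iso_assoc U' V' W'.

(** The extension of [(t, r)] sought is the lower right 2 x 2 block of [w]; its relations are the V-
    or V'-components of those of [w]. *)
Lemma left_exts_assoc w : w \in left_exts ->
  translate ia ia' (hdeg0 _ _ _) w \in right_exts.
Proof.
rewrite inE => /exists_inP[u /tens_extsP[[x1 e1] [x2 e2] [x3 e3]]].
move=> /tens_extsP[[p1 f1] [p2 f2] [p3 f3]].
have ext : is_tens_ext t r (lunit_lf U V \o p1)%VF (lunit_lf U' V' \o p2)%VF
    (lunit_lf U' V' \o p3)%VF.
  have h1 : hdeg 1 p1 by have := dsrc_hdeg w; rewrite f1 => /hdeg_ublock[].
  have h2 : hdeg 0 p2 by have := qmap_hdeg w; rewrite f2 => /hdeg_ublock[].
  have h3 : hdeg 1 p3 by have := dtgt_hdeg w; rewrite f3 => /hdeg_ublock[].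
  have [_ _ d2] := dsrc_diff w; have [_ _ d2'] := dtgt_diff w.
  have ch := qmap_chain w.
  rewrite f1 comp_ublock -ublock0 in d2; have [_ g1 _] := ublock_inj d2.
  rewrite f3 comp_ublock -ublock0 in d2'; have [_ g3 _] := ublock_inj d2'.
  rewrite f1 f2 f3 !comp_ublock in ch; have [_ g2 _] := ublock_inj ch.
  split.
  - split; [apply: (hdeg_compE h1 (hdeg_lunit U V)) | apply: (hdeg_compE h2 (hdeg_lunit U' V'))
           | apply: (hdeg_compE h3 (hdeg_lunit U' V'))]; by rewrite addr0.
  - have := congr1 (fun h => lunit_lf U V \o h)%VF g1.
    by rewrite comp_lfunDr comp_lfun0r !comp_lfunA e1 snd_ublock.
  - have := congr1 (fun h => lunit_lf U' V' \o h)%VF g3.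
    by rewrite comp_lfunDr comp_lfun0r !comp_lfunA e3 snd_ublock.
  have := congr1 (fun h => lunit_lf U' V' \o h)%VF g2.
  by rewrite !comp_lfunDr !comp_lfunA e2 e3 !snd_ublock addrC.
rewrite inE; apply/exists_inP; exists (mk_qtriple (tens_qtriple_proof ext)).
  by apply/tens_extsP; split; eexists.
have aK : (a \o a^-1)%VF = \1%VF := fg_iso_compVr ia.
have aK' : (a' \o a'^-1)%VF = \1%VF := fg_iso_compVr ia'.
apply/tens_extsP; split.
- rewrite dsrc_translate f1 e1 /a assoc_ublock -(comp_lfunA _ (assoc_lf U V W)) aK comp_lfun1r.
  by eexists.
- rewrite qmap_translate comp_lfun0l comp_lfun0r addr0 subr0.
  rewrite f2 e2 /a' /a assoc_ublock -(comp_lfunA _ (assoc_lf U V W)) aK comp_lfun1r.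
  by eexists.
rewrite dtgt_translate f3 e3 /a' assoc_ublock -(comp_lfunA _ (assoc_lf U' V' W')) aK' comp_lfun1r.
by eexists.
Qed.

(** Dually, the upper left 2 x 2 block is found by restricting the first row to V or V'. The
    homotopy is a variable with [h = 0] because [translateK] returns one that is zero only up to a
    proof. *)
Lemma right_exts_assoc (h : 'Hom(R, L')) (h1 : hdeg (-1) h) (ja : fg_iso a^-1%VF)
    (ja' : fg_iso a'^-1%VF) w : h = 0 -> w \in right_exts ->
  translate ja ja' h1 w \in left_exts.
Proof.
move=> h0; rewrite inE => /exists_inP[u /tens_extsP[[x1 e1] [x2 e2] [x3 e3]]].
move=> /tens_extsP[[p1 f1] [p2 f2] [p3 f3]].
have ext : is_tens_ext s t (p1 \o inl_lf V W)%VF (p2 \o inl_lf V W)%VF (p3 \o inl_lf V' W')%VF.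
  have hp1 : hdeg 1 p1 by have := dsrc_hdeg w; rewrite f1 => /hdeg_ublock[].
  have hp2 : hdeg 0 p2 by have := qmap_hdeg w; rewrite f2 => /hdeg_ublock[].
  have hp3 : hdeg 1 p3 by have := dtgt_hdeg w; rewrite f3 => /hdeg_ublock[].
  have [_ _ d2] := dsrc_diff w; have [_ _ d2'] := dtgt_diff w.
  have ch := qmap_chain w.
  rewrite f1 comp_ublock -ublock0 in d2; have [_ g1 _] := ublock_inj d2.
  rewrite f3 comp_ublock -ublock0 in d2'; have [_ g3 _] := ublock_inj d2'.
  rewrite f1 f2 f3 !comp_ublock in ch; have [_ g2 _] := ublock_inj ch.
  split.
  - split; [apply: (hdeg_compE (hdeg_inl V W) hp1) | apply: (hdeg_compE (hdeg_inl V W) hp2)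
           | apply: (hdeg_compE (hdeg_inl V' W') hp3)]; by rewrite add0r.
  - have := congr1 (fun h => h \o inl_lf V W)%VF g1.
    by rewrite comp_lfunDl comp_lfun0l -!comp_lfunA e1 ublock_inl.
  - have := congr1 (fun h => h \o inl_lf V' W')%VF g3.
    by rewrite comp_lfunDl comp_lfun0l -!comp_lfunA e3 ublock_inl.
  have := congr1 (fun h => h \o inl_lf V W)%VF g2.
  by rewrite !comp_lfunDl -!comp_lfunA e1 e2 !ublock_inl addrC.
rewrite inE; apply/exists_inP; exists (mk_qtriple (tens_qtriple_proof ext)).
  by apply/tens_extsP; split; eexists.
have aK : (a^-1 \o a)%VF = \1%VF := fg_iso_compVl ia.
have aK' : (a'^-1 \o a')%VF = \1%VF := fg_iso_compVl ia'.
apply/tens_extsP; split.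
- rewrite dsrc_translate (fg_iso_invK ia) f1 e1 -comp_lfunA /a assoc_ublockV comp_lfunA aK comp_lfun1l.
  by eexists.
- rewrite qmap_translate h0 comp_lfun0l comp_lfun0r addr0 subr0 (fg_iso_invK ia).
  rewrite f2 e2 -comp_lfunA /a /a' assoc_ublockV comp_lfunA aK' comp_lfun1l.
  by eexists.
rewrite dtgt_translate (fg_iso_invK ia') f3 e3 -comp_lfunA /a' assoc_ublockV comp_lfunA aK' comp_lfun1l.
by eexists.
Qed.

Lemma Htens_assoc_cls :
  Htr a a' (Htens (Htens (cls s) (cls t)) (cls r)) =
  Htens (cls s) (Htens (cls t) (cls r)).
Proof.
rewrite !Htens_cls !tens_repE Htens_suml Htens_sumr.
transitivity ((tens_coef U V U' V' * tens_coef (tens_space U V) W (tens_space U' V') W') *: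
    \sum_(w in left_exts) Htr a a' (cls w)).
  rewrite -sum_left_exts -scalerA scaler_sumr linear_sumE; last exact: Htr_linear.
  rewrite -scaler_sumr; congr (_ *: _); rewrite scaler_sumr; apply: eq_bigr => u _.
  rewrite Htens_cls tens_repE scaler_sumr linear_sumE; last exact: Htr_linear.
  by rewrite scaler_sumr.
transitivity ((tens_coef V W V' W' * tens_coef U (tens_space V W) U' (tens_space V' W')) *:
    \sum_(w in right_exts) cls w); last first.
  rewrite -sum_right_exts -scalerA; congr (_ *: _); rewrite scaler_sumr.
  by apply: eq_bigr => v _; rewrite Htens_cls tens_repE.
rewrite tens_coef_assoc; congr (_ *: _).
have [h' [ja [ja' [h'1 [eh' wK wVK]]]]] := translateK ia ia' (hdeg0 L R' (-1)).
apply: (sum_bij (h := translate ia ia' (hdeg0 L R' (-1))) (h' := translate ja ja' h'1)).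
- exact: left_exts_assoc.
- move=> w; apply: right_exts_assoc.
  by rewrite eh' comp_lfun0r comp_lfun0l oppr0.
- by move=> w _.
- by move=> w _.
by move=> w _; apply: Htr_cls; apply: gequiv_translate.
Qed.

End Triples.

Lemma Htens_assoc U U' V V' W W' (x : Hhom U U') (y : Hhom V V') (z : Hhom W W') :
  @Htr k (tens_space (tens_space U V) W) (tens_space (tens_space U' V') W')
    (tens_space U (tens_space V W)) (tens_space U' (tens_space V' W'))
    (assoc_lf U V W) (assoc_lf U' V' W') (Htens (Htens x y) z) =
  Htens x (Htens y z).
Proof.
move: x; apply: Hhom_ext; [by move=> a x x'; rewrite !Htens_linl Htr_linear |
  by move=> a x x'; rewrite !Htens_linl | move=> s].
move: y; apply: Hhom_ext; [by move=> a x x'; rewrite Htens_linr !Htens_linl Htr_linear |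
  by move=> a x x'; rewrite !Htens_linl Htens_linr | move=> t].
move: z; apply: Hhom_ext; [by move=> a x x'; rewrite Htens_linr Htr_linear |
  by move=> a x x'; rewrite !Htens_linr | move=> r].
exact: Htens_assoc_cls.
Qed.

End Associativity.

(** * The unit object *)

Section Units.
Variable k : finFieldType.
Implicit Types U V W X Y Z : flagspace k.
Let one : flagspace k := unit_space k.

Lemma to_unit0 X (h : 'Hom(X, one)) : h = 0.
Proof. by apply/lfunP=> v; rewrite [LHS]zero_eq0 [RHS]zero_eq0. Qed.

Lemma of_unit0 X (h : 'Hom(one, X)) : h = 0.
Proof. by apply/lfunP=> v; rewrite (zero_eq0 v) !linear0. Qed.

Lemma card_singleton (T : finType) (x0 : T) (S : {set T}) :
  (forall x, x = x0) -> x0 \in S -> #|S| = 1%N.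
Proof.
move=> Tx Sx; apply/eqP/cards1P; exists x0; apply/setP=> x.
by rewrite (Tx x) Sx inE eqxx.
Qed.

Lemma card_homset_to_unit X i : #|homset X one i| = 1%N.
Proof. by apply: (card_singleton (x0 := 0)) => [h|]; [exact: to_unit0 | exact: homset0]. Qed.

Lemma card_homset_of_unit X i : #|homset one X i| = 1%N.
Proof. by apply: (card_singleton (x0 := 0)) => [h|]; [exact: of_unit0 | exact: homset0]. Qed.

Lemma altc1 X U : (forall i, #|homset X U i| = 1%N) -> altc X U = 1.
Proof.
move=> H; have [N /(_ N (leqnn _)) ->] := altcE X U; rewrite big1 // => i _.
by rewrite H spow1.
Qed.

Lemma comp_coef_unit : comp_coef one = 1.
Proof.
have [N /(_ N (leqnn _)) ->] := comp_coefE one; rewrite big1 // => i _.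
rewrite (card_singleton (x0 := 0)) ?spow1 // => [h|]; [exact: of_unit0 | exact: endset_lt0].
Qed.

Lemma card_automorphisms_unit : #|automorphisms one| = 1%N.
Proof.
apply: (@card_singleton (finvect_type 'End(one)) \1%VF) => [h|]; last exact/automorphismsP/fg_iso1.
by rewrite [LHS]of_unit0 [RHS]of_unit0.
Qed.

Lemma unit_diff : is_diff (0 : 'End(one)).
Proof.
by split; [exact: hdeg0 | move=> j; rewrite lim0g sub0v | exact: of_unit0].
Qed.

Lemma Hid_unit : Hid one = cls (id_qtriple unit_diff).
Proof.
rewrite /Hid comp_coef_unit card_automorphisms_unit mul1r invr1 scale1r.
rewrite (bigD1 (0 : finvect_type 'End(one))) /=; last exact/asboolP/unit_diff.
rewrite big1 ?addr0 => [|d /andP[_ /eqP[]]]; last exact: (of_unit0 (d : 'Hom(one, one))).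
exact: (clsr_id unit_diff).
Qed.

Lemma card_tens_exts U V X Y (s : qtriple U V) (t : qtriple X Y) :
  #|tens_exts s t| = #|ext_blocks s t|.
Proof.
rewrite -!sum1_card; exact: (sum_tens_exts s t (fun _ _ _ => 1%N)).
Qed.

Lemma Htens_unitl X Y (x : Hhom X Y) :
  @Htr k (tens_space one X) (tens_space one Y) X Y (lunit_lf one X) (lunit_lf one Y)
    (Htens (Hid one) x) = x.
Proof.
move: x; apply: Hhom_ext => [|//|s].
  by move=> a x y; rewrite Htens_linr Htr_linear.
rewrite Hid_unit Htens_cls tens_repE tens_coefE.
rewrite !(altc1 (card_homset_to_unit _)) card_homset_to_unit !mul1r invr1 scale1r.
(* All Hom spaces into or out of the zero object are trivial: the constants are 1, and there is
   exactly one extension. *)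
have /eqP/cards1P[u eT] : #|tens_exts (id_qtriple unit_diff) s| = 1%N.
  rewrite card_tens_exts card_ext_blocks.
  by rewrite !(card_singleton (x0 := 0)) ?cocycles0 ?coboundaries0 // => h; exact: to_unit0.
have /tens_extsP[[x ex] [y ey] [z ez]] : u \in tens_exts (id_qtriple unit_diff) s.
  by rewrite eT set11.
rewrite eT big_set1; apply: Htr_cls; split; try exact: fg_iso_lunit.
- by rewrite ex; apply: snd_ublock.
- by rewrite ez; apply: snd_ublock.
by apply: homotopic_eq; rewrite ey; apply: snd_ublock.
Qed.

Lemma fst_ublock_unit U V (a : 'Hom(U, V)) (b : 'Hom(one, V)) (c : 'Hom(one, one)) :
  (runit_lf V one \o ublock a b c)%VF = (a \o runit_lf U one)%VF.
Proof.
apply/lfunP=> p; rewrite !comp_lfunE !runit_lfE ublockE /=.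
by rewrite (zero_eq0 p.2) linear0 addr0.
Qed.

Lemma Htens_unitr X Y (x : Hhom X Y) :
  @Htr k (tens_space X one) (tens_space Y one) X Y (runit_lf X one) (runit_lf Y one)
    (Htens x (Hid one)) = x.
Proof.
move: x; apply: Hhom_ext => [|//|s].
  by move=> a x y; rewrite Htens_linl Htr_linear.
rewrite Hid_unit Htens_cls tens_repE tens_coefE.
rewrite !(altc1 (card_homset_of_unit _)) card_homset_of_unit !mul1r invr1 scale1r.
have /eqP/cards1P[u eT] : #|tens_exts s (id_qtriple unit_diff)| = 1%N.
  rewrite card_tens_exts card_ext_blocks.
  by rewrite !(card_singleton (x0 := 0)) ?cocycles0 ?coboundaries0 // => h; exact: of_unit0.
have /tens_extsP[[x ex] [y ey] [z ez]] : u \in tens_exts s (id_qtriple unit_diff).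
  by rewrite eT set11.
rewrite eT big_set1; apply: Htr_cls; split; try exact: fg_iso_runit.
- by rewrite ex; apply: fst_ublock_unit.
- by rewrite ez; apply: fst_ublock_unit.
by apply: homotopic_eq; rewrite ey; apply: fst_ublock_unit.
Qed.

End Units.

(** * Isomorphisms of objects as morphisms of the category *)

Section IsoMorphisms.
Variable k : finFieldType.
Implicit Types U V W X Y Z : flagspace k.

(** The structure morphisms of the theorem, written with [Htr] so that proofs of [fg_iso] do not
    occur in the term. *)
Definition Hiso V W (phi : 'Hom(V, W)) : Hhom V W := Htr \1%VF phi (Hid V).

Lemma Hiso1 V : Hiso (\1 : 'End(V))%VF = Hid V.
Proof. exact: Htr1. Qed.

Lemma Hiso_inv V W (phi : 'Hom(V, W)) : fg_iso phi ->
  Hiso phi = Htr phi^-1%VF \1%VF (Hid W).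
Proof.
move=> ip; rewrite -(Htr_id ip) Htr_Htr ?fg_iso_compVl ?comp_lfun1l //.
- exact: fg_iso_inv.
exact: fg_iso1.
Qed.

(** Transport commutes with composition, so it can be pulled out of the identity; naturality squares
    thereby become equalities of transports. *)
Lemma Hcomp_Hiso_l U V W (phi : 'Hom(V, W)) (x : Hhom U V) : fg_iso phi ->
  Hcomp (Hiso phi) x = Htr \1%VF phi x.
Proof.
move=> ip; rewrite -[x in LHS]Htr1 /Hiso Htr_comp ?Hcomp_idl //; exact: fg_iso1.
Qed.

Lemma Hcomp_Hiso_r V W X (phi : 'Hom(V, W)) (y : Hhom W X) : fg_iso phi ->
  Hcomp y (Hiso phi) = Htr phi^-1%VF \1%VF y.
Proof.
move=> ip; rewrite -[y in LHS]Htr1 (Hiso_inv ip) Htr_comp ?Hcomp_idr //.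
- exact: fg_iso_inv.
- exact: fg_iso1.
exact: fg_iso1.
Qed.

Lemma Hiso_comp U V W (phi : 'Hom(U, V)) (psi : 'Hom(V, W)) :
  fg_iso phi -> fg_iso psi -> Hcomp (Hiso psi) (Hiso phi) = Hiso (psi \o phi)%VF.
Proof.
move=> ip iq; rewrite Hcomp_Hiso_l // /Hiso Htr_Htr ?comp_lfun1l //; exact: fg_iso1.
Qed.

Lemma Hiso_tens U V X Y (phi : 'Hom(U, V)) (psi : 'Hom(X, Y)) :
  fg_iso phi -> fg_iso psi ->
  Htens (Hiso phi) (Hiso psi) =
  Hiso (ublock phi 0 psi : 'Hom(tens_space U X, tens_space V Y)).
Proof.
by move=> ip iq; rewrite /Hiso Htr_tens ?ublock1 ?Htens_id //; exact: fg_iso1.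
Qed.

Lemma Hiso_is_iso V W (phi : 'Hom(V, W)) : fg_iso phi ->
  is_iso (@Hid k) (@Hcomp k) (Hiso phi).
Proof.
move=> ip; have jp := fg_iso_inv ip; exists (Hiso phi^-1%VF).
by rewrite !Hiso_comp // fg_iso_compVl // fg_iso_compVr // !Hiso1.
Qed.

Lemma Hpush_id V W (phi : 'Hom(V, W)) (ip : fg_iso phi) : Hpush ip (Hid V) = Hiso phi.
Proof. exact: Hpush_Htr. Qed.

End IsoMorphisms.

Theorem proposition1p1 (k : finFieldType) :
  [/\ (* composition is well defined on equivalence classes *)
      forall (U V W : flagspace k) (t : qtriple V W) (s : qtriple U V),
        Hcomp (cls t) (cls s) = comp_rep t s,
      (* so is the monoidal product of morphisms *)
      forall (U V X Y : flagspace k) (s : qtriple U V) (t : qtriple X Y),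
        Htens (cls s) (cls t) = tens_rep s t
    & exists idm : forall V : flagspace k, Hhom V V,
        is_monoidal_category idm (@Hcomp k)
          (unit_space k) (@tens_space k) (@Htens k)
          (fun U V W => Hpush (fg_iso_assoc U V W)
                          (idm (tens_space (tens_space U V) W)))
          (fun V => Hpush (fg_iso_lunit V) (idm (tens_space (unit_space k) V)))
          (fun V => Hpush (fg_iso_runit V) (idm (tens_space V (unit_space k))))].
Proof.
split; [exact: Hcomp_cls | exact: Htens_cls | exists (@Hid k)].
have ia (U V W : flagspace k) := fg_iso_assoc U V W.
have il (V : flagspace k) := fg_iso_lunit V.
have ir (V : flagspace k) := fg_iso_runit V.
have i1 (V : flagspace k) := fg_iso1 V.
split.
- split; first exact: Hcomp_assoc.
    exact: Hcomp_idl.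
  exact: Hcomp_idr.
- exact: Htens_id.
- exact: Htens_comp.
- by move=> U V W; rewrite Hpush_id; apply: Hiso_is_iso.
- by move=> V; rewrite Hpush_id; apply: Hiso_is_iso.
- by move=> V; rewrite Hpush_id; apply: Hiso_is_iso.
- move=> U U' V V' W W' x y z; rewrite !Hpush_id.
  (* The right side transports along [assoc] on both ends and back at the source; only the transport
     at the target survives, as on the left. *)
  rewrite Hcomp_Hiso_l // Hcomp_Hiso_r // -Htens_assoc Htr_Htr ?fg_iso_compVl ?comp_lfun1l //.
  exact: fg_iso_inv.
- move=> V W x; rewrite !Hpush_id Hcomp_Hiso_l // Hcomp_Hiso_r //.
  rewrite -{2}(Htens_unitl x) Htr_Htr ?fg_iso_compVl ?comp_lfun1l //.
  exact: fg_iso_inv.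
- move=> V W x; rewrite !Hpush_id Hcomp_Hiso_l // Hcomp_Hiso_r //.
  rewrite -{2}(Htens_unitr x) Htr_Htr ?fg_iso_compVl ?comp_lfun1l //.
  exact: fg_iso_inv.
- move=> U V W X; rewrite !Hpush_id -(Hiso1 U) -(Hiso1 X).
  rewrite (Hiso_tens (i1 U) (ia V W X)) (Hiso_tens (ia U V W) (i1 X)).
  have iL := fg_iso_ublock (ia U V W) (hdeg0 _ _ _) (i1 X).
  have iR := fg_iso_ublock (i1 U) (hdeg0 _ _ _) (ia V W X).
  rewrite (Hiso_comp (ia (tens_space U V) W X) (ia U V (tens_space W X))).
  rewrite (Hiso_comp iL (ia U (tens_space V W) X)).
  rewrite (Hiso_comp (fg_iso_comp iL (ia U (tens_space V W) X)) iR).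
  apply: (congr1 (@Hiso k _ _)); apply/lfunP=> -[[[u v] w] x].
  rewrite !(comp_lfunE, ublockE, assoc_lfE, id_lfunE) /=.
  by rewrite !zero_lfunE /= !addr0.
move=> U V; rewrite !Hpush_id -(Hiso1 U) -(Hiso1 V).
rewrite (Hiso_tens (i1 U) (il V)) (Hiso_tens (ir U) (i1 V)).
have iR := fg_iso_ublock (i1 U) (hdeg0 _ _ _) (il V).
rewrite (Hiso_comp (ia U (unit_space k) V) iR).
apply: (congr1 (@Hiso k _ _)); apply/lfunP=> -[[u z] v].
rewrite !(comp_lfunE, ublockE, assoc_lfE, lunit_lfE, runit_lfE, id_lfunE, zero_lfunE) /=.
by [].
Qed.
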